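(* Let $q$ be a nonzero complex number which is not a root of unity. Let $\mu(u)=\sum_{r\ge0}\mu^{(r)}u^{-r}$ and $\bar\mu(u)=\sum_{r\ge 0}\bar\mu^{(r)}u^r$ be formal power series with complex coefficients, and let $V(\mu(u);\bar\mu(u))$ be the irreducible highest weight representation of $\mathrm{Y}'_q(\mathfrak{sp}_2)$ with highest weight $(\mu(u);\bar\mu(u))$. Then $V(\mu(u);\bar\mu(u))$ is finite-dimensional if and only if there exists a polynomial $P(u)$ in $u$ of even degree with constant term $1$ such that $u^{\deg P}P(u^{-1})=q^{-\deg P}P(uq^2)$ and $$\frac{\bar\mu(u^{-1})}{\mu(u)}=q^{-\deg P}\,\frac{P(uq^2)}{P(u)}$$ (as power series in $u^{-1}$). In this case $P(u)$ is unique.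
   Context: Let $E_{ij}$ denote matrix units. $R(u,v)=(u-v)\sum_{i\ne j}E_{ii}\otimes E_{jj}+(q^{-1}u-qv)\sum_i E_{ii}\otimes E_{ii}+(q^{-1}-q)u\sum_{i>j}E_{ij}\otimes E_{ji}+(q^{-1}-q)v\sum_{i<j}E_{ij}\otimes E_{ji}$ (indices in $\{1,2\}$). The algebra $\mathrm{U}^{\rm ext}_q(\widehat{\mathfrak{gl}}_2)$ has generators $t_{ij}^{(r)},\bar t_{ij}^{(r)}$ ($i,j\in\{1,2\}$, $r\ge0$) and $(t_{ii}^{(0)})^{-1},(\bar t_{ii}^{(0)})^{-1}$; with $t_{ij}(u)=\sum_r t_{ij}^{(r)}u^{-r}$, $\bar t_{ij}(u)=\sum_r\bar t_{ij}^{(r)}u^r$, $T(u)=\sum t_{ij}(u)\otimes E_{ij}$, $\overline T(u)=\sum \bar t_{ij}(u)\otimes E_{ij}$, relations: $t_{12}^{(0)}=\bar t_{21}^{(0)}=0$; $t_{ii}^{(0)}\bar t_{ii}^{(0)}=\bar t_{ii}^{(0)}t_{ii}^{(0)}$; the listed inverses are two-sided inverses; $R(u,v)T_1(u)T_2(v)=T_2(v)T_1(u)R(u,v)$, $R(u,v)\overline T_1(u)\overline T_2(v)=\overline T_2(v)\overline T_1(u)R(u,v)$, $R(u,v)\overline T_1(u)T_2(v)=T_2(v)\overline T_1(u)R(u,v)$. $\mathrm{Y}'_q(\mathfrak{sp}_2)$ is the subalgebra generated by the coefficients $s_{ij}^{(r)}$ of $s_{ij}(u)=q\,t_{i1}(u)\bar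 t_{j2}(u^{-1})-t_{i2}(u)\bar t_{j1}(u^{-1})=\sum_{r\ge0}s_{ij}^{(r)}u^{-r}$ together with $(s_{12}^{(0)})^{-1}$ (where $s_{12}^{(0)}=q\,t_{11}^{(0)}\bar t_{22}^{(0)}$). Also $\bar s_{ij}(u)=q\,\bar t_{i1}(u)t_{j2}(u^{-1})-\bar t_{i2}(u)t_{j1}(u^{-1})$, a power series in $u$ with coefficients in $\mathrm{Y}'_q(\mathfrak{sp}_2)$. A highest weight representation with highest weight $(\mu(u);\bar\mu(u))$ is one generated by a nonzero $\xi$ with $s_{11}(u)\xi=0$, $s_{21}(u)\xi=\mu(u)\xi$, $\bar s_{21}(u)\xi=\bar\mu(u)\xi$. The Verma module is the quotient of $\mathrm{Y}'_q(\mathfrak{sp}_2)$ by the left ideal generated by the coefficients of $s_{11}(u)$, $s_{21}(u)-\mu(u)$, $\bar s_{21}(u)-\bar\mu(u)$; it has a unique maximal proper submodule, and $V(\mu(u);\bar\mu(u))$ is the irreducible quotient. *)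

(* Defs.v *)
From HB Require Import structures.
From mathcomp Require Import all_boot all_order all_algebra.
From mathcomp Require Import complex Rstruct.
Set Implicit Arguments. Unset Strict Implicit. Unset Printing Implicit Defensive.
Import Order.TTheory GRing.Theory Num.Theory.
Local Open Scope ring_scope.

Definition C : fieldType := (Rdefinitions.R)[i].

(* Matrix indices 1,2 are encoded as the ordinals 0,1 of 'I_2. *)
Definition o1 : 'I_2 := ord0.
Definition o2 : 'I_2 := ord_max.

(* The R-matrix R(u,v) = sum_{i,k,a,b} R_{(i,k),(a,b)}(u,v) E_ia (x) E_kb, whose
   entries are linear in u,v: R_{(i,k),(a,b)}(u,v) = Ral i k a b * u + Rbe i k a b * v. *)
Definition Ral (q : C) (i k a b : 'I_2) : C :=
  if (i == a) && (k == b) then (if i == k then q^-1 else 1)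
  else if [&& i == b, k == a & (k < i)%N] then q^-1 - q else 0.
Definition Rbe (q : C) (i k a b : 'I_2) : C :=
  if (i == a) && (k == b) then (if i == k then - q else - 1)
  else if [&& i == b, k == a & (i < k)%N] then q^-1 - q else 0.

Definition pc (A : algType C) (f : nat -> A) (n : nat) : A :=
  if n is m.+1 then f m else 0.

(* Entry (i,k),(j,l) of the matrix identity  R X_1 Y_2 = Y_2 X_1 R, after extracting
   one coefficient: Xa,Ya are the coefficients of X,Y multiplying the u-part of R,
   Xb,Yb those multiplying the v-part of R (u is the variable of X, v that of Y). *)
Definition rtt_entry (q : C) (A : algType C) (Xa Ya Xb Yb : 'I_2 -> 'I_2 -> A)
  (i j k l : 'I_2) : Prop :=
  \sum_(a < 2) \sum_(b < 2)
     (Ral q i k a b *: (Xa a j * Ya b l) + Rbe q i k a b *: (Xb a j * Yb b l))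
  = \sum_(a < 2) \sum_(b < 2)
     (Ral q a b j l *: (Ya k b * Xa i a) + Rbe q a b j l *: (Yb k b * Xb i a)).

Definition Uext_rels (q : C) (A : algType C) (t tb : 'I_2 -> 'I_2 -> nat -> A)
  (ti tbi : 'I_2 -> A) : Prop :=
  [/\ t o1 o2 0%N = 0, tb o2 o1 0%N = 0,
      (forall i, t i i 0%N * tb i i 0%N = tb i i 0%N * t i i 0%N),
      (forall i, [/\ t i i 0%N * ti i = 1, ti i * t i i 0%N = 1,
                    tb i i 0%N * tbi i = 1 & tbi i * tb i i 0%N = 1]) &
      forall (r s : nat) (i j k l : 'I_2),
        (* R(u,v) T_1(u) T_2(v) = T_2(v) T_1(u) R(u,v): coefficient of u^(1-r) v^(1-s) *)
        [/\ rtt_entry q (fun a b => t a b r) (fun a b => pc (t a b) s)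
                        (fun a b => pc (t a b) r) (fun a b => t a b s) i j k l,
        (* R(u,v) Tb_1(u) Tb_2(v) = Tb_2(v) Tb_1(u) R(u,v): coefficient of u^r v^s *)
            rtt_entry q (fun a b => pc (tb a b) r) (fun a b => tb a b s)
                        (fun a b => tb a b r) (fun a b => pc (tb a b) s) i j k l &
        (* R(u,v) Tb_1(u) T_2(v) = T_2(v) Tb_1(u) R(u,v): coefficient of u^r v^(1-s) *)
            rtt_entry q (fun a b => pc (tb a b) r) (fun a b => pc (t a b) s)
                        (fun a b => tb a b r) (fun a b => t a b s) i j k l]].

Definition alg_hom (A B : algType C) (f : A -> B) : Prop :=
  [/\ forall x y, f (x + y) = f x + f y,
      forall (c : C) x, f (c *: x) = c *: f x,
      forall x y, f (x * y) = f x * f y & f 1 = 1].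

Definition is_Uext (q : C) (A : algType C) (t tb : 'I_2 -> 'I_2 -> nat -> A)
  (ti tbi : 'I_2 -> A) : Prop :=
  Uext_rels q t tb ti tbi /\
  forall (B : algType C) (t' tb' : 'I_2 -> 'I_2 -> nat -> B) (ti' tbi' : 'I_2 -> B),
    Uext_rels q t' tb' ti' tbi' ->
    exists f : A -> B,
      [/\ alg_hom f,
          (forall i j r, f (t i j r) = t' i j r /\ f (tb i j r) = tb' i j r),
          (forall i, f (ti i) = ti' i /\ f (tbi i) = tbi' i) &
          forall g : A -> B, alg_hom g ->
            (forall i j r, g (t i j r) = t' i j r /\ g (tb i j r) = tb' i j r) ->
            (forall i, g (ti i) = ti' i /\ g (tbi i) = tbi' i) ->
            forall x, g x = f x].

(* Coefficients: s_ij(u) = sum_r s_ij^(r) u^-r, sbar_ij(u) = sum_r sbar_ij^(r) u^r. *)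
Definition s_coef (q : C) (A : algType C) (t tb : 'I_2 -> 'I_2 -> nat -> A)
  (i j : 'I_2) (r : nat) : A :=
  \sum_(a < r.+1) (q *: (t i o1 a * tb j o2 (r - a)%N) - t i o2 a * tb j o1 (r - a)%N).
Definition sb_coef (q : C) (A : algType C) (t tb : 'I_2 -> 'I_2 -> nat -> A)
  (i j : 'I_2) (r : nat) : A :=
  \sum_(a < r.+1) (q *: (tb i o1 a * t j o2 (r - a)%N) - tb i o2 a * t j o1 (r - a)%N).
(* The two-sided inverse of s_12^(0) = q t_11^(0) tbar_22^(0). *)
Definition s12inv (q : C) (A : algType C) (ti tbi : 'I_2 -> A) : A :=
  q^-1 *: (tbi o2 * ti o1).

Definition subalg (A : algType C) (S : A -> Prop) : Prop :=
  [/\ S 1, forall x y, S x -> S y -> S (x + y),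
      forall (c : C) x, S x -> S (c *: x) & forall x y, S x -> S y -> S (x * y)].

Definition Yq (q : C) (A : algType C) (t tb : 'I_2 -> 'I_2 -> nat -> A)
  (ti tbi : 'I_2 -> A) (x : A) : Prop :=
  forall S : A -> Prop, subalg S ->
    (forall i j r, S (s_coef q t tb i j r)) -> S (s12inv q ti tbi) -> S x.

Definition left_ideal (A : algType C) (Y N : A -> Prop) : Prop :=
  [/\ forall x, N x -> Y x, N 0, forall x y, N x -> N y -> N (x + y) &
      forall y x, Y y -> N x -> N (y * x)].

Definition verma_ideal (q : C) (A : algType C) (t tb : 'I_2 -> 'I_2 -> nat -> A)
  (ti tbi : 'I_2 -> A) (mu mub : nat -> C) (x : A) : Prop :=
  forall N : A -> Prop, left_ideal (Yq q t tb ti tbi) N ->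
    (forall r, N (s_coef q t tb o1 o1 r)) ->
    (forall r, N (s_coef q t tb o2 o1 r - mu r *: 1)) ->
    (forall r, N (sb_coef q t tb o2 o1 r - mub r *: 1)) -> N x.

(* Submodules of M = Y'/I correspond to left ideals N of Y' with I <= N; such a
   submodule is proper iff 1 (the class of which is the generator xi) is not in N. *)
Definition proper_sub (q : C) (A : algType C) (t tb : 'I_2 -> 'I_2 -> nat -> A)
  (ti tbi : 'I_2 -> A) (mu mub : nat -> C) (N : A -> Prop) : Prop :=
  [/\ left_ideal (Yq q t tb ti tbi) N,
      (forall x, verma_ideal q t tb ti tbi mu mub x -> N x) & ~ N 1].

Definition max_sub (q : C) (A : algType C) (t tb : 'I_2 -> 'I_2 -> nat -> A)
  (ti tbi : 'I_2 -> A) (mu mub : nat -> C) (x : A) : Prop :=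
  forall S : A -> Prop, S 0 -> (forall x y, S x -> S y -> S (x + y)) ->
    (forall N, proper_sub q t tb ti tbi mu mub N -> forall y, N y -> S y) -> S x.

(* V(mu(u); mub(u)) = Y'/J (J = max_sub) is finite-dimensional over C:
   Y' is spanned by finitely many elements modulo J. *)
Definition V_findim (q : C) (A : algType C) (t tb : 'I_2 -> 'I_2 -> nat -> A)
  (ti tbi : 'I_2 -> A) (mu mub : nat -> C) : Prop :=
  exists (n : nat) (v : 'I_n -> A),
    (forall k, Yq q t tb ti tbi (v k)) /\
    forall y, Yq q t tb ti tbi y ->
      exists c : 'I_n -> C, max_sub q t tb ti tbi mu mub (y - \sum_(k < n) c k *: v k).

Definition revp (P : {poly C}) : {poly C} :=
  \poly_(k < size P) P`_((size P).-1 - k).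

Definition ser_mul (f g : nat -> C) (r : nat) : C :=
  \sum_(a < r.+1) f a * g (r - a)%N.

(* The condition on P in Theorem 4.6.  Writing d = deg P:
   - d is even and P(0) = 1;
   - u^d P(u^-1) = q^-d P(u q^2);
   - mub(u^-1)/mu(u) = q^-d P(u q^2)/P(u) as power series in w = u^-1.  Here
     mub(u^-1) = sum_r mub_r w^r, mu(u) = sum_r mu_r w^r, and multiplying the
     numerator and denominator of the right side by w^d gives the polynomials
     revp (P(q^2 X)) and revp P in w; the quotient by mu(u) in C[[w]] exists iff
     mu_0 <> 0, and then the identity is equivalent to the cross-multiplied one. *)
Definition good_P (q : C) (mu mub : nat -> C) (P : {poly C}) : Prop :=
  let d := (size P).-1 in
  let Pq := P \Po (q ^+ 2 *: 'X) in
  [/\ ~~ odd d, P`_0 = 1,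
      revp P = q ^- d *: Pq,
      mu 0%N != 0 &
      forall r, ser_mul mub (fun k => (revp P)`_k) r
                = q ^- d * ser_mul mu (fun k => (revp Pq)`_k) r].

(* Main.v *)
Require Import Defs.
From HB Require Import structures.
From mathcomp Require Import all_boot all_order all_algebra.
From mathcomp Require Import perm complex Rstruct boolp ring.
Set Implicit Arguments. Unset Strict Implicit. Unset Printing Implicit Defensive.
Import Order.TTheory GRing.Theory Num.Theory.
Local Open Scope ring_scope.

Definition trivext (K : comNzRingType) (V : lmodType K) : Type := (K * V)%type.

Section TrivExt.
Variables (K : comNzRingType) (V : lmodType K).
Local Notation E := (trivext V).
HB.instance Definition _ := GRing.Zmodule.on E.
Definition trivext_mul (x y : E) : E := (x.1 * y.1, x.1 *: y.2 + y.1 *: x.2).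
Fact trivext_mulA : associative trivext_mul.
Proof.
move=> [a u] [b v] [c w]; rewrite /trivext_mul /=; congr (_, _); rewrite ?mulrA //.
by rewrite !scalerDr !scalerA !addrA (mulrC c) (mulrC c).
Qed.
Fact trivext_mulC : commutative trivext_mul.
Proof. by move=> [a u] [b v]; rewrite /trivext_mul /= mulrC addrC. Qed.
Fact trivext_mul1 : left_id ((1, 0) : E) trivext_mul.
Proof. by move=> [a u]; rewrite /trivext_mul /= mul1r scale1r scaler0 addr0. Qed.
Fact trivext_mulDl : left_distributive trivext_mul +%R.
Proof.
move=> [a u] [b v] [c w]; rewrite /trivext_mul /= -[LHS]/(_, _).
congr (_, _) => /=; first by rewrite mulrDl.
by rewrite scalerDl scalerDr addrACA.
Qed.
Fact trivext_oner_neq0 : ((1, 0) : E) != 0.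
Proof. by apply/eqP => -[/eqP]; rewrite oner_eq0. Qed.
HB.instance Definition _ := GRing.Zmodule_isComNzRing.Build E
  trivext_mulA trivext_mulC trivext_mul1 trivext_mulDl trivext_oner_neq0.

Definition tscal (a : K) : E := (a, 0).
Definition tvec (u : V) : E := (0, u).
Fact tscal_is_additive : {morph tscal : a b / a - b}.
Proof. by move=> a b; congr (_, _) => /=; rewrite subr0. Qed.
HB.instance Definition _ := GRing.isZmodMorphism.Build K E tscal tscal_is_additive.
Fact tscal_is_monoid : monoid_morphism tscal.
Proof. by split=> // a b; congr (_, _) => /=; rewrite !scaler0 addr0. Qed.
HB.instance Definition _ := GRing.isMonoidMorphism.Build K E tscal tscal_is_monoid.
Fact tvec_is_additive : {morph tvec : u v / u - v}.
Proof. by move=> u v; congr (_, _) => /=; rewrite subr0. Qed.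
HB.instance Definition _ := GRing.isZmodMorphism.Build V E tvec tvec_is_additive.
Lemma tvecD u v : tvec (u + v) = tvec u + tvec v. Proof. exact: raddfD. Qed.
Lemma tvecB u v : tvec (u - v) = tvec u - tvec v. Proof. exact: raddfB. Qed.
Lemma tvecN u : tvec (- u) = - tvec u. Proof. exact: raddfN. Qed.
Lemma tvec0 : tvec 0 = 0. Proof. exact: raddf0. Qed.
Lemma tvecZ a u : tvec (a *: u) = tscal a * tvec u.
Proof. by congr (_, _) => /=; rewrite ?mulr0 // scale0r addr0. Qed.
Lemma tvec_inj : injective tvec.
Proof. by move=> u v []. Qed.
End TrivExt.

(* Square-zero extensions turn linear identities in a module into commutative ring identities. *)
Ltac linring_pre := apply: tvec_inj; rewrite ?(tvecD, tvecB, tvecN, tvec0, tvecZ).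
Ltac linring := linring_pre; ring.

Lemma lin_comb (K : comNzRingType) (V : lmodType K) (c : K) (u v l r : V) :
  l = r -> u - v = c *: (l - r) -> u = v.
Proof. by move=> ->; rewrite subrr scaler0 => /subr0_eq. Qed.

Record pser (R : Type) := Pser { pcoef : nat -> R }.

HB.instance Definition _ (R : Type) := gen_eqMixin (pser R).
HB.instance Definition _ (R : Type) := gen_choiceMixin (pser R).

Lemma pserP (R : Type) (f g : pser R) : pcoef f =1 pcoef g -> f = g.
Proof. by case: f g => [f] [g] /= /funext ->. Qed.

HB.lock Definition pser_add (R : zmodType) (f g : pser R) : pser R :=
  Pser (fun n => pcoef f n + pcoef g n).
HB.lock Definition pser_opp (R : zmodType) (f : pser R) : pser R := Pser (fun n => - pcoef f n).

Section PserZmod.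
Variable R : zmodType.
Implicit Types f g : pser R.
Fact pser_addA : associative (@pser_add R).
Proof. by move=> f g k; apply: pserP => n; rewrite !pser_add.unlock /= addrA. Qed.
Fact pser_addC : commutative (@pser_add R).
Proof. by move=> f g; apply: pserP => n; rewrite !pser_add.unlock /= addrC. Qed.
Fact pser_add0 : left_id (Pser (fun=> 0)) (@pser_add R).
Proof. by move=> f; apply: pserP => n; rewrite pser_add.unlock /= add0r. Qed.
Fact pser_addN : left_inverse (Pser (fun=> 0)) (@pser_opp R) (@pser_add R).
Proof. by move=> f; apply: pserP => n; rewrite pser_add.unlock pser_opp.unlock /= addNr. Qed.
HB.instance Definition _ := GRing.isZmodule.Build (pser R)
  pser_addA pser_addC pser_add0 pser_addN.
Lemma pcoefD f g n : pcoef (f + g) n = pcoef f n + pcoef g n.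
Proof. by rewrite -[f + g]/(pser_add f g) pser_add.unlock. Qed.
Lemma pcoefN f n : pcoef (- f) n = - pcoef f n.
Proof. by rewrite -[- f]/(pser_opp f) pser_opp.unlock. Qed.
Lemma pcoefB f g n : pcoef (f - g) n = pcoef f n - pcoef g n.
Proof. by rewrite pcoefD pcoefN. Qed.
Lemma pcoef0 n : pcoef (0 : pser R) n = 0. Proof. by []. Qed.
End PserZmod.

HB.lock Definition pser_mul (R : nzRingType) (f g : pser R) : pser R :=
  Pser (fun n => \sum_(i < n.+1) pcoef f i * pcoef g (n - i)).

Section PserRing.
Variable R : nzRingType.
Implicit Types f g : pser R.
Definition pser_const (c : R) := Pser (fun n => if n is 0%N then c else 0).
Definition ptrunc N f : {poly R} := \poly_(i < N) pcoef f i.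

Lemma ptrunc_mul N f g n : (n < N)%N -> pcoef (pser_mul f g) n = (ptrunc N f * ptrunc N g)`_n.
Proof.
move=> nN; rewrite pser_mul.unlock coefM /=; apply: eq_bigr => i _.
by rewrite !coef_poly (leq_ltn_trans _ nN) ?leq_ord // (leq_ltn_trans (leq_subr _ _) nN).
Qed.

Fact pser_mulA : associative (@pser_mul R).
Proof.
move=> f g k; apply: pserP => n.
have E u v : pcoef (pser_mul u v) n = (ptrunc n.+1 u * ptrunc n.+1 v)`_n.
  exact: ptrunc_mul.
have T u v m : (m <= n)%N -> (ptrunc n.+1 (pser_mul u v))`_m = (ptrunc n.+1 u * ptrunc n.+1 v)`_m.
  by move=> mn; rewrite coef_poly ltnS mn (@ptrunc_mul n.+1).
rewrite !E.
transitivity (ptrunc n.+1 f * (ptrunc n.+1 g * ptrunc n.+1 k))`_n.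
  by rewrite !(coefM (ptrunc _ f)); apply: eq_bigr => i _; rewrite T ?leq_subr.
by rewrite mulrA !(coefM _ (ptrunc _ k)); apply: eq_bigr => i _; rewrite T // -ltnS.
Qed.
Fact pser_mul1 : left_id (pser_const 1) (@pser_mul R).
Proof.
move=> f; apply: pserP => n; rewrite pser_mul.unlock /= big_ord_recl /= mul1r subn0.
by rewrite big1 ?addr0 // => i _; rewrite mul0r.
Qed.
Fact pser_mulr1 : right_id (pser_const 1) (@pser_mul R).
Proof.
move=> f; apply: pserP => n; rewrite pser_mul.unlock /= big_ord_recr /= subnn mulr1.
by rewrite big1 ?add0r // => i _; case: (n - i)%N (subn_gt0 i n) => [|m]; rewrite ?ltn_ord ?mulr0.
Qed.
Fact pser_mulDl : left_distributive (@pser_mul R) +%R.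
Proof.
move=> f g k; apply: pserP => n; rewrite pcoefD !pser_mul.unlock /= -big_split /=.
by apply: eq_bigr => i _; rewrite pcoefD mulrDl.
Qed.
Fact pser_mulDr : right_distributive (@pser_mul R) +%R.
Proof.
move=> f g k; apply: pserP => n; rewrite pcoefD !pser_mul.unlock /= -big_split /=.
by apply: eq_bigr => i _; rewrite pcoefD mulrDr.
Qed.
Fact pser_oner_neq0 : pser_const 1 != 0.
Proof. by apply/eqP => /(congr1 (fun f => pcoef f 0%N)) /= /eqP; rewrite oner_eq0. Qed.
HB.instance Definition _ := GRing.Zmodule_isNzRing.Build (pser R)
  pser_mulA pser_mul1 pser_mulr1 pser_mulDl pser_mulDr pser_oner_neq0.

Lemma pcoefM f g n : pcoef (f * g) n = \sum_(i < n.+1) pcoef f i * pcoef g (n - i).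
Proof. by rewrite -[f * g]/(pser_mul f g) pser_mul.unlock. Qed.

Lemma pcoefMr f g n : pcoef (f * g) n = \sum_(i < n.+1) pcoef f (n - i) * pcoef g i.
Proof.
rewrite pcoefM (reindex_inj rev_ord_inj) /=; apply: eq_bigr => i _.
by rewrite subSS subKn // -ltnS.
Qed.

Fact pser_const_is_additive : {morph pser_const : x y / x - y}.
Proof. by move=> x y; apply: pserP => -[|n]; rewrite pcoefB //= subr0. Qed.
HB.instance Definition _ := GRing.isZmodMorphism.Build R (pser R) pser_const pser_const_is_additive.

Lemma pcoef_constM c f n : pcoef (pser_const c * f) n = c * pcoef f n.
Proof.
rewrite pcoefM big_ord_recl /= subn0 big1 ?addr0 // => i _; exact: mul0r.
Qed.
Lemma pcoef_Mconst c f n : pcoef (f * pser_const c) n = pcoef f n * c.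
Proof.
rewrite pcoefMr big_ord_recl /= subn0 big1 ?addr0 // => i _; exact: mulr0.
Qed.

Fact pser_const_is_monoid : monoid_morphism pser_const.
Proof.
split=> // x y; apply: pserP => n; rewrite pcoef_constM.
by case: n => //= n; rewrite mulr0.
Qed.
HB.instance Definition _ := GRing.isMonoidMorphism.Build R (pser R) pser_const pser_const_is_monoid.

Definition pvar : pser R := Pser (fun n => (n == 1%N)%:R).
Lemma pcoef_varM f n : pcoef (pvar * f) n = if n is m.+1 then pcoef f m else 0.
Proof.
rewrite pcoefM; case: n => [|n]; first by rewrite big_ord1 /= mul0r.
rewrite big_ord_recl /= mul0r add0r big_ord_recl /= mul1r subSS subn0.
by rewrite big1 ?addr0 // => i _; rewrite mul0r.
Qed.
Lemma pvar_comm f : f * pvar = pvar * f.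
Proof.
apply: pserP => n; rewrite pcoef_varM pcoefMr; case: n => [|n].
  by rewrite big_ord1 /= mulr0.
rewrite big_ord_recl /= mulr0 add0r big_ord_recl /= mulr1 subSS subn0.
by rewrite big1 ?addr0 // => i _; rewrite mulr0.
Qed.
End PserRing.

Section PserMap.
Variables (R S : nzRingType) (phi : {rmorphism R -> S}).
Definition psmap (f : pser R) : pser S := Pser (fun n => phi (pcoef f n)).
Fact psmap_is_additive : {morph psmap : x y / x - y}.
Proof. by move=> x y; apply: pserP => n; rewrite pcoefB /= pcoefB rmorphB. Qed.
HB.instance Definition _ := GRing.isZmodMorphism.Build (pser R) (pser S) psmap psmap_is_additive.
Fact psmap_is_monoid : monoid_morphism psmap.
Proof.
split=> [|x y]; apply: pserP => n; last first.
  rewrite /= pcoefM [RHS]pcoefM rmorph_sum; apply: eq_bigr => i _.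
  by rewrite rmorphM.
by case: n => [|n] /=; rewrite ?rmorph1 ?rmorph0.
Qed.
HB.instance Definition _ := GRing.isMonoidMorphism.Build (pser R) (pser S) psmap psmap_is_monoid.
End PserMap.

Section PserCom.
Variable R : comNzRingType.
Fact pser_mulC : commutative (@pser_mul R).
Proof.
move=> f g; apply: pserP => n; rewrite -[LHS]/(pcoef (f * g) n) pcoefMr.
rewrite -[RHS]/(pcoef (g * f) n) pcoefM.
by apply: eq_bigr => i _; rewrite mulrC.
Qed.
HB.instance Definition _ := GRing.PzRing_hasCommutativeMul.Build (pser R) pser_mulC.
End PserCom.

Section PserIdomain.
Variable R : idomainType.
Implicit Types f g : pser R.
Definition pser_unit : {pred (pser R)} := [pred f | `[< exists g, g * f = 1 >]].
Definition pser_inv f := if pselect (exists g, g * f = 1) is left p then projT1 (cid p) else f.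
Fact pser_mulVx : {in pser_unit, left_inverse 1 pser_inv *%R}.
Proof.
move=> f /asboolP fU; rewrite /pser_inv; case: pselect => // p.
by case: (cid p).
Qed.
Fact pser_unitPl f g : g * f = 1 -> pser_unit f.
Proof. by move=> gf; apply/asboolP; exists g. Qed.
Fact pser_invr_out : {in [predC pser_unit], pser_inv =1 id}.
Proof. by move=> f /asboolP fU; rewrite /pser_inv; case: pselect. Qed.
HB.instance Definition _ := GRing.ComNzRing_hasMulInverse.Build (pser R)
  pser_mulVx pser_unitPl pser_invr_out.

Lemma pser_neq0P f : reflect (exists n, pcoef f n != 0 /\ forall m, (m < n)%N -> pcoef f m = 0) (f != 0).
Proof.
apply: (iffP idP) => [f0|[n [fn _]]]; last by apply: contraNneq fn => ->.
have ex : exists n, pcoef f n != 0.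
  apply: contrapT => /forallNP fz; move/eqP: f0; apply; apply: pserP => n.
  by apply/eqP; move: (fz n); case: eqP.
case: (ex_minnP ex) => n fn nmin; exists n; split=> // m mn.
by apply: contraTeq mn => /nmin; rewrite -leqNgt.
Qed.

Fact pser_integral : GRing.integral_domain_axiom (pser R).
Proof.
move=> f g fg0; apply: contraPT (congr1 (fun u => pcoef u) fg0).
rewrite negb_or => /andP[/pser_neq0P[n [fn fz]] /pser_neq0P[m [gm gz]]].
move=> /(congr1 (fun u => u (n + m)%N)); rewrite pcoefM.
have nlt : (n < (n + m).+1)%N by rewrite ltnS leq_addr.
rewrite (bigD1 (Ordinal nlt)) //= addKn big1 ?addr0 => [/eqP|i].
  by rewrite mulf_eq0 (negPf fn) (negPf gm).
rewrite -val_eqE /= neq_ltn => /orP[/fz -> |ni]; first exact: mul0r.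
by rewrite gz ?mulr0 // ltn_subLR ?ltn_add2r // -ltnS ltn_ord.
Qed.
HB.instance Definition _ := GRing.ComUnitRing_isIntegral.Build (pser R) pser_integral.
End PserIdomain.

HB.lock Definition ten1 (K : nzRingType) (t : 'M[K]_2) : 'M['M[K]_2]_2 :=
  \matrix_(i, j) (t i j)%:M.
HB.lock Definition ten2 (K : nzRingType) (t : 'M[K]_2) : 'M['M[K]_2]_2 := t%:M.
HB.lock Definition tenR (K : nzRingType) (sc : C -> K) (q : C) (U V : K) : 'M['M[K]_2]_2 :=
  \matrix_(i, a) \matrix_(k, b) (sc (Ral q i k a b) * U + sc (Rbe q i k a b) * V).
HB.lock Definition tentr (K : nzRingType) (Z : 'M['M[K]_2]_2) : 'M['M[K]_2]_2 :=
  \matrix_(i, a) \matrix_(k, b) Z a i k b.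

Section Tensors.
Variable K : nzRingType.
Local Notation M4 := 'M['M[K]_2]_2.
Implicit Types (t : 'M[K]_2) (Z : M4).
Lemma ten1E t i j k l : ten1 t i j k l = t i j *+ (k == l).
Proof. by rewrite unlock !mxE. Qed.
Lemma ten2E t i j k l : ten2 t i j k l = t k l *+ (i == j).
Proof. by rewrite unlock mxE; case: eqP => // _; rewrite mxE. Qed.
Lemma tenRE (sc : C -> K) q U V i a k b :
  tenR sc q U V i a k b = sc (Ral q i k a b) * U + sc (Rbe q i k a b) * V.
Proof. by rewrite unlock !mxE. Qed.
Lemma tentrE Z i a k b : tentr Z i a k b = Z a i k b.
Proof. by rewrite unlock !mxE. Qed.

Lemma ten4E Z Z' : Z = Z' -> forall i j k l, Z i j k l = Z' i j k l.
Proof. by move=> ->. Qed.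
Lemma ten4P Z Z' : (forall i j k l, Z i j k l = Z' i j k l) -> Z = Z'.
Proof. by move=> ZZ; apply/matrixP => i j; apply/matrixP => k l. Qed.

Lemma mul_ten4 Z Z' i j k l : (Z * Z') i j k l = \sum_a \sum_b Z i a k b * Z' a j b l.
Proof. by rewrite mxE summxE; apply: eq_bigr => a _; rewrite mxE. Qed.

Lemma mulr_ten1 Z t i j k l : (Z * ten1 t) i j k l = \sum_a Z i a k l * t a j.
Proof.
rewrite mul_ten4; apply: eq_bigr => a _; rewrite (bigD1 l) //= ten1E eqxx.
by rewrite mulr1n big1 ?addr0 // => b bl; rewrite ten1E (negPf bl) mulr0.
Qed.
Lemma mull_ten1 Z t i j k l : (ten1 t * Z) i j k l = \sum_a t i a * Z a j k l.
Proof.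
rewrite mul_ten4; apply: eq_bigr => a _; rewrite (bigD1 k) //= ten1E eqxx.
by rewrite mulr1n big1 ?addr0 // => b bl; rewrite ten1E eq_sym (negPf bl) mul0r.
Qed.
Lemma mulr_ten2 Z t i j k l : (Z * ten2 t) i j k l = \sum_b Z i j k b * t b l.
Proof.
rewrite mul_ten4 (bigD1 j) //= [X in _ + X]big1 => [|a aj].
  by rewrite addr0; apply: eq_bigr => b _; rewrite ten2E eqxx.
by rewrite big1 // => b _; rewrite ten2E (negPf aj) mulr0.
Qed.
Lemma mull_ten2 Z t i j k l : (ten2 t * Z) i j k l = \sum_b t k b * Z i j b l.
Proof.
rewrite mul_ten4 (bigD1 i) //= [X in _ + X]big1 => [|a aj].
  by rewrite addr0; apply: eq_bigr => b _; rewrite ten2E eqxx.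
by rewrite big1 // => b _; rewrite ten2E eq_sym (negPf aj) mul0r.
Qed.

Lemma ten1M t t' : ten1 (t * t') = ten1 t * ten1 t'.
Proof.
apply: ten4P => i j k l; rewrite mull_ten1 ten1E mxE.
case: eqP => [->|kl].
  by rewrite mulr1n; apply: eq_bigr => a _; rewrite ten1E eqxx.
by rewrite mulr0n big1 // => a _; rewrite ten1E (introF eqP kl) mulr0.
Qed.
Lemma ten2M t t' : ten2 (t * t') = ten2 t * ten2 t'.
Proof. by rewrite !ten2.unlock; apply: scalar_mxM. Qed.

Lemma ten12C t t' : (forall i j k l, t i j * t' k l = t' k l * t i j) ->
  ten1 t * ten2 t' = ten2 t' * ten1 t.
Proof.
move=> tt; apply: ten4P => i j k l; rewrite mulr_ten2 mull_ten2.
rewrite (bigD1 k) //= big1 ?addr0 => [|b bk]; last by rewrite ten1E eq_sym (negPf bk) mul0r.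
rewrite (bigD1 l) //= big1 ?addr0 => [|b bl]; last by rewrite ten1E (negPf bl) mulr0.
by rewrite !ten1E !eqxx !mulr1n tt.
Qed.

Lemma mul_Z12 Z t t' i j k l :
  (Z * ten1 t * ten2 t') i j k l = \sum_b \sum_a Z i a k b * t a j * t' b l.
Proof.
by rewrite mulr_ten2; apply: eq_bigr => b _; rewrite mulr_ten1 mulr_suml.
Qed.
Lemma mul_21Z Z t t' i j k l :
  (ten2 t' * ten1 t * Z) i j k l = \sum_b \sum_a t' k b * t i a * Z a j b l.
Proof.
rewrite -mulrA mull_ten2; apply: eq_bigr => b _; rewrite mull_ten1 mulr_sumr.
by apply: eq_bigr => a _; rewrite mulrA.
Qed.
Lemma mul_1Z2 Z t t' i j k l :
  (ten1 t * Z * ten2 t') i j k l = \sum_b \sum_a t i a * Z a j k b * t' b l.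
Proof.
by rewrite mulr_ten2; apply: eq_bigr => b _; rewrite mull_ten1 mulr_suml.
Qed.
Lemma mul_2Z1 Z t t' i j k l :
  (ten2 t' * Z * ten1 t) i j k l = \sum_b \sum_a t' k b * Z i a b l * t a j.
Proof.
rewrite mulr_ten1 [RHS]exchange_big; apply: eq_bigr => a _ /=.
by rewrite mull_ten2 mulr_suml.
Qed.

Definition formG (sc : C -> K) (q : C) : 'M[K]_2 :=
  \matrix_(i, j) sc (if i == j then 0 else if i == o1 then q else -1).
End Tensors.

Lemma ord2E (i : 'I_2) : i = o1 \/ i = o2.
Proof. by case: i => [[|[|//]] Hi]; [left|right]; apply: val_inj. Qed.

Lemma sum_o12 (V : nmodType) (f : 'I_2 -> V) : \sum_(i < 2) f i = f o1 + f o2.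
Proof. by rewrite !big_ord_recl big_ord0 addr0; congr (f _ + f _); apply: val_inj. Qed.

Lemma refl_formG (K : comNzRingType) (sc : {rmorphism C -> K}) (q : C) (x y : K) : q != 0 ->
  let R := tenR sc q y x in let R' := tentr (tenR sc q (x * y) 1) in
  R * ten1 (formG sc q) * R' * ten2 (formG sc q) = ten2 (formG sc q) * R' * ten1 (formG sc q) * R.
Proof.
move=> q0 R R'; have qV : sc q * sc q^-1 = 1 by rewrite -rmorphM divff ?rmorph1.
apply: ten4P => i j k l; rewrite mulr_ten2 [RHS]mul_ten4 !sum_o12 !mul_2Z1 !sum_o12.
rewrite !mul_ten4 !sum_o12 !mulr_ten1 !sum_o12.
case: (ord2E i) => ->; case: (ord2E j) => ->; case: (ord2E k) => ->; case: (ord2E l) => ->;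
rewrite !tentrE !tenRE !mxE /Ral /Rbe /= ?rmorph0 ?rmorph1 ?rmorphN ?rmorphB ?rmorphN ?rmorph1; move: (sc q) (sc q^-1) qV => a b ab; ring: ab.
Qed.

Lemma map_refl_formG (K0 : comNzRingType) (K : nzRingType) (kap : {rmorphism K0 -> K})
    (sc0 : {rmorphism C -> K0}) (sc : C -> K) (q : C) (x y : K0) (R R' : 'M['M[K]_2]_2) :
  q != 0 -> (forall c, kap (sc0 c) = sc c) ->
  R = tenR sc q (kap y) (kap x) -> R' = tentr (tenR sc q (kap x * kap y) 1) ->
  R * ten1 (formG sc q) * R' * ten2 (formG sc q) = ten2 (formG sc q) * R' * ten1 (formG sc q) * R.
Proof.
move=> q0 scE RE R'E; have := refl_formG sc0 x y q0 => /=.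
pose T (Z : 'M['M[K0]_2]_2) : 'M['M[K]_2]_2 := \matrix_(i, j) \matrix_(k, l) kap (Z i j k l).
have TE Z i j k l : T Z i j k l = kap (Z i j k l) by rewrite !mxE.
have TM Z Z' : T (Z * Z') = T Z * T Z'.
  apply: ten4P => i j k l; rewrite TE !mul_ten4 rmorph_sum; apply: eq_bigr => a _.
  by rewrite rmorph_sum; apply: eq_bigr => b _; rewrite rmorphM !TE.
have TR U V : T (tenR sc0 q U V) = tenR sc q (kap U) (kap V).
  by apply: ten4P => i j k l; rewrite TE !tenRE rmorphD !rmorphM !scE.
have TG i j : kap (formG sc0 q i j) = formG sc q i j by rewrite !mxE scE.
have T1 : T (ten1 (formG sc0 q)) = ten1 (formG sc q).
  by apply: ten4P => i j k l; rewrite TE !ten1E rmorphMn TG.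
have T2 : T (ten2 (formG sc0 q)) = ten2 (formG sc q).
  by apply: ten4P => i j k l; rewrite TE !ten2E rmorphMn TG.
have TT : T (tentr (tenR sc0 q (x * y) 1)) = R'.
  by rewrite R'E; apply: ten4P => i j k l; rewrite TE !tentrE -TE TR rmorphM rmorph1.
by move/(congr1 T); rewrite !TM T1 T2 TT TR -RE.
Qed.

Lemma reflection_abs (M : nzRingType) (R R' T1 T2 G1 G2 B1 B2 : M) :
  R * T1 * T2 = T2 * T1 * R -> R * B1 * B2 = B2 * B1 * R ->
  B1 * R' * T2 = T2 * R' * B1 -> T1 * R' * B2 = B2 * R' * T1 ->
  T1 * G2 = G2 * T1 -> G1 * T2 = T2 * G1 -> B1 * G2 = G2 * B1 -> G1 * B2 = B2 * G1 ->
  R * G1 * R' * G2 = G2 * R' * G1 * R ->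
  R * (T1 * G1 * B1) * R' * (T2 * G2 * B2) = (T2 * G2 * B2) * R' * (T1 * G1 * B1) * R.
Proof.
move=> RT RB BT TB TG GT BG GB RG.
transitivity (R * T1 * T2 * (G1 * R' * G2) * B1 * B2).
  transitivity (R * T1 * G1 * (B1 * R' * T2) * G2 * B2); first by rewrite !mulrA.
  rewrite BT; transitivity (R * T1 * (G1 * T2) * R' * (B1 * G2) * B2); first by rewrite !mulrA.
  by rewrite GT BG !mulrA.
transitivity (T2 * T1 * (R * G1 * R' * G2) * B1 * B2); first by rewrite RT !mulrA.
transitivity (T2 * T1 * G2 * R' * G1 * (R * B1 * B2)); first by rewrite RG !mulrA.
transitivity (T2 * (T1 * G2) * R' * (G1 * B2) * B1 * R); first by rewrite RB !mulrA.
transitivity (T2 * G2 * (T1 * R' * B2) * G1 * B1 * R); first by rewrite TG GB !mulrA.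
by rewrite TB !mulrA.
Qed.

Section TwoVariables.
Variable A : algType C.
Local Notation K := (pser (pser A)).
Implicit Types (f g : nat -> A) (F : K) (c : C).

Definition inx f : K := pser_const (Pser f).
Definition iny f : K := Pser (fun s => pser_const (f s)).
Definition vx : K := pser_const (pvar A).
Definition vy : K := pvar _.
Definition sc c : K := pser_const (pser_const c%:A).
Definition cf2 F r s : A := pcoef (pcoef F s) r.
Definition pcb (b : bool) f := if b then pc f else f.

Lemma cf2_inj F G : (forall r s, cf2 F r s = cf2 G r s) -> F = G.
Proof. by move=> FG; apply: pserP => s; apply: pserP => r; apply: FG. Qed.

Lemma cf2D F G r s : cf2 (F + G) r s = cf2 F r s + cf2 G r s.
Proof. by rewrite /cf2 !pcoefD. Qed.
Lemma cf2B F G r s : cf2 (F - G) r s = cf2 F r s - cf2 G r s.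
Proof. by rewrite /cf2 !pcoefB. Qed.
Lemma cf2N F r s : cf2 (- F) r s = - cf2 F r s.
Proof. by rewrite /cf2 !pcoefN. Qed.
Lemma cf2_0 r s : cf2 0 r s = 0. Proof. by []. Qed.
Lemma cf2_sum (I : Type) (l : seq I) (P : pred I) (F : I -> K) r s :
  cf2 (\sum_(i <- l | P i) F i) r s = \sum_(i <- l | P i) cf2 (F i) r s.
Proof. by elim/big_rec2: _ => // i y1 y2 _ <-; rewrite cf2D. Qed.

Lemma cf2_xy f g r s : cf2 (inx f * iny g) r s = f r * g s.
Proof. by rewrite /cf2 /inx /iny pcoef_constM; apply: pcoef_Mconst. Qed.
Lemma cf2_yx f g r s : cf2 (iny g * inx f) r s = g s * f r.
Proof. by rewrite /cf2 /inx /iny pcoef_Mconst; apply: pcoef_constM. Qed.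

Lemma cf2_sc c F r s : cf2 (sc c * F) r s = c *: cf2 F r s.
Proof. by rewrite /cf2 /sc !pcoef_constM mulr_algl. Qed.
Lemma cf2_vx F r s : cf2 (vx * F) r s = if r is r'.+1 then cf2 F r' s else 0.
Proof. by rewrite /cf2 /vx pcoef_constM pcoef_varM. Qed.
Lemma cf2_vy F r s : cf2 (vy * F) r s = if s is s'.+1 then cf2 F r s' else 0.
Proof. by rewrite /cf2 /vy pcoef_varM; case: s. Qed.

Lemma vx_comm F : F * vx = vx * F.
Proof.
apply: cf2_inj => r s; rewrite cf2_vx /cf2 pcoef_Mconst pvar_comm pcoef_varM.
by case: r.
Qed.
Lemma vy_comm F : F * vy = vy * F.
Proof. exact: pvar_comm. Qed.
Lemma sc_comm c F : F * sc c = sc c * F.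
Proof.
by apply: cf2_inj => r s; rewrite cf2_sc /cf2 !pcoef_Mconst mulr_algr.
Qed.
Lemma sc_is_monoid : monoid_morphism sc.
Proof.
split=> [|c d]; first by rewrite /sc scale1r !rmorph1.
by rewrite /sc -!rmorphM /= mulr_algl scalerA.
Qed.
Lemma sc_is_additive : {morph sc : c d / c - d}.
Proof. by move=> c d; rewrite /sc scalerBl !rmorphB. Qed.
HB.instance Definition _ := GRing.isZmodMorphism.Build C K sc sc_is_additive.
HB.instance Definition _ := GRing.isMonoidMorphism.Build C K sc sc_is_monoid.

Definition central F := forall G, G * F = F * G.
Lemma centralD F G : central F -> central G -> central (F + G).
Proof. by move=> cF cG H; rewrite mulrDr cF cG mulrDl. Qed.
Lemma centralM F G : central F -> central G -> central (F * G).
Proof. by move=> cF cG H; rewrite mulrA cF -mulrA cG mulrA. Qed.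
Lemma central1 : central 1.
Proof. by move=> H; rewrite mulr1 mul1r. Qed.
Lemma central0 : central 0.
Proof. by move=> H; rewrite mulr0 mul0r. Qed.

Section RTT.
Variables (q : C) (e1 e2 : (nat -> A) -> K) (fa fb ga gb : (nat -> A) -> nat -> A).
Variables (U V : K) (cf : K -> nat -> nat -> A).
Hypothesis cf_inj : forall F G, (forall r s, cf F r s = cf G r s) -> F = G.
Hypothesis cfD : forall F G r s, cf (F + G) r s = cf F r s + cf G r s.
Hypothesis cfsc : forall c F r s, cf (sc c * F) r s = c *: cf F r s.
Hypothesis cU : central U.
Hypothesis cV : central V.
Hypothesis cf_Ul : forall f g r s, cf (U * (e1 f * e2 g)) r s = fa f r * ga g s.
Hypothesis cf_Vl : forall f g r s, cf (V * (e1 f * e2 g)) r s = fb f r * gb g s.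
Hypothesis cf_Ur : forall f g r s, cf (U * (e2 g * e1 f)) r s = ga g s * fa f r.
Hypothesis cf_Vr : forall f g r s, cf (V * (e2 g * e1 f)) r s = gb g s * fb f r.
Variables (t t' : 'I_2 -> 'I_2 -> nat -> A).
Let m1 : 'M[K]_2 := \matrix_(i, j) e1 (t i j).
Let m2 : 'M[K]_2 := \matrix_(i, j) e2 (t' i j).

Lemma rtt_tenP :
  (forall r s i j k l, rtt_entry q (fun a b => fa (t a b) r) (fun a b => ga (t' a b) s)
                        (fun a b => fb (t a b) r) (fun a b => gb (t' a b) s) i j k l) <->
  tenR sc q U V * ten1 m1 * ten2 m2 = ten2 m2 * ten1 m1 * tenR sc q U V.
Proof.
have cf0 r s : cf 0 r s = 0.
  by apply: (addIr (cf 0 r s)); rewrite -cfD !add0r.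
have cfS (I : Type) (l : seq I) (F : I -> K) r s :
    cf (\sum_(i <- l) F i) r s = \sum_(i <- l) cf (F i) r s.
  by elim: l => [|x l IH]; rewrite ?big_nil ?big_cons ?cfD ?IH.
have L i j k l r s : cf ((tenR sc q U V * ten1 m1 * ten2 m2) i j k l) r s =
    \sum_(a < 2) \sum_(b < 2) (Ral q i k a b *: (fa (t a j) r * ga (t' b l) s)
      + Rbe q i k a b *: (fb (t a j) r * gb (t' b l) s)).
  rewrite mulr_ten2 cfS exchange_big /=; apply: eq_bigr => b _.
  rewrite mulr_ten1 mulr_suml cfS; apply: eq_bigr => a _.
  by rewrite tenRE !mxE -mulrA mulrDl cfD -!mulrA !cfsc cf_Ul cf_Vl.
have R i j k l r s : cf ((ten2 m2 * ten1 m1 * tenR sc q U V) i j k l) r s =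
    \sum_(a < 2) \sum_(b < 2) (Ral q a b j l *: (ga (t' k b) s * fa (t i a) r)
      + Rbe q a b j l *: (gb (t' k b) s * fb (t i a) r)).
  rewrite -mulrA mull_ten2 cfS exchange_big /=; apply: eq_bigr => b _.
  rewrite mull_ten1 mulr_sumr cfS; apply: eq_bigr => a _.
  have cc c W : central W -> central (sc c * W).
    by move=> cW; apply: centralM => // H; apply: sc_comm.
  by rewrite tenRE !mxE mulrA (centralD (cc _ _ cU) (cc _ _ cV)) mulrDl -!mulrA cfD !cfsc cf_Ur cf_Vr.
split=> [H|H r s i j k l].
  apply: ten4P => i j k l; apply: cf_inj => r s.
  exact: etrans (L i j k l r s) (etrans (H r s i j k l) (esym (R i j k l r s))).
by rewrite /rtt_entry -(L i j k l r s) H (R i j k l r s).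
Qed.
End RTT.
End TwoVariables.

Section CfLemmas.
Variable A : algType C.
Implicit Types f g : nat -> A.
Lemma central_vx : central (vx A). Proof. exact: vx_comm. Qed.
Lemma central_vy : central (vy A). Proof. exact: vy_comm. Qed.
Lemma central_sc c : central (sc A c). Proof. by move=> F; apply: sc_comm. Qed.

Lemma cf2x_xy f g r s : cf2 (vx A * (inx f * iny g)) r s = pc f r * g s.
Proof. by rewrite cf2_vx; case: r => [|r] /=; rewrite ?mul0r ?cf2_xy. Qed.
Lemma cf2x_yx f g r s : cf2 (vx A * (iny g * inx f)) r s = g s * pc f r.
Proof. by rewrite cf2_vx; case: r => [|r] /=; rewrite ?mulr0 ?cf2_yx. Qed.
Lemma cf2y_xy f g r s : cf2 (vy A * (inx f * iny g)) r s = f r * pc g s.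
Proof. by rewrite cf2_vy; case: s => [|s] /=; rewrite ?mulr0 ?cf2_xy. Qed.
Lemma cf2y_yx f g r s : cf2 (vy A * (iny g * inx f)) r s = pc g s * f r.
Proof. by rewrite cf2_vy; case: s => [|s] /=; rewrite ?mul0r ?cf2_yx. Qed.
Lemma cf2xy_xy f g r s : cf2 (vx A * vy A * (inx f * iny g)) r s = pc f r * pc g s.
Proof. by rewrite -mulrA cf2_vx; case: r => [|r] /=; rewrite ?mul0r ?cf2y_xy. Qed.
Lemma cf2xy_yx f g r s : cf2 (vx A * vy A * (iny g * inx f)) r s = pc g s * pc f r.
Proof. by rewrite -mulrA cf2_vx; case: r => [|r] /=; rewrite ?mulr0 ?cf2y_yx. Qed.
Lemma cf2_1xy f g r s : cf2 (1 * (inx f * iny g)) r s = f r * g s.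
Proof. by rewrite mul1r cf2_xy. Qed.
Lemma cf2_1yx f g r s : cf2 (1 * (iny g * inx f)) r s = g s * f r.
Proof. by rewrite mul1r cf2_yx. Qed.

Definition rttTT (q : C) (t t' : 'I_2 -> 'I_2 -> nat -> A) :=
  forall r s i j k l, rtt_entry q (fun a b => t a b r) (fun a b => pc (t' a b) s)
                        (fun a b => pc (t a b) r) (fun a b => t' a b s) i j k l.
Definition rttBB (q : C) (t t' : 'I_2 -> 'I_2 -> nat -> A) :=
  forall r s i j k l, rtt_entry q (fun a b => pc (t a b) r) (fun a b => t' a b s)
                        (fun a b => t a b r) (fun a b => pc (t' a b) s) i j k l.
Definition rttBT (q : C) (t t' : 'I_2 -> 'I_2 -> nat -> A) :=
  forall r s i j k l, rtt_entry q (fun a b => pc (t a b) r) (fun a b => pc (t' a b) s)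
                        (fun a b => t a b r) (fun a b => t' a b s) i j k l.

Definition mxx (t : 'I_2 -> 'I_2 -> nat -> A) := \matrix_(i, j) inx (t i j).
Definition mxy (t : 'I_2 -> 'I_2 -> nat -> A) := \matrix_(i, j) iny (t i j).
Local Notation R := (tenR (sc A)).

Lemma rttTT_P q t t' : rttTT q t t' <->
  R q (vy A) (vx A) * ten1 (mxx t) * ten2 (mxy t') = ten2 (mxy t') * ten1 (mxx t) * R q (vy A) (vx A).
Proof.
exact: (rtt_tenP q (@cf2_inj A) (@cf2D A) (@cf2_sc A) central_vy central_vx
  cf2y_xy cf2x_xy cf2y_yx cf2x_yx t t').
Qed.
Lemma rttBB_P q t t' : rttBB q t t' <->
  R q (vx A) (vy A) * ten1 (mxx t) * ten2 (mxy t') = ten2 (mxy t') * ten1 (mxx t) * R q (vx A) (vy A).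
Proof.
exact: (rtt_tenP q (@cf2_inj A) (@cf2D A) (@cf2_sc A) central_vx central_vy
  cf2x_xy cf2y_xy cf2x_yx cf2y_yx t t').
Qed.
Lemma rttBB_swapP q t t' : rttBB q t t' <->
  R q (vy A) (vx A) * ten1 (mxy t) * ten2 (mxx t') = ten2 (mxx t') * ten1 (mxy t) * R q (vy A) (vx A).
Proof.
refine (rtt_tenP q (fa := @pc A) (ga := fun f => f) (fb := fun f => f) (gb := @pc A) (cf := fun F r s => cf2 F s r) _ _ _ central_vy central_vx _ _ _ _ t t').
- by move=> F G FG; apply: cf2_inj => r s; apply: FG.
- by move=> *; apply: cf2D.
- by move=> *; apply: cf2_sc.
- by move=> *; apply: cf2y_yx.
- by move=> *; apply: cf2x_yx.
- by move=> *; apply: cf2y_xy.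
- by move=> *; apply: cf2x_xy.
Qed.
Lemma rttBT_P q t t' : rttBT q t t' <->
  R q (vx A * vy A) 1 * ten1 (mxx t) * ten2 (mxy t') = ten2 (mxy t') * ten1 (mxx t) * R q (vx A * vy A) 1.
Proof.
exact: (rtt_tenP q (@cf2_inj A) (@cf2D A) (@cf2_sc A) (centralM central_vx central_vy) (@central1 A)
  cf2xy_xy cf2_1xy cf2xy_yx cf2_1yx t t').
Qed.
Lemma rttBT_swapP q t t' : rttBT q t t' <->
  R q (vx A * vy A) 1 * ten1 (mxy t) * ten2 (mxx t') = ten2 (mxx t') * ten1 (mxy t) * R q (vx A * vy A) 1.
Proof.
refine (rtt_tenP q (fa := @pc A) (ga := @pc A) (fb := fun f => f) (gb := fun f => f) (cf := fun F r s => cf2 F s r) _ _ _ (centralM central_vx central_vy) (@central1 A) _ _ _ _ t t').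
- by move=> F G FG; apply: cf2_inj => r s; apply: FG.
- by move=> *; apply: cf2D.
- by move=> *; apply: cf2_sc.
- by move=> *; apply: cf2xy_yx.
- by move=> *; apply: cf2_1yx.
- by move=> *; apply: cf2xy_xy.
- by move=> *; apply: cf2_1xy.
Qed.

Lemma tenR_central q U V i j k l : central U -> central V -> central (R q U V i j k l).
Proof.
by move=> cU cV; rewrite tenRE; apply: centralD; apply: centralM => //; apply: central_sc.
Qed.

Lemma tenR_sym q U V i j k l : R q U V i j k l = R q U V l k j i.
Proof.
rewrite !tenRE /Ral /Rbe; congr (sc _ _ * _ + sc _ _ * _).
- by case: (ord2E i) (ord2E j) (ord2E k) (ord2E l) => -> [] -> [] -> [] ->.
- by case: (ord2E i) (ord2E j) (ord2E k) (ord2E l) => -> [] -> [] -> [] ->.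
Qed.
End CfLemmas.

Section Reflection.
Variables (A : algType C) (q : C) (q0 : q != 0) (t tb : 'I_2 -> 'I_2 -> nat -> A).
Hypothesis tt : rttTT q t t.
Hypothesis bb : rttBB q tb tb.
Hypothesis bt : rttBT q tb t.
Local Notation K := (pser (pser A)).
Local Notation R := (tenR (sc A) q (vy A) (vx A)).
Local Notation Rz := (tenR (sc A) q (vx A * vy A) 1).
Local Notation R' := (tentr Rz).
Local Notation tx := (mxx t).
Local Notation ty := (mxy t).
Local Notation bx := ((mxx tb)^T).
Local Notation by_ := ((mxy tb)^T).
Local Notation G := (formG (sc A) q).

Let cRz i j k l : central (Rz i j k l).
Proof. apply: tenR_central; [apply: centralM; [exact: central_vx|exact: central_vy]|exact: central1]. Qed.

Lemma rtt_b1b2 : R * ten1 bx * ten2 by_ = ten2 by_ * ten1 bx * R.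
Proof.
have /rttBB_swapP H := bb; have cR i j k l : central (R i j k l).
  by apply: tenR_central; [exact: central_vy|exact: central_vx].
have Rs := @tenR_sym A q (vy A) (vx A).
apply: ten4P => i j k l.
rewrite (mul_Z12 R bx by_).
rewrite (mul_21Z R bx by_).
have E := ten4E H l k j i.
rewrite (mul_Z12 R (mxy tb) (mxx tb)) (mul_21Z R (mxy tb) (mxx tb)) in E.
rewrite exchange_big [RHS]exchange_big /= in E.
rewrite [LHS](_ : _ = \sum_b \sum_a mxx tb j a * mxy tb l b * R b k a i); last first.
  apply: eq_bigr => b _; apply: eq_bigr => a _.
  by rewrite -[R b k a i]Rs (cR i a k b) -mulrA [bx a j]mxE [by_ b l]mxE.
rewrite [RHS](_ : _ = \sum_b \sum_a R l b j a * mxy tb b k * mxx tb a i); last first.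
  apply: eq_bigr => b _; apply: eq_bigr => a _.
  by rewrite (Rs l b j a) -[RHS]mulrA -(cR a j b l) [bx i a]mxE [by_ k b]mxE.
exact: esym E.
Qed.

Lemma rtt_b1t2 : ten1 bx * R' * ten2 ty = ten2 ty * R' * ten1 bx.
Proof.
have /rttBT_P H := bt; apply: ten4P => j i k l.
have := ten4E H i j k l.
rewrite (mul_Z12 Rz) (mul_21Z Rz) (mul_1Z2 R') (mul_2Z1 R') => E.
rewrite [LHS](_ : _ = \sum_b \sum_a Rz i a k b * mxx tb a j * mxy t b l); last first.
  apply: eq_bigr => b _; apply: eq_bigr => a _.
  by rewrite [bx j a]mxE tentrE cRz.
rewrite [RHS](_ : _ = \sum_b \sum_a mxy t k b * mxx tb i a * Rz a j b l); last first.
  apply: eq_bigr => b _; apply: eq_bigr => a _.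
  by rewrite [bx a i]mxE tentrE -!mulrA cRz.
exact: E.
Qed.

Lemma rtt_t1b2 : ten1 tx * R' * ten2 by_ = ten2 by_ * R' * ten1 tx.
Proof.
have /rttBT_swapP H := bt; apply: ten4P => j i k l.
have := ten4E H l k j i.
rewrite (mul_Z12 Rz) (mul_21Z Rz) (mul_1Z2 R') (mul_2Z1 R') => E.
rewrite exchange_big [RHS]exchange_big /= in E.
rewrite [RHS](_ : _ = \sum_b \sum_a Rz l b j a * mxy tb b k * mxx t a i); last first.
  apply: eq_bigr => b _; apply: eq_bigr => a _.
  by rewrite [by_ k b]mxE tentrE cRz (tenR_sym _ _ _ l).
rewrite [LHS](_ : _ = \sum_b \sum_a mxx t j a * mxy tb l b * Rz b k a i); last first.
  apply: eq_bigr => b _; apply: eq_bigr => a _.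
  by rewrite [by_ b l]mxE tentrE -!mulrA cRz (tenR_sym _ _ _ i).
exact: esym E.
Qed.

Lemma formG_comm (m : 'M[K]_2) i j k l : G i j * m k l = m k l * G i j.
Proof. by rewrite mxE (central_sc _ (m k l)). Qed.

Lemma ten12_formG (m : 'M[K]_2) : ten1 m * ten2 G = ten2 G * ten1 m.
Proof. by apply: ten12C => *; rewrite formG_comm. Qed.
Lemma ten21_formG (m : 'M[K]_2) : ten1 G * ten2 m = ten2 m * ten1 G.
Proof. by apply: ten12C => *; rewrite formG_comm. Qed.

Lemma refl_formG2 : R * ten1 G * R' * ten2 G = ten2 G * R' * ten1 G * R.
Proof.
pose kap : {rmorphism pser (pser C) -> K} := psmap (psmap (in_alg A)).
have kx : kap (pser_const (pvar C)) = vx A.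
  by apply: cf2_inj => -[|[|r]] [|s] //=; rewrite /cf2 /= ?rmorph0 ?rmorph1 ?pcoef0 ?scale0r ?scale1r.
have ky : kap (pvar (pser C)) = vy A.
  by apply: cf2_inj => -[|r] [|[|s]] //=; rewrite /cf2 /= ?rmorph0 ?rmorph1 ?pcoef0 ?scale0r ?scale1r.
apply: (@map_refl_formG _ _ kap ((@pser_const (pser C)) \o (@pser_const C)) (sc A) q
  (pser_const (pvar C)) (pvar (pser C))) => //.
- by move=> c; apply: cf2_inj => -[|r] [|s] //=; rewrite /cf2 /= ?rmorph0 ?pcoef0 ?scale0r.
- by rewrite kx ky.
- by rewrite kx ky.
Qed.

Definition Sx := tx * G * bx.
Definition Sy := ty * G * by_.

Theorem reflection : R * ten1 Sx * R' * ten2 Sy = ten2 Sy * R' * ten1 Sx * R.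
Proof.
have /rttTT_P H := tt.
rewrite /Sx /Sy !ten1M !ten2M.
apply: reflection_abs.
- exact: H.
- exact: rtt_b1b2.
- exact: rtt_b1t2.
- exact: rtt_t1b2.
- exact: ten12_formG.
- exact: ten21_formG.
- exact: ten12_formG.
- exact: ten21_formG.
- exact: refl_formG2.
Qed.
End Reflection.

Definition shift (V : zmodType) (i j : nat) (F : nat -> nat -> V) (r s : nat) : V :=
  if (i <= r)%N && (j <= s)%N then F (r - i)%N (s - j)%N else 0.

(* Coefficients of (a y + b x)(c x y + d) F(x, y). *)
HB.lock Definition quad (V : lmodType C) (a b c d : C) (F : nat -> nat -> V) (r s : nat) : V :=
  (a * c) *: shift 1 2 F r s + (a * d) *: shift 0 1 F r s
  + (b * c) *: shift 2 1 F r s + (b * d) *: shift 1 0 F r s.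

Lemma quad_ext (V : lmodType C) a b c d (F G : nat -> nat -> V) r s :
  (forall r s, F r s = G r s) -> quad a b c d F r s = quad a b c d G r s.
Proof. by move=> FG; rewrite !quad.unlock /shift !FG. Qed.

Section QuadCoef.
Variable A : algType C.
Local Notation K := (pser (pser A)).
Lemma cf2_quad a b c d (F : K) r s :
  cf2 ((sc A a * vy A + sc A b * vx A) * ((sc A c * (vx A * vy A) + sc A d * 1) * F)) r s
  = quad a b c d (cf2 F) r s.
Proof.
have V2 i j (G : K) u v : cf2 (vx A ^+ i * (vy A ^+ j * G)) u v = shift i j (cf2 G) u v.
  rewrite /shift; elim: i u => [|i IH] u.
    rewrite expr0 mul1r subn0 /=; elim: j v => [|j IH] v; first by rewrite mul1r subn0.
    by rewrite exprS -mulrA cf2_vy; case: v => //= v; rewrite IH ltnS subSS.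
  by rewrite exprS -mulrA cf2_vx; case: u => //= u; rewrite IH ltnS subSS.
have scl (U G : K) x y : (sc A x * U) * (sc A y * G) = sc A (x * y) * (U * G).
  by rewrite rmorphM -(mulrA _ U) (mulrA U) sc_comm -(mulrA _ U) mulrA.
have E x y : (sc A x * vy A) * ((sc A y * (vx A * vy A)) * F) = sc A (x * y) * (vx A ^+ 1 * (vy A ^+ 2 * F)).
  rewrite -(mulrA (sc A y)) scl; congr (_ * _).
  by rewrite expr1 expr2 -(mulrA (vx A)) (mulrA (vy A)) (vx_comm (vy A)) -(mulrA (vx A)) -(mulrA (vy A)).
have E2 x y : (sc A x * vy A) * ((sc A y * 1) * F) = sc A (x * y) * (vx A ^+ 0 * (vy A ^+ 1 * F)).
  by rewrite mulr1 scl expr0 mul1r.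
have E3 x y : (sc A x * vx A) * ((sc A y * (vx A * vy A)) * F) = sc A (x * y) * (vx A ^+ 2 * (vy A ^+ 1 * F)).
  by rewrite -(mulrA (sc A y)) scl expr1 expr2 -(mulrA (vx A) (vy A)) -(mulrA (vx A) (vx A)).
have E4 x y : (sc A x * vx A) * ((sc A y * 1) * F) = sc A (x * y) * (vx A ^+ 1 * (vy A ^+ 0 * F)).
  by rewrite mulr1 scl expr0 mul1r.
rewrite mulrDl !(mulrDl (sc A c * _)) !(mulrDr _ (sc A c * _ * F)) E E2 E3 E4.
by rewrite !cf2D !cf2_sc !V2 quad.unlock addrA.
Qed.

Lemma central_lin a b U V : central U -> central V -> central (sc A a * U + sc A b * V).
Proof.
by move=> cU cV; apply: centralD; apply: centralM => //; apply: central_sc.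
Qed.
Lemma cf2_termL a b c d (f g : nat -> A) r s :
  cf2 ((sc A a * vy A + sc A b * vx A) * inx f * (sc A c * (vx A * vy A) + sc A d * 1) * iny g) r s
  = quad a b c d (fun r s => f r * g s) r s.
Proof.
have cz : central (sc A c * (vx A * vy A) + sc A d * 1).
  by apply: central_lin; [apply: centralM; [exact: central_vx|exact: central_vy]|exact: central1].
rewrite -mulrA -mulrA (mulrA (inx f)) (cz (inx f)) -mulrA cf2_quad.
by apply: quad_ext => r' s'; rewrite cf2_xy.
Qed.
Lemma cf2_termR a b c d (f g : nat -> A) r s :
  cf2 (iny g * (sc A c * (vx A * vy A) + sc A d * 1) * inx f * (sc A a * vy A + sc A b * vx A)) r s
  = quad a b c d (fun r s => g s * f r) r s.
Proof.
have cz : central (sc A c * (vx A * vy A) + sc A d * 1).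
  by apply: central_lin; [apply: centralM; [exact: central_vx|exact: central_vy]|exact: central1].
rewrite (central_lin a b (@central_vy A) (@central_vx A)) (cz (iny g)) -mulrA cf2_quad.
by apply: quad_ext => r' s'; rewrite cf2_yx.
Qed.
End QuadCoef.

Section ReflCoef.
Variables (A : algType C) (q : C) (q0 : q != 0) (t tb : 'I_2 -> 'I_2 -> nat -> A).
Hypothesis tt : rttTT q t t.
Hypothesis bb : rttBB q tb tb.
Hypothesis bt : rttBT q tb t.
Local Notation S := (s_coef q t tb).

Lemma inxM (f g h : nat -> A) : (forall n, \sum_(i < n.+1) f i * g (n - i)%N = h n) -> inx f * inx g = inx h.
Proof.
move=> H; rewrite /inx -rmorphM; congr pser_const; apply: pserP => n.
by rewrite pcoefM /= H.
Qed.
Lemma inyM (f g h : nat -> A) : (forall n, \sum_(i < n.+1) f i * g (n - i)%N = h n) -> iny f * iny g = iny h.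
Proof.
move=> H; apply: pserP => n; rewrite pcoefM /= -H rmorph_sum.
by apply: eq_bigr => i _; rewrite rmorphM.
Qed.
Lemma inxB (f g : nat -> A) c : sc A c * inx f - inx g = inx (fun n => c *: f n - g n).
Proof.
apply: cf2_inj => r s; rewrite cf2B cf2_sc /cf2 /inx.
by case: s => [|s] //=; rewrite ?pcoef0 scaler0 subr0.
Qed.
Lemma inyB (f g : nat -> A) c : sc A c * iny f - iny g = iny (fun n => c *: f n - g n).
Proof.
apply: cf2_inj => r s; rewrite cf2B cf2_sc /cf2 /iny.
by case: r => [|r] //=; rewrite ?pcoef0 scaler0 subr0.
Qed.

Lemma SxE i j : Sx q t tb i j = inx (S i j).
Proof.
rewrite /Sx mxE sum_o12 !mxE !sum_o12 !mxE /=.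
rewrite !rmorphN !rmorph1 !rmorph0 !mulr0 addr0 add0r mulrN1 mulNr sc_comm -mulrA addrC.
rewrite (inxM (f := t i o1) (g := tb j o2) (h := fun n => \sum_(a < n.+1) t i o1 a * tb j o2 (n - a)%N)) //.
rewrite (inxM (f := t i o2) (g := tb j o1) (h := fun n => \sum_(a < n.+1) t i o2 a * tb j o1 (n - a)%N)) //.
rewrite inxB; congr inx; apply/funext => n.
by rewrite /s_coef sumrB scaler_sumr.
Qed.
Lemma SyE i j : Sy q t tb i j = iny (S i j).
Proof.
rewrite /Sy mxE sum_o12 !mxE !sum_o12 !mxE /=.
rewrite !rmorphN !rmorph1 !rmorph0 !mulr0 addr0 add0r mulrN1 mulNr sc_comm -mulrA addrC.
rewrite (inyM (f := t i o1) (g := tb j o2) (h := fun n => \sum_(a < n.+1) t i o1 a * tb j o2 (n - a)%N)) //.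
rewrite (inyM (f := t i o2) (g := tb j o1) (h := fun n => \sum_(a < n.+1) t i o2 a * tb j o1 (n - a)%N)) //.
rewrite inyB; congr iny; apply/funext => n.
by rewrite /s_coef sumrB scaler_sumr.
Qed.

Lemma refl_coef r s i j k l :
  \sum_b \sum_a \sum_c \sum_d quad (Ral q i k d c) (Rbe q i k d c) (Ral q j c a b) (Rbe q j c a b)
     (fun r s => S d a r * S b l s) r s =
  \sum_a \sum_b \sum_c \sum_d quad (Ral q a b j l) (Rbe q a b j l) (Ral q d c i b) (Rbe q d c i b)
     (fun r s => S k c s * S d a r) r s.
Proof.
have := ten4E (reflection q0 tt bb bt) i j k l.
rewrite mulr_ten2 [in RHS]mul_ten4 => /(congr1 (fun F => cf2 F r s)) E.
transitivity (cf2 (\sum_b (tenR (sc A) q (vy A) (vx A) * ten1 (Sx q t tb)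
   * tentr (tenR (sc A) q (vx A * vy A) 1)) i j k b * Sy q t tb b l) r s).
  rewrite cf2_sum; apply: eq_bigr => b _.
  rewrite mul_ten4 mulr_suml cf2_sum; apply: eq_bigr => a _.
  rewrite mulr_suml cf2_sum; apply: eq_bigr => c _.
  rewrite mulr_ten1 !mulr_suml cf2_sum; apply: eq_bigr => d _.
  by rewrite tentrE !tenRE SxE SyE cf2_termL.
rewrite E cf2_sum; apply: eq_bigr => a _.
rewrite cf2_sum; apply: eq_bigr => b _.
rewrite mul_2Z1 mulr_suml cf2_sum; apply: eq_bigr => c _.
rewrite mulr_suml cf2_sum; apply: eq_bigr => d _.
by rewrite tentrE !tenRE SxE SyE cf2_termR.
Qed.

Lemma quad0l (V : lmodType C) c d (F : nat -> nat -> V) r s : quad 0 0 c d F r s = 0.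
Proof. by rewrite quad.unlock !mul0r !scale0r !addr0. Qed.
Lemma quad0r (V : lmodType C) a b (F : nat -> nat -> V) r s : quad a b 0 0 F r s = 0.
Proof. by rewrite quad.unlock !mulr0 !scale0r !addr0. Qed.

Let h := q^-1 - q.
Lemma refl_BB r s :
  quad q^-1 (- q) q^-1 (- q) (fun r s => S o2 o2 r * S o2 o2 s) r s =
  quad q^-1 (- q) q^-1 (- q) (fun r s => S o2 o2 s * S o2 o2 r) r s.
Proof.
have := refl_coef r s o2 o2 o2 o2; rewrite !sum_o12 /Ral /Rbe /=.
by rewrite !(quad0l, quad0r, add0r, addr0).
Qed.
Lemma refl_AB r s :
  quad q^-1 (- q) q^-1 (- q) (fun r s => S o2 o2 r * S o2 o1 s) r s =
  quad 1 (- 1) 1 (- 1) (fun r s => S o2 o1 s * S o2 o2 r) r s +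
  quad 1 (- 1) 0 h (fun r s => S o2 o2 s * S o1 o2 r) r s +
  quad 0 h q^-1 (- q) (fun r s => S o2 o2 s * S o2 o1 r) r s.
Proof.
have := refl_coef r s o2 o2 o2 o1; rewrite !sum_o12 /Ral /Rbe /=.
rewrite !(quad0l, quad0r, add0r, addr0).
by move=> ->; rewrite addrC.
Qed.
Lemma refl_EB r s :
  quad 1 (- 1) q^-1 (- q) (fun r s => S o1 o2 r * S o2 o2 s) r s +
  quad 0 h 1 (- 1) (fun r s => S o2 o2 r * S o1 o2 s) r s +
  quad 0 h h 0 (fun r s => S o2 o1 r * S o2 o2 s) r s =
  quad q^-1 (- q) 1 (- 1) (fun r s => S o2 o2 s * S o1 o2 r) r s +
  quad q^-1 (- q) h 0 (fun r s => S o2 o1 s * S o2 o2 r) r s.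
Proof.
have := refl_coef r s o1 o2 o2 o2; rewrite !sum_o12 /Ral /Rbe /=.
rewrite !(quad0l, quad0r, add0r, addr0).
by rewrite addrA addrC addrA [in X in X -> _](addrC (quad q^-1 _ h _ _ _ _)).
Qed.
Lemma refl_CB r s :
  quad 1 (- 1) 1 (- 1) (fun r s => S o1 o1 r * S o2 o2 s) r s +
  quad 1 (- 1) 0 h (fun r s => S o1 o2 r * S o1 o2 s) r s +
  quad 0 h q^-1 (- q) (fun r s => S o2 o1 r * S o1 o2 s) r s =
  quad 1 (- 1) 1 (- 1) (fun r s => S o2 o2 s * S o1 o1 r) r s +
  quad 1 (- 1) h 0 (fun r s => S o2 o1 s * S o2 o1 r) r s +
  quad h 0 q^-1 (- q) (fun r s => S o2 o1 s * S o1 o2 r) r s.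
Proof.
have := refl_coef r s o1 o1 o2 o2; rewrite !sum_o12 /Ral /Rbe /=.
rewrite !(quad0l, quad0r, add0r, addr0).
move=> E; rewrite -addrA addrC [X in X + _]addrC E.
by congr (_ + _); rewrite addrC.
Qed.
End ReflCoef.

Section Symmetry.
Variables (A : algType C) (q : C) (q0 : q != 0) (t tb : 'I_2 -> 'I_2 -> nat -> A).
Hypothesis bt : rttBT q tb t.
Local Notation S := (s_coef q t tb).
Local Notation D := (sb_coef q t tb).

Definition kap : {rmorphism pser C -> pser A} := psmap (in_alg A).
Lemma kap_comm p (F : pser A) : F * kap p = kap p * F.
Proof.
apply: pserP => n; rewrite pcoefMr pcoefM; apply: eq_bigr => i _ /=.
by rewrite mulr_algl mulr_algr.
Qed.
Fact kap_scaleA a b (F : pser A) : kap a * (kap b * F) = kap (a * b) * F.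
Proof. by rewrite rmorphM mulrA. Qed.
Fact kap_scale1 (F : pser A) : kap 1 * F = F. Proof. by rewrite rmorph1 mul1r. Qed.
Fact kap_scaleDr a (F G : pser A) : kap a * (F + G) = kap a * F + kap a * G.
Proof. exact: mulrDr. Qed.
Fact kap_scaleDl (F : pser A) a b : kap (a + b) * F = kap a * F + kap b * F.
Proof. by rewrite rmorphD mulrDl. Qed.
HB.instance Definition _ := GRing.Zmodule_isLmodule.Build (pser C) (pser A)
  kap_scaleA kap_scale1 kap_scaleDr kap_scaleDl.
Lemma kapE p (F : pser A) : kap p * F = p *: F. Proof. by []. Qed.

Lemma pcoef_kapC c F n : pcoef (kap (pser_const c) * F) n = c *: pcoef F n.
Proof.
have -> : kap (pser_const c) = pser_const c%:A.
  by apply: pserP => -[|m] /=; rewrite ?scale0r.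
by rewrite pcoef_constM mulr_algl.
Qed.
Lemma kap_var : kap (pvar C) = pvar A.
Proof. by apply: pserP => -[|[|m]] /=; rewrite ?scale0r ?scale1r. Qed.

Let z : pser C := pvar C * pvar C.
Local Notation cst := (@pser_const C).
Let T i j := Pser (t i j).
Let B i j := Pser (tb i j).

Lemma rtt_diag i j k l :
  \sum_(a < 2) \sum_(b < 2) kap (cst (Ral q i k a b) * z + cst (Rbe q i k a b)) * (B a j * T b l) =
  \sum_(a < 2) \sum_(b < 2) kap (cst (Ral q a b j l) * z + cst (Rbe q a b j l)) * (T k b * B i a).
Proof.
have pcE (f : nat -> A) n : pc f n = pcoef (pvar A * Pser f) n.
  by rewrite pcoef_varM; case: n.
have LE (c d : C) (F G : pser A) n : pcoef (kap (cst c * z + cst d) * (F * G)) n =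
    \sum_(r < n.+1) (c *: (pcoef (pvar A * F) r * pcoef (pvar A * G) (n - r)) + d *: (pcoef F r * pcoef G (n - r))).
  rewrite big_split -!scaler_sumr -!pcoefM rmorphD rmorphM mulrDl pcoefD.
  rewrite -mulrA !pcoef_kapC; congr (_ *: pcoef _ n + _).
  by rewrite rmorphM kap_var -!mulrA; congr (_ * _); rewrite !mulrA pvar_comm.
have pS (I : finType) (F : I -> pser A) n : pcoef (\sum_i F i) n = \sum_i pcoef (F i) n.
  by apply: (big_morph (fun f => pcoef f n)) => [f g|]; rewrite ?pcoefD.
have rev n (f : nat -> nat -> A) : \sum_(r < n.+1) f (n - r)%N r = \sum_(r < n.+1) f r (n - r)%N.
  rewrite (reindex_inj rev_ord_inj); apply: eq_bigr => r _ /=.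
  by rewrite subSS subKn // -ltnS.
apply: pserP => n.
transitivity (\sum_(r < n.+1) \sum_(a < 2) \sum_(b < 2)
   (Ral q i k a b *: (pc (tb a j) r * pc (t b l) (n - r)%N) + Rbe q i k a b *: (tb a j r * t b l (n - r)%N))).
  rewrite pS [RHS]exchange_big; apply: eq_bigr => a _; rewrite pS [RHS]exchange_big; apply: eq_bigr => b _.
  by rewrite LE; apply: eq_bigr => r _; rewrite !pcE.
rewrite (eq_bigr _ (fun (r : 'I_n.+1) _ => bt r (n - r)%N i j k l)).
rewrite pS [LHS]exchange_big; apply: eq_bigr => a _; rewrite pS [LHS]exchange_big; apply: eq_bigr => b _.
rewrite LE -(rev _ (fun r s => Ral q a b j l *: (pc (t k b) s * pc (tb i a) r) + Rbe q a b j l *: (t k b s * tb i a r))).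
by apply: eq_bigr => r _; rewrite !pcE.
Qed.

Let h : pser C := cst q^-1 - cst q.
Let A_ := Pser (S o2 o1).
Let E_ := Pser (S o1 o2).
Let D_ := Pser (D o2 o1).
Let D' := Pser (D o1 o2).

Lemma s_pserE i j : Pser (S i j) = kap (cst q) * (T i o1 * B j o2) - T i o2 * B j o1.
Proof.
apply: pserP => n; rewrite pcoefB pcoef_kapC !pcoefM /= /s_coef.
by rewrite scaler_sumr -sumrB.
Qed.
Lemma sb_pserE i j : Pser (D i j) = kap (cst q) * (B i o1 * T j o2) - B i o2 * T j o1.
Proof.
apply: pserP => n; rewrite pcoefB pcoef_kapC !pcoefM /= /sb_coef.
by rewrite scaler_sumr -sumrB.
Qed.

Lemma symm12 i k : i != k -> (z - 1) *: Pser (D i k) + (if (k < i)%N then h * z else h) *: Pser (D k i) =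
  (cst q^-1 * (1 - cst q * cst q * z)) *: Pser (S k i).
Proof.
move=> ik; have q1 : cst q * cst q^-1 = 1 by rewrite -rmorphM divff ?rmorph1.
have /(congr1 (tscal (pser A))) := q1; rewrite rmorphM rmorph1 => q2.
have := rtt_diag i o1 k o2; have := rtt_diag i o2 k o1.
rewrite !sum_o12 !s_pserE !sb_pserE !kapE.
have cN c : cst (- c) = - cst c by rewrite rmorphN.
case: (ord2E i) ik => ->; case: (ord2E k) => -> // _; rewrite /Ral /Rbe /= !(rmorph0, rmorph1, rmorphB, rmorphN);
move=> E2 E1; apply: (lin_comb (c := cst q) E1); apply/eqP; rewrite -subr_eq0; apply/eqP;
apply: (lin_comb (c := -1) E2); rewrite ?/h; linring_pre; ring: q2.
Qed.

Lemma symm_pser : (1 - z) *: E_ = - (cst q - cst q^-1 * z) *: D_ - (h * z) *: A_.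
Proof.
have q1 : cst q * cst q^-1 = 1 by rewrite -rmorphM divff ?rmorph1.
have /(congr1 (tscal (pser A))) := q1; rewrite rmorphM rmorph1 => q2.
have E1 := @symm12 o1 o2 isT; have E2 := @symm12 o2 o1 isT; rewrite /= in E1 E2.
have U : (1 - cst q * cst q * z) *: ((1 - z) *: E_) =
   (1 - cst q * cst q * z) *: (- (cst q - cst q^-1 * z) *: D_ - (h * z) *: A_).
  apply: (lin_comb (c := cst q * (z - 1)) E2); apply/eqP; rewrite -subr_eq0; apply/eqP.
  apply: (lin_comb (c := - cst q * h * z) E1).
  rewrite -/A_ -/E_ -/D_ /h; linring_pre; ring: q2.
have pz (F : pser A) n : pcoef (z *: F) n = if n is m.+2 then pcoef F m else 0.
  rewrite -kapE rmorphM kap_var -mulrA pcoef_varM; case: n => [|[|n]] //; by rewrite pcoef_varM.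
have pc c (F : pser A) n : pcoef (cst c *: F) n = c *: pcoef F n by rewrite -kapE pcoef_kapC.
apply/eqP; rewrite -subr_eq0; move: U => /eqP; rewrite -subr_eq0 -scalerBr.
set F := (X in _ *: X) => /eqP H; apply/eqP; apply: pserP.
have {}H n : pcoef F n = (q * q) *: pcoef (z *: F) n.
  move: F H => F H.
  apply/eqP; rewrite -subr_eq0 -pc rmorphM -pcoefB scalerA -[X in X - _]scale1r -scalerBl.
  by rewrite H.
have S2 n : (pcoef F n = 0) /\ (pcoef F n.+1 = 0).
  elim: n => [|n [IH1 IH2]]; first by rewrite !H !pz scaler0.
  by split=> //; rewrite H pz IH1 scaler0.
by move=> n; case: (S2 n).
Qed.

Definition shift2 (V : zmodType) (f : nat -> V) n := if n is m.+2 then f m else 0.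

Lemma symm_coef n : S o1 o2 n - shift2 (S o1 o2) n =
  - (q *: D o2 o1 n - q^-1 *: shift2 (D o2 o1) n) - (q^-1 - q) *: shift2 (S o2 o1) n.
Proof.
have pz (f : nat -> A) : pcoef (z *: Pser f) n = shift2 f n.
  rewrite -kapE rmorphM kap_var -mulrA pcoef_varM; case: n => [|[|m]] //; by rewrite pcoef_varM.
have pc c (F : pser A) : pcoef (cst c *: F) n = c *: pcoef F n by rewrite -kapE pcoef_kapC.
have := congr1 (fun F => pcoef F n) symm_pser.
rewrite scalerBl scale1r pcoefB pz => ->.
have -> : h = cst (q^-1 - q) by rewrite rmorphB.
by rewrite scaleNr scalerBl -!scalerA !(pcoefB, pcoefN) !pc !(scalerA (pvar C)) !pz.
Qed.
End Symmetry.

Definition subspace (V : lmodType C) (M : V -> Prop) :=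
  [/\ M 0, forall x y, M x -> M y -> M (x + y) & forall c x, M x -> M (c *: x)].

Section Subspace.
Variables (V : lmodType C) (M : V -> Prop) (sM : subspace M).
Lemma sub0 : M 0. Proof. by case: sM. Qed.
Lemma subD x y : M x -> M y -> M (x + y). Proof. by case: sM => _ H _; apply: H. Qed.
Lemma subZ c x : M x -> M (c *: x). Proof. by case: sM => _ _; apply. Qed.
Lemma subN x : M x -> M (- x). Proof. by rewrite -scaleN1r; apply: subZ. Qed.
Lemma subB x y : M x -> M y -> M (x - y). Proof. by move=> Mx My; apply/subD/subN. Qed.
Lemma sub_sum (I : Type) (l : seq I) (P : pred I) (F : I -> V) :
  (forall i, P i -> M (F i)) -> M (\sum_(i <- l | P i) F i).
Proof. by move=> H; elim/big_ind: _ => //; [apply: sub0|apply: subD]. Qed.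
Lemma sub_shift i j F r s : (forall r s, M (F r s)) -> M (shift i j F r s).
Proof. by move=> H; rewrite /shift; case: ifP => _ //; apply: sub0. Qed.
Lemma sub_shift2 (f : nat -> V) n : (forall n, M (f n)) -> M (shift2 f n).
Proof. by move=> H; case: n => [|[|n]] /=; rewrite ?H //; apply: sub0. Qed.
Lemma sub_quad a b c d F r s : (forall r s, M (F r s)) -> M (quad a b c d F r s).
Proof. by move=> H; rewrite quad.unlock; do !apply: subD; apply/subZ/sub_shift. Qed.

Lemma quad_sub a b c d F : b * d != 0 -> (forall r s, M (quad a b c d F r s)) -> forall r s, M (F r s).
Proof.
move=> bd H r s; elim/ltn_ind: s r => s IH r.
have := H r.+1 s; rewrite quad.unlock {4}/shift /= subn1 subn0 /= => Hr.
rewrite -[F r s](scalerK bd); apply: subZ.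
set u := (X in X + _) in Hr; rewrite -[_ *: F r s](addKr u); apply: subD => //.
have Hs i v : (0 < v)%N -> M (shift i v F r.+1 s).
  move=> v0; rewrite /shift; case: ifP => [/andP[_ vs]|_]; last exact: sub0.
  by apply: IH; rewrite ltn_subrL v0 (leq_trans v0).
by apply: subN; do 2?apply: subD; apply: subZ; apply: Hs.
Qed.

Lemma shift2_ind c (f g : nat -> V) : (forall n, f n - c *: shift2 f n = g n) -> (forall n, M (g n)) -> forall n, M (f n).
Proof.
move=> E H; suff S2 : forall m, M (f m) /\ M (f m.+1) by move=> n; case: (S2 n).
have fE m : f m = g m + c *: shift2 f m by rewrite -E subrK.
elim=> [|m [IH1 IH2]]; first by rewrite !fE /= !scaler0 !addr0.
by split=> //; rewrite fE; apply: subD => //; apply: subZ.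
Qed.
End Subspace.

Lemma quadMr (A : algType C) a b c d (F : nat -> nat -> A) w r s :
  quad a b c d F r s * w = quad a b c d (fun r s => F r s * w) r s.
Proof.
rewrite !quad.unlock !mulrDl -!scalerAl; congr (_ *: _ + _ *: _ + _ *: _ + _ *: _);
by rewrite /shift; case: ifP; rewrite ?mul0r.
Qed.

Lemma sum3_l (V : zmodType) (a b c d : V) : b + c + d = a -> b = a - d - c.
Proof. by move=> <-; rewrite !addrK. Qed.

Section Verma.
Variables (q : C) (q0 : q != 0) (hq : forall n : nat, (0 < n)%N -> q ^+ n != 1).
Variables (A : algType C) (t tb : 'I_2 -> 'I_2 -> nat -> A) (ti tbi : 'I_2 -> A).
Hypothesis HR : Uext_rels q t tb ti tbi.
Variables (mu mub : nat -> C).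
Local Notation S := (s_coef q t tb).
Local Notation D := (sb_coef q t tb o2 o1).
Local Notation Y := (Yq q t tb ti tbi).
Local Notation I := (verma_ideal q t tb ti tbi mu mub).
Local Notation K' := (s12inv q ti tbi).
Local Notation h := (q^-1 - q).

Lemma rels_tt : rttTT q t t. Proof. by case: HR => _ _ _ _ H r s i j k l; case: (H r s i j k l). Qed.
Lemma rels_bb : rttBB q tb tb. Proof. by case: HR => _ _ _ _ H r s i j k l; case: (H r s i j k l). Qed.
Lemma rels_bt : rttBT q tb t. Proof. by case: HR => _ _ _ _ H r s i j k l; case: (H r s i j k l). Qed.

Lemma Yq_subalg : subalg Y.
Proof.
split.
- by move=> S0 [H1 _ _ _].
- by move=> x y Hx Hy S0 sS H1 H2; have [_ H _ _] := sS; apply: H; [apply: Hx|apply: Hy].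
- by move=> c x Hx S0 sS H1 H2; have [_ _ H _] := sS; apply: H; apply: Hx.
- by move=> x y Hx Hy S0 sS H1 H2; have [_ _ _ H] := sS; apply: H; [apply: Hx|apply: Hy].
Qed.
Lemma Yq_s i j r : Y (S i j r). Proof. by move=> S0 _ H _; apply: H. Qed.
Lemma Yq_inv : Y K'. Proof. by move=> S0 _ _. Qed.
Lemma Yq1 : Y 1. Proof. by case: Yq_subalg. Qed.
Lemma Yq_subspace : subspace Y.
Proof.
have [H1 HD HZ _] := Yq_subalg; split=> //.
by rewrite -(scale0r 1); apply: HZ.
Qed.
Lemma YqM x y : Y x -> Y y -> Y (x * y). Proof. by case: Yq_subalg => _ _ _; apply. Qed.

Lemma Yq_sb r : Y (D r).
Proof.
have sY := Yq_subspace; move: r.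
apply: (shift2_ind sY (c := q^-1 * q^-1) (g := fun r => q^-1 *: (shift2 (S o1 o2) r - S o1 o2 r - h *: shift2 (S o2 o1) r))) => r.
  have E := symm_coef q0 rels_bt r; apply: (lin_comb (c := q^-1) E).
  have /(congr1 (tscal A)) : q^-1 * q = 1 by rewrite mulVf.
  by rewrite rmorphM rmorph1 => q1; linring_pre; ring: q1.
by apply: (subZ sY); do 2?apply: (subB sY); rewrite ?(sub_shift2 sY) //; do ?[apply: (subZ sY)|apply: (sub_shift2 sY)|move=> *; exact: Yq_s].
Qed.

Lemma Yq_ideal : left_ideal Y Y.
Proof.
have sY := Yq_subspace; split=> // [|x y|x y]; [exact: sub0 sY|exact: subD|exact: YqM].
Qed.
Lemma verma_left : left_ideal Y I.
Proof.
have sY := Yq_subspace; split.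
- move=> x; apply; first exact: Yq_ideal.
  + by move=> r; apply: Yq_s.
  + by move=> r; apply: (subB sY); [exact: Yq_s|exact: (subZ sY _ Yq1)].
  + by move=> r; apply: (subB sY); [exact: Yq_sb|exact: (subZ sY _ Yq1)].
- by move=> N [_ H _ _].
- by move=> x y Hx Hy N HN H1 H2 H3; have [_ _ H _] := HN; apply: H; [apply: Hx|apply: Hy].
- by move=> y x Yy Hx N HN H1 H2 H3; have [_ _ _ H] := HN; apply: H => //; apply: Hx.
Qed.
Lemma left_subspace N : left_ideal Y N -> subspace N.
Proof.
case=> _ N0 ND NM; split=> // c x Nx; rewrite -[x]mul1r scalerAl; apply: NM => //.
exact: (subZ Yq_subspace _ Yq1).
Qed.
Lemma verma_subspace : subspace I. Proof. exact/left_subspace/verma_left. Qed.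
Lemma vermaM y x : Y y -> I x -> I (y * x). Proof. by case: verma_left => _ _ _; apply. Qed.
Lemma verma_C r : I (S o1 o1 r). Proof. by move=> N _ H _ _. Qed.
Lemma verma_A r : I (S o2 o1 r - mu r *: 1). Proof. by move=> N _ _ H _. Qed.
Lemma verma_D r : I (D r - mub r *: 1). Proof. by move=> N _ _ _ H. Qed.

Definition word (rs : seq nat) : A := foldr (fun r w => S o2 o2 r * w) 1 rs.

(* The span of I and of the words of length at most k. *)
Inductive level (k : nat) : A -> Prop :=
| level_I x : I x -> level k x
| level_w c rs : (size rs <= k)%N -> level k (c *: word rs)
| level_D x y : level k x -> level k y -> level k (x + y).

Lemma level_subspace k : subspace (level k).
Proof.
split; [by apply: level_I; exact: (sub0 verma_subspace)|exact: level_D|].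
move=> c x; elim=> [y Iy|d rs Hs|y z _ IHy _ IHz].
- by apply: level_I; apply: (subZ verma_subspace).
- by rewrite scalerA; apply: level_w.
- by rewrite scalerDr; apply: level_D.
Qed.
Lemma level_le k l x : (k <= l)%N -> level k x -> level l x.
Proof.
move=> kl; elim=> [y Iy|d rs Hs|y z _ IHy _ IHz]; [exact: level_I| |exact: level_D].
by apply: level_w; apply: leq_trans kl.
Qed.
Lemma level_B k r x : level k x -> level k.+1 (S o2 o2 r * x).
Proof.
elim=> [y Iy|d rs Hs|y z _ IHy _ IHz].
- by apply: level_I; apply: vermaM => //; exact: Yq_s.
- by rewrite -scalerAr; apply: (level_w _ (rs := r :: rs)).
- by rewrite mulrDr; apply: level_D.
Qed.

Lemma level_stable k (a : A) : Y a -> (forall rs, (size rs <= k)%N -> level k (a * word rs)) ->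
  forall x, level k x -> level k (a * x).
Proof.
move=> Ya H x; elim=> [y Iy|d rs Hs|y z _ IHy _ IHz].
- by apply: level_I; apply: vermaM.
- by rewrite -scalerAr; apply: (subZ (level_subspace k)); apply: H.
- by rewrite mulrDr; apply: level_D.
Qed.

Lemma level_mu k (f : nat -> A) (m : nat -> C) r : (forall r, I (f r - m r *: 1)) -> level k (f r * 1).
Proof.
move=> H; rewrite mulr1 -[f r](subrK (m r *: 1)); apply: level_D; first by apply: level_I; apply: H.
exact: (level_w _ (rs := [::])).
Qed.

Lemma level_word0 r : [/\ level 0 (S o2 o1 r * word [::]), level 0 (S o1 o2 r * word [::])
  & level 0 (S o1 o1 r * word [::])].
Proof.
have LA m : level 0 (S o2 o1 m * 1) by apply: level_mu verma_A.
have LD m : level 0 (D m * 1) by apply: level_mu verma_D.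
have sL := level_subspace 0.
split=> //; last by apply: level_I; rewrite mulr1; apply: verma_C.
move: r; rewrite /=.
apply: (shift2_ind sL (c := 1) (g := fun n => (- (q *: D n - q^-1 *: shift2 D n)
  - h *: shift2 (S o2 o1) n) * 1)) => n.
  by rewrite -(symm_coef q0 rels_bt) scale1r mulrBl; congr (_ - _); case: n => [|[|n]] /=; rewrite ?mul0r.
rewrite mulr1; have mul1 f m : level 0 (f m * 1) -> level 0 (f m) by rewrite mulr1.
apply: (subB sL); [apply/(subN sL)/(subB sL)|]; apply: (subZ sL); rewrite ?(sub_shift2 sL) //.
- exact: mul1.
- by apply: (sub_shift2 sL) => m; apply: mul1.
- by apply: (sub_shift2 sL) => m; apply: mul1.
Qed.

Lemma level_ACE k r x : level k x ->
  [/\ level k (S o2 o1 r * x), level k (S o1 o2 r * x) & level k (S o1 o1 r * x)].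
Proof.
have W n : (forall rs r, (size rs <= n)%N -> [/\ level n (S o2 o1 r * word rs),
    level n (S o1 o2 r * word rs) & level n (S o1 o1 r * word rs)]) ->
    forall r x, level n x ->
    [/\ level n (S o2 o1 r * x), level n (S o1 o2 r * x) & level n (S o1 o1 r * x)].
  move=> H m y Ly; split; apply: level_stable => //; try exact: Yq_s;
  by move=> rs Hs; case: (H rs m Hs).
apply: (W k); elim: k {r x} => [|k IH] [|b rs] r //= Hs.
- exact: level_word0.
- by have [H1 H2 H3] := level_word0 r; split; apply: level_le _ _; try eassumption.
have {}IH := W k IH.
set w := word rs; have Lw : level k w by rewrite -[w]scale1r; apply: level_w.
have sL := level_subspace k.+1.
have LB m x : level k x -> level k.+1 (S o2 o2 m * x) by apply: level_B.
have LA m x : level k x -> level k.+1 (S o2 o1 m * x).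
  by move=> Lx; apply: level_le (leqnSn k) _; case: (IH m x Lx).
have LE m x : level k x -> level k.+1 (S o1 o2 m * x).
  by move=> Lx; apply: level_le (leqnSn k) _; case: (IH m x Lx).
have Qw a b' c d (F : nat -> nat -> A) u v :
    (forall r s, level k.+1 (F r s * w)) -> level k.+1 (quad a b' c d F u v * w).
  by move=> HF; rewrite quadMr; apply: (sub_quad sL).
have Qs (a b' c d : C) (F : nat -> nat -> A) : b' * d != 0 ->
    (forall u v, level k.+1 (quad a b' c d F u v * w)) -> forall r s, level k.+1 (F r s * w).
  by move=> bd HF; apply: (quad_sub sL bd) => u v; rewrite -quadMr.
have n1 : (-1) * (-1) != 0 :> C by rewrite mulrNN mulr1 oner_neq0.
have nq : (-1) * (- q) != 0 :> C by rewrite mulrNN mul1r.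
have BA u v : level k.+1 (S o2 o2 u * S o2 o1 v * w).
  by rewrite -mulrA; apply: LB; case: (IH v w Lw).
have BE u v : level k.+1 (S o2 o2 u * S o1 o2 v * w).
  by rewrite -mulrA; apply: LB; case: (IH v w Lw).
have AB : forall u v, level k.+1 (S o2 o1 v * S o2 o2 u * w).
  apply: (Qs 1 (-1) 1 (-1) (fun u v => S o2 o1 v * S o2 o2 u)) => // u v.
  have E := refl_AB q0 rels_tt rels_bb rels_bt u v.
  rewrite (sum3_l (esym E)).
  by rewrite !mulrBl; do 2?apply: (subB sL); apply: Qw => *; rewrite ?BA ?BE.
have EB : forall u v, level k.+1 (S o1 o2 u * S o2 o2 v * w).
  apply: (Qs 1 (-1) q^-1 (-q) (fun u v => S o1 o2 u * S o2 o2 v)) => // u v.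
  have E := refl_EB q0 rels_tt rels_bb rels_bt u v.
  rewrite (sum3_l E) !mulrBl mulrDl.
  by do 2?apply: (subB sL); do 1?apply: (subD sL); apply: Qw => *; rewrite ?BA ?BE ?AB.
have CB : forall u v, level k.+1 (S o1 o1 u * S o2 o2 v * w).
  apply: (Qs 1 (-1) 1 (-1) (fun u v => S o1 o1 u * S o2 o2 v)) => // u v.
  have E := refl_CB q0 rels_tt rels_bb rels_bt u v.
  rewrite (sum3_l E).
  have LAA x y : level k.+1 (S o2 o1 x * S o2 o1 y * w).
    by rewrite -mulrA; apply: LA; case: (IH y w Lw).
  have LAE x y : level k.+1 (S o2 o1 x * S o1 o2 y * w).
    by rewrite -mulrA; apply: LA; case: (IH y w Lw).
  have LEE x y : level k.+1 (S o1 o2 x * S o1 o2 y * w).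
    by rewrite -mulrA; apply: LE; case: (IH y w Lw).
  have LBC x y : level k.+1 (S o2 o2 x * S o1 o1 y * w).
    by rewrite -mulrA; apply: LB; case: (IH y w Lw).
  rewrite !mulrBl !mulrDl.
  by do 2?apply: (subB sL); do 2?apply: (subD sL); apply: Qw => *; rewrite ?LAA ?LAE ?LEE ?LBC.
by split; rewrite mulrA.
Qed.

Local Notation E0 := (S o1 o2 0%N).
Lemma s12_0 : E0 = q *: (t o1 o1 0%N * tb o2 o2 0%N).
Proof. by case: HR => t0 _ _ _ _; rewrite /s_coef big_ord1 /= t0 mul0r subr0. Qed.
Lemma s12invK : K' * E0 = 1.
Proof.
case: HR => _ _ _ H _; have [_ H1 _ _] := H o1; have [_ _ _ H2] := H o2.
rewrite s12_0 /s12inv -scalerAl -scalerAr scalerA mulVf // scale1r.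
by rewrite -mulrA (mulrA (ti o1)) H1 mul1r H2.
Qed.
Lemma s12_B r : E0 * S o2 o2 r = (q^-1 * q^-1) *: (S o2 o2 r * E0).
Proof.
have := refl_EB q0 rels_tt rels_bb rels_bt 0%N r.+1.
rewrite !quad.unlock /shift /= !subn1 /= !(scaler0, addr0, add0r, mul0r, scale0r, mulr0) !mul1r.
move=> /(congr1 ( *:%R (- q^-1))); rewrite !scalerA mulrNN mulVf // scale1r mulrN1 mulrNN.
by move=> ->.
Qed.

Hypothesis I1 : ~ I 1.
Let eps0 := - (q * mub 0%N).
Definition lam k : C := - (q * mub 0%N) * (q^-1 * q^-1) ^+ k.

Lemma mub0_neq0 : mub 0%N != 0.
Proof.
apply/eqP => m0; apply: I1; rewrite -s12invK; apply: vermaM Yq_inv _.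
have := symm_coef q0 rels_bt 0%N; rewrite /= !(scaler0, subr0) => ->.
apply: (subN verma_subspace); apply: (subZ verma_subspace).
by have := verma_D 0%N; rewrite m0 scale0r subr0.
Qed.
Lemma lam_neq0 k : lam k != 0.
Proof. by rewrite /lam mulf_neq0 ?expf_neq0 ?mulf_neq0 ?invr_eq0 // oppr_eq0 mulf_neq0 // mub0_neq0. Qed.
Lemma lam_inj j k : lam j = lam k -> j = k.
Proof.
suff H : forall j k, (j < k)%N -> lam j <> lam k.
  by case: (ltngtP j k) => // jk E; [case: (H _ _ jk)|case: (H _ _ jk)].
move=> {j k} j k jk /mulfI E; have {E} := E _; rewrite oppr_eq0 mulf_neq0 ?mub0_neq0 // => /(_ isT).
rewrite -(subnK (ltnW jk)) exprD -[X in X = _]mul1r => /mulIf E.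
have {E} := E (expf_neq0 _ (mulf_neq0 (invr_neq0 q0) (invr_neq0 q0))).
move=> E; have := hq (n := (k - j) + (k - j)); rewrite addn_gt0 subn_gt0 jk => /(_ isT) /eqP; apply.
by rewrite exprD -exprMn -[q * q]invrK exprVn invfM -E invr1.
Qed.

Lemma E0_word rs : I (E0 * word rs - lam (size rs) *: word rs).
Proof.
have sI := verma_subspace.
elim: rs => [|r rs IH] /=.
  have := symm_coef q0 rels_bt 0%N; rewrite /= !(scaler0, subr0) mulr1 => ->.
  rewrite /lam expr0 mulr1 scaleNr opprK addrC -scalerA -scalerBr; apply: (subZ sI).
  by rewrite -opprB; apply: (subN sI); apply: verma_D.
rewrite mulrA s12_B -scalerAl -mulrA.
have -> : lam (size rs).+1 = (q^-1 * q^-1) * lam (size rs) by rewrite /lam exprS mulrCA.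
move: (q^-1 * q^-1) => p; rewrite -scalerA -scalerBr scalerAr -mulrBr; apply: (subZ sI).
by apply: vermaM => //; apply: Yq_s.
Qed.

Lemma level_inv k x : level k x -> level k (K' * x).
Proof.
apply: (level_stable Yq_inv) => rs Hs; have sL := level_subspace k.
have := vermaM Yq_inv (E0_word rs); rewrite mulrBr mulrA s12invK mul1r -scalerAr => H.
rewrite -[K' * word rs](scalerK (lam_neq0 (size rs))); apply: (subZ sL).
rewrite -[_ *: _](subKr (word rs)).
by apply: (subB sL); [rewrite -[word rs]scale1r; apply: level_w|apply: level_I].
Qed.

Lemma Yq_level y : Y y -> forall k x, level k x -> exists l, level l (y * x).
Proof.
move=> /(_ (fun y => forall k x, level k x -> exists l, level l (y * x))) H.
apply: H => [|i j r k x L|k x L]; first split.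
- by move=> k x L; exists k; rewrite mul1r.
- move=> y1 y2 H1 H2 k x L; have [l1 L1] := H1 k x L; have [l2 L2] := H2 k x L.
  exists (maxn l1 l2); rewrite mulrDl; apply: level_D.
    exact: level_le (leq_maxl _ _) L1.
  exact: level_le (leq_maxr _ _) L2.
- move=> c y1 H1 k x L; have [l1 L1] := H1 k x L; exists l1.
  by rewrite -scalerAl; apply: (subZ (level_subspace l1)).
- move=> y1 y2 H1 H2 k x L; have [l2 L2] := H2 k x L.
  by have [l1 L1] := H1 _ _ L2; exists l1; rewrite -mulrA.
- have [LA LE LC] := level_ACE r L.
  case: (ord2E i) (ord2E j) => -> [] ->; [by exists k|by exists k|by exists k|].
  by exists k.+1; apply: level_B.
- by exists k; apply: level_inv.
Qed.

Fixpoint Pop K (y : A) : A := if K is K.+1 then E0 * Pop K y - lam K.+1 *: Pop K y else y.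

Lemma PopD K x y : Pop K (x + y) = Pop K x + Pop K y.
Proof. by elim: K => //= K ->; rewrite mulrDr scalerDr opprD addrACA. Qed.
Lemma PopZ K c x : Pop K (c *: x) = c *: Pop K x.
Proof. by elim: K => //= K ->; rewrite -scalerAr scalerA mulrC -scalerA -scalerBr. Qed.
Lemma PopI N K x : left_ideal Y N -> N x -> N (Pop K x).
Proof.
move=> HN Nx; have sN := left_subspace HN; have [_ _ _ NM] := HN.
elim: K => //= K IH; apply: (subB sN); last exact: (subZ sN).
by apply: NM => //; apply: Yq_s.
Qed.
Lemma Pop_le K L x : (K <= L)%N -> I (Pop K x) -> I (Pop L x).
Proof.
have sI := verma_subspace.
move=> /subnK <-; elim: (L - K)%N => //= m IH /IH H; apply: (subB sI); last exact: (subZ sI).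
by apply: vermaM => //; apply: Yq_s.
Qed.
Lemma Pop_word K rs : I (Pop K (word rs) - (\prod_(j < K) (lam (size rs) - lam j.+1)) *: word rs).
Proof.
have sI := verma_subspace.
elim: K => [|K IH]; first by rewrite big_ord0 scale1r subrr; apply: (sub0 sI).
rewrite big_ord_recr /=; set p := \prod_(_ < K) _ in IH *; set P := Pop K _ in IH *.
rewrite [X in I X](_ : _ = (E0 * (P - p *: word rs) - lam K.+1 *: (P - p *: word rs))
   + p *: (E0 * word rs - lam (size rs) *: word rs)).
  apply: (subD sI); last by apply: (subZ sI); apply: E0_word.
  by apply: (subB sI); [apply: vermaM => //; apply: Yq_s|apply: (subZ sI)].
by rewrite (mulrBr E0) -scalerAr; linring.
Qed.

Lemma Pop_level k x : level k x -> exists c, I (Pop k x - c *: 1).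
Proof.
have sI := verma_subspace.
elim=> [y Iy|c rs Hs|y z _ [c Hc] _ [d Hd]].
- by exists 0; rewrite scale0r subr0; exact: (PopI _ verma_left Iy).
- have H := Pop_word k rs; rewrite PopZ.
  case: rs Hs H => [|r rs] Hs H; last first.
    exists 0; rewrite scale0r subr0; apply: (subZ sI).
    by move: H; rewrite (bigD1 (Ordinal Hs)) //= subrr mul0r scale0r subr0.
  set p := (X in X *: _) in H; exists (c * p).
  by rewrite -scalerA -scalerBr; apply: (subZ sI).
- exists (c + d); rewrite PopD scalerDl opprD addrACA; exact: (subD sI).
Qed.

Lemma max_sub1 : ~ max_sub q t tb ti tbi mu mub 1.
Proof.
have sI := verma_subspace.
move=> /(_ (fun y => exists K, I (Pop K y))) [].
- by exists 0%N; apply: (sub0 sI).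
- move=> x y [K Hx] [L Hy]; exists (maxn K L); rewrite PopD; apply: (subD sI).
    exact: Pop_le (leq_maxl _ _) Hx.
  exact: Pop_le (leq_maxr _ _) Hy.
- move=> N [HN IN N1] y Ny; have sN := left_subspace HN.
  have [l Ll] : exists l, level l (y * 1).
    by apply: (Yq_level _ (k := 0)); [case: HN => + _ _ _; apply|rewrite -[1]scale1r; apply: (level_w 1 (rs := [::]))].
  rewrite mulr1 in Ll; have [c Hc] := Pop_level Ll; exists l.
  have [c0|c0] := eqVneq c 0; first by move: Hc; rewrite c0 scale0r subr0.
  case: N1; rewrite -[1](scalerK c0); apply: (subZ sN).
  rewrite -[_ *: _](subKr (Pop l y)).
  by apply: (subB sN); [exact: (PopI _ HN Ny)|exact: IN].
- move=> K H; have := Pop_word K [::]; rewrite /= => H2; apply: I1.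
  have := subB sI H H2; rewrite opprB addrCA subrr addr0 => H3.
  rewrite -[1](scalerK (a := \prod_(j < K) (lam 0 - lam j.+1))); first exact: (subZ sI).
  by apply/prodf_neq0 => j _; rewrite subr_eq0; apply/eqP => /lam_inj.
Qed.
End Verma.

Section Coordinates.
Variables (V : lmodType C) (Y J : V -> Prop) (sY : subspace Y) (sJ : subspace J).

Definition spanning n (v : 'I_n -> V) := (forall k, Y (v k)) /\
  forall y, Y y -> exists c : 'I_n -> C, J (y - \sum_(k < n) c k *: v k).

Lemma coordinates : (exists n (v : 'I_n -> V), spanning v) ->
  exists N (co : V -> 'cV[C]_N) (v : 'I_N -> V),
  [/\ forall x y, Y x -> Y y -> co (x + y) = co x + co y,
      forall c x, Y x -> co (c *: x) = c *: co x,
      forall x, Y x -> (co x = 0 <-> J x),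
      forall k, Y (v k) &
      forall x, Y x -> J (x - \sum_k co x k 0 *: v k)].
Proof.
move=> ex; have ex' : exists n, `[< exists v : 'I_n -> V, spanning v >].
  by case: ex => n [v Hv]; exists n; apply/asboolP; exists v.
case: (ex_minnP ex') => N /asboolP[v [Yv Hv]] Nmin.
have vfree (c : 'I_N -> C) : J (\sum_k c k *: v k) -> forall k, c k = 0.
  move=> Jc k; apply: contrapT => /eqP ck.
  case: N k v Yv Hv Nmin c Jc ck => [[//]|N] k v Yv Hv Nmin c Jc ck.
  suff /Nmin : `[< exists v : 'I_N -> V, spanning v >] by rewrite ltnn.
  apply/asboolP; exists (v \o lift k); split=> [i|y Yy]; first exact: Yv.
  have [d Hd] := Hv y Yy; exists (fun i => d (lift k i) - (d k / c k) * c (lift k i)).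
  have sumE (e : 'I_N.+1 -> C) : \sum_i e i *: v i = e k *: v k + \sum_(i < N) e (lift k i) *: v (lift k i).
    rewrite (bigD1 k) //=; congr (_ + _).
    rewrite (reindex_omap (lift k) (unlift k)) => [|i ik]; last first.
      by case: unliftP ik => [j ->|->]; rewrite ?eqxx.
    by apply: eq_bigl => i; rewrite eq_sym neq_lift liftK eqxx.
  rewrite [X in J X](_ : _ = (y - \sum_i d i *: v i) + (d k / c k) *: \sum_i c i *: v i).
    by apply: (subD sJ) => //; apply: (subZ sJ).
  rewrite !sumE; rewrite (eq_bigr (fun i => d (lift k i) *: v (lift k i) - (d k / c k) *: (c (lift k i) *: v (lift k i)))).
    rewrite sumrB -scaler_sumr scalerDr scalerA divfK //.
    by move: (\sum_(i < N) _) => s1; move: (\sum_(i < N) _) => s2; linring.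
  by move=> i _; rewrite scalerBl scalerA.
have /choice[co Hco] : forall y, exists c : 'cV[C]_N, Y y -> J (y - \sum_k c k 0 *: v k).
  move=> y; have [Yy|nY] := pselect (Y y); last by exists 0.
  have [c Hc] := Hv y Yy; exists (\col_k c k) => _.
  by under eq_bigr do rewrite mxE.
have uniq y (c d : 'cV[C]_N) : J (y - \sum_k c k 0 *: v k) -> J (y - \sum_k d k 0 *: v k) -> c = d.
  move=> H1 H2; apply/matrixP => k j; rewrite (ord1 j); apply/eqP; rewrite -subr_eq0; apply/eqP.
  apply: (vfree (fun k => c k 0 - d k 0)).
  under eq_bigr do rewrite scalerBl; rewrite sumrB.
  have := subB sJ H2 H1; congr J.
  by move: (\sum_k _) => s1; move: (\sum_k _) => s2; linring.
exists N, co, v; split=> //.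
- move=> x y Yx Yy; apply: (uniq (x + y)); first exact/Hco/(subD sY).
  under eq_bigr do rewrite mxE scalerDl; rewrite big_split opprD addrACA.
  exact: (subD sJ (Hco _ Yx) (Hco _ Yy)).
- move=> c x Yx; apply: (uniq (c *: x)); first exact/Hco/(subZ sY).
  under eq_bigr do rewrite mxE -scalerA; rewrite -scaler_sumr -scalerBr.
  exact: (subZ sJ _ (Hco _ Yx)).
- move=> x Yx; split=> [c0|Jx].
    by have := Hco x Yx; rewrite c0 big1 ?subr0 // => k _; rewrite mxE scale0r.
  apply: (uniq x); first exact: Hco.
  by rewrite big1 ?subr0 // => k _; rewrite mxE scale0r.
Qed.
End Coordinates.

(* The operators of a finite-dimensional highest weight module that matter for the
   highest weight: A = s_21, B = s_22, D = sbar_21, E = s_12 and C = s_11^(0). *)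
Record hw_module (q : C) (mu mub : nat -> C) (N : nat) := HwModule {
  opA : nat -> 'M[C]_N; opB : nat -> 'M[C]_N; opD : nat -> 'M[C]_N; opE : nat -> 'M[C]_N;
  opC : 'M[C]_N; hwv : 'cV[C]_N;
  hwv_neq0 : hwv != 0;
  hwA : forall r, opA r *m hwv = mu r *: hwv;
  hwD : forall r, opD r *m hwv = mub r *: hwv;
  hwC : opC *m hwv = 0;
  opBB : forall r s, quad q^-1 (- q) q^-1 (- q) (fun r s => opB r *m opB s) r s =
                     quad q^-1 (- q) q^-1 (- q) (fun r s => opB s *m opB r) r s;
  opAB : forall r s, quad q^-1 (- q) q^-1 (- q) (fun r s => opB r *m opA s) r s =
    quad 1 (- 1) 1 (- 1) (fun r s => opA s *m opB r) r s +
    quad 1 (- 1) 0 (q^-1 - q) (fun r s => opB s *m opE r) r s +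
    quad 0 (q^-1 - q) q^-1 (- q) (fun r s => opB s *m opA r) r s;
  opEB : forall r s, quad 1 (- 1) q^-1 (- q) (fun r s => opE r *m opB s) r s +
    quad 0 (q^-1 - q) 1 (- 1) (fun r s => opB r *m opE s) r s +
    quad 0 (q^-1 - q) (q^-1 - q) 0 (fun r s => opA r *m opB s) r s =
    quad q^-1 (- q) 1 (- 1) (fun r s => opB s *m opE r) r s +
    quad q^-1 (- q) (q^-1 - q) 0 (fun r s => opA s *m opB r) r s;
  opE0B : forall r, opE 0%N *m opB r = (q^-1 * q^-1) *: (opB r *m opE 0%N);
  opCB : forall r, opC *m opB r - opB r *m opC =
    (q^-1 - q) *: (opE 0%N *m opE r) + ((q^-1 - q) * q) *: (opA r *m opE 0%N);
  opEAD : forall n, opE n - shift2 opE n =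
    - (q *: opD n - q^-1 *: shift2 opD n) - (q^-1 - q) *: shift2 opA n }.

Section Representation.
Variables (q : C) (q0 : q != 0) (hq : forall n : nat, (0 < n)%N -> q ^+ n != 1).
Variables (A : algType C) (t tb : 'I_2 -> 'I_2 -> nat -> A) (ti tbi : 'I_2 -> A).
Hypothesis HR : Uext_rels q t tb ti tbi.
Variables (mu mub : nat -> C).
Local Notation S := (s_coef q t tb).
Local Notation D := (sb_coef q t tb o2 o1).
Local Notation Y := (Yq q t tb ti tbi).
Local Notation I := (verma_ideal q t tb ti tbi mu mub).
Local Notation J := (max_sub q t tb ti tbi mu mub).
Local Notation h := (q^-1 - q).

Lemma s11_B r : S o1 o1 0%N * S o2 o2 r - S o2 o2 r * S o1 o1 0%N =
  h *: (S o1 o2 0%N * S o1 o2 r) + (h * q) *: (S o2 o1 r * S o1 o2 0%N).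
Proof.
have := refl_CB q0 (rels_tt HR) (rels_bb HR) (rels_bt HR) 0%N r.+1.
rewrite !quad.unlock /shift /= !subn1 /= !(scaler0, addr0, add0r, mul0r, scale0r, mulr0) !mul1r.
rewrite !scaleN1r => E; apply: (lin_comb (c := -1) E); linring.
Qed.

Hypothesis I1 : ~ I 1.
Lemma I_proper : Defs.proper_sub q t tb ti tbi mu mub I.
Proof. by split=> //; apply: verma_left. Qed.
Lemma max_sub_left : left_ideal Y J.
Proof.
have sY := Yq_subspace q t tb ti tbi; split.
- move=> x; apply; [exact: (sub0 sY)|exact: (subD sY)|].
  by move=> N [[NY _ _ _] _ _].
- by move=> N.
- by move=> x y Hx Hy N N0 ND H; apply: (ND); [apply: Hx|apply: Hy].
- move=> y x Yy Hx N N0 ND H; apply: (Hx (fun x => N (y * x))) => [|a b Na Nb|M HM z Mz].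
  + by rewrite mulr0.
  + by rewrite mulrDr; apply: ND.
  + apply: (H M HM); case: HM => -[_ _ _ MM] _ _; exact: MM.
Qed.
Lemma I_sub_J x : I x -> J x.
Proof. by move=> Ix N _ _ /(_ I I_proper); apply. Qed.

Lemma findim_hw_module : V_findim q t tb ti tbi mu mub -> exists N, inhabited (hw_module q mu mub N).
Proof.
have sY := Yq_subspace q t tb ti tbi; have sJ := left_subspace max_sub_left.
have J1 := max_sub1 q0 hq HR I1; have [_ _ _ JM] := max_sub_left.
move=> /(coordinates sY sJ)[N [co [v [coD coZ coJ Yv Hv]]]]; exists N.
have YM := @YqM q A t tb ti tbi.
pose rho y : 'M[C]_N := \matrix_(l, k) co (y * v k) l 0.
have co0 : co 0 = 0 by apply/coJ; [exact: sub0 sY|exact: sub0 sJ].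
have cosum (c : 'I_N -> C) (w : 'I_N -> A) : (forall k, Y (w k)) -> co (\sum_k c k *: w k) = \sum_k c k *: co (w k).
  move=> Yw; suff [] : Y (\sum_k c k *: w k) /\ co (\sum_k c k *: w k) = \sum_k c k *: co (w k) by [].
  elim/big_rec2: _ => [|k y1 y2 _ [Yy <-]]; first by split=> //; exact: sub0 sY.
  have Yk : Y (c k *: w k) by apply: (subZ sY).
  by split; [exact: (subD sY)|rewrite coD // coZ].
have rhoE y z : Y y -> Y z -> rho y *m co z = co (y * z).
  move=> Yy Yz.
  have -> : co (y * z) = co (\sum_k co z k 0 *: (y * v k)).
    have Ys : Y (\sum_k co z k 0 *: (y * v k)).
      by apply: (sub_sum sY) => k _; apply: (subZ sY); apply: YM.
    apply/eqP; rewrite -subr_eq0 -scaleN1r -coZ // -coD ?scaleN1r; last exact: (subN sY); last exact: YM.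
    apply/eqP/coJ; first by apply: (subB sY) => //; apply: YM.
    have := JM y _ Yy (Hv z Yz); rewrite mulrBr mulr_sumr.
    by under eq_bigr do rewrite -scalerAr.
  rewrite cosum => [|k]; last exact: YM.
  apply/matrixP => l j; rewrite (ord1 j) mxE summxE; apply: eq_bigr => k _.
  by rewrite !mxE mulrC.
have rhoM y z : Y y -> Y z -> rho (y * z) = rho y *m rho z.
  move=> Yy Yz; apply/matrixP => l k; rewrite !mxE -mulrA -rhoE //; last exact: YM.
  by rewrite mxE; apply: eq_bigr => j _; rewrite !mxE.
have rhoD y z : Y y -> Y z -> rho (y + z) = rho y + rho z.
  by move=> Yy Yz; apply/matrixP => l k; rewrite !mxE mulrDl coD ?mxE //; apply: YM.
have rhoZ c y : Y y -> rho (c *: y) = c *: rho y.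
  by move=> Yy; apply/matrixP => l k; rewrite !mxE -scalerAl coZ ?mxE //; apply: YM.
have rho0 : rho 0 = 0 by rewrite -(scale0r 0) rhoZ ?scale0r //; exact: sub0 sY.
have rhoB y z : Y y -> Y z -> rho (y - z) = rho y - rho z.
  by move=> Yy Yz; rewrite -scaleN1r rhoD ?rhoZ ?scaleN1r //; exact: (subN sY).
have rhoq a b c d F r s : (forall r s, Y (F r s)) -> rho (quad a b c d F r s) = quad a b c d (fun r s => rho (F r s)) r s.
  move=> YF; rewrite !quad.unlock; have Ys i j : Y (shift i j F r s) by apply: (sub_shift sY).
  have rs i j : rho (shift i j F r s) = shift i j (fun r s => rho (F r s)) r s by rewrite /shift; case: ifP.
  by rewrite !rhoD ?rhoZ ?rs //; do ?apply: (subD sY); apply: (subZ sY).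
have rho2 (f : nat -> A) n : rho (shift2 f n) = shift2 (fun n => rho (f n)) n by case: n => [|[|n]].
have Y2 (f : nat -> A) n : (forall n, Y (f n)) -> Y (shift2 f n) by move=> H; apply: (sub_shift2 sY).
have YS i j r : Y (S i j r) := @Yq_s q A t tb ti tbi i j r.
have YD r : Y (D r) := @Yq_sb q q0 A t tb ti tbi HR r.
have YSS i j r k l s : Y (S i j r * S k l s) by apply: YM.
have Y1 : Y 1 := @Yq1 q A t tb ti tbi.
have YQ a b c d (F : nat -> nat -> A) r s : (forall r s, Y (F r s)) -> Y (quad a b c d F r s).
  exact: (sub_quad sY).
have rq a b c d (f g : nat -> nat -> A) r s : (forall r s, Y (f r s)) -> (forall r s, Y (g r s)) ->
    rho (quad a b c d (fun r s => f r s * g r s) r s) = quad a b c d (fun r s => rho (f r s) *m rho (g r s)) r s.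
  move=> Yf Yg; rewrite rhoq; last by move=> *; exact: YM.
  by rewrite (@quad_ext _ a b c d _ (fun r s => rho (f r s) *m rho (g r s))) // => u w; rewrite rhoM.
have hwE f (m : nat -> C) r : Y (f r) -> I (f r - m r *: 1) -> rho (f r) *m co 1 = m r *: co 1.
  move=> Yf If; rewrite rhoE // mulr1; apply/eqP; rewrite -subr_eq0 -coZ // -scaleN1r.
  rewrite -coZ; last exact: (subZ sY).
  rewrite -coD ?scaleN1r //; last by apply: (subN sY); exact: (subZ sY).
  apply/eqP/coJ; last exact: I_sub_J.
  by apply: (subB sY) => //; apply: (subZ sY).
constructor.
apply: (@HwModule q mu mub N (fun r => rho (S o2 o1 r)) (fun r => rho (S o2 o2 r))
  (fun r => rho (D r)) (fun r => rho (S o1 o2 r)) (rho (S o1 o1 0%N)) (co 1)).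
- by apply/eqP => c1; apply: J1; exact: (proj1 (coJ 1 Y1) c1).
- by move=> r; apply: (hwE (fun r => S o2 o1 r)) => //; exact: verma_A.
- by move=> r; apply: (hwE (fun r => D r)) => //; exact: verma_D.
- rewrite rhoE // mulr1; apply: (proj2 (coJ _ (YS o1 o1 0%N))).
  by apply: I_sub_J; exact: verma_C.
- move=> r s; have := congr1 rho (refl_BB q0 (rels_tt HR) (rels_bb HR) (rels_bt HR) r s).
  by rewrite !rq.
- move=> r s; have := congr1 rho (refl_AB q0 (rels_tt HR) (rels_bb HR) (rels_bt HR) r s).
  by rewrite !rhoD ?rq //; do ?apply: (subD sY); exact: YQ.
- move=> r s; have := congr1 rho (refl_EB q0 (rels_tt HR) (rels_bb HR) (rels_bt HR) r s).
  by rewrite !rhoD ?rq //; do ?apply: (subD sY); exact: YQ.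
- move=> r; have := congr1 rho (s12_B q0 HR r).
  by rewrite rhoZ // !rhoM.
- move=> r; have := congr1 rho (s11_B r).
  by rewrite rhoB // rhoD ?rhoZ // ?rhoM //; exact: (subZ sY).
- move=> n; have := congr1 rho (symm_coef q0 (rels_bt HR) n).
  have YZ c y : Y y -> Y (c *: y) by apply: (subZ sY).
  have YB y z : Y y -> Y z -> Y (y - z) by apply: (subB sY).
  have Yo (i j : 'I_2) : Y (shift2 (S i j) n) by apply: Y2.
  have YDo : Y (shift2 D n) by apply: Y2.
  have rhoN y : Y y -> rho (- y) = - rho y by move=> Yy; rewrite -scaleN1r rhoZ // scaleN1r.
  have YX : Y (q *: D n - q^-1 *: shift2 D n) by apply: YB; apply: YZ.
  rewrite rhoB // rho2 (rhoB (- _)); [|exact: (subN sY)|exact: YZ].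
  by rewrite rhoN // rhoB ?rhoZ ?rho2 //; apply: YZ.
Qed.
End Representation.

Lemma dependent_descent (K F : fieldType) (io : {rmorphism K -> F}) k (phi : 'I_k -> nat -> K) (m : 'rV[F]_k) :
  m != 0 -> (forall r, \sum_j m 0 j * io (phi j r) = 0) ->
  exists2 c : 'rV[K]_k, c != 0 & forall r, \sum_j c 0 j * phi j r = 0.
Proof.
move=> m0 mphi; pose M R : 'M[K]_(k, R) := \matrix_(j, r) phi j r.
have mM R : m *m map_mx io (M R) = 0.
  apply/matrixP => i r; rewrite (ord1 i) !mxE -[RHS](mphi r).
  by apply: eq_bigr => j _; rewrite !mxE.
have ker0 R : kermx (M R) != 0.
  rewrite kermx_eq0; apply: contra m0 => fM.
  by have /row_freeP[N mN] : row_free (map_mx io (M R)); rewrite ?row_free_map //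
    -[m]mulmx1 -mN mulmxA mM mul0mx.
have ex : exists d, `[< exists R, \rank (kermx (M R)) = d >].
  by exists (\rank (kermx (M 0%N))); apply/asboolP; exists 0%N.
case: (ex_minnP ex) => d /asboolP[R Rd] dmin.
exists (nz_row (kermx (M R))); first by rewrite nz_row_eq0.
have subK R' : (R <= R')%N -> (kermx (M R') <= kermx (M R))%MS.
  move=> RR; apply/sub_kermxP; apply/matrixP => i r; rewrite !mxE.
  have /matrixP/(_ i (widen_ord RR r)) := mulmx_ker (M R'); rewrite !mxE => E.
  by rewrite -[RHS]E; apply: eq_bigr => j _; rewrite !mxE.
move=> r; pose R' := maxn R r.+1.
have RR : (R <= R')%N by apply: leq_maxl.
have /eqmxP KE : (kermx (M R') == kermx (M R))%MS.
  rewrite -(geq_leqif (mxrank_leqif_eq (subK _ RR))) Rd.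
  by apply: dmin; apply/asboolP; exists R'.
have : (nz_row (kermx (M R)) <= kermx (M R'))%MS by rewrite KE nz_row_sub.
move=> /sub_kermxP /matrixP /(_ 0 (Ordinal (leq_maxr R r.+1))); rewrite !mxE => E.
by rewrite -[RHS]E; apply: eq_bigr => j _; rewrite mxE.
Qed.

(* A field with n points in general position at which formal power series over C,
   in one variable or in a pair of variables, can be evaluated. *)
Record points (n : nat) := Points {
  pF : fieldType;
  pio : {rmorphism C -> pF};
  pw : nat -> pF;
  pev : nat -> (nat -> C) -> pF;
  pev2 : nat -> nat -> (nat -> nat -> C) -> pF;
  pevD : forall i f g, (i < n)%N -> pev i (fun r => f r + g r) = pev i f + pev i g;
  pevZ : forall i c f, (i < n)%N -> pev i (fun r => c * f r) = pio c * pev i f;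
  pev1 : forall i, (i < n)%N -> pev i (fun r => (r == 0%N)%:R) = 1;
  pevX : forall i f, (i < n)%N -> pev i (fun r => if r is m.+1 then f m else 0) = pw i * pev i f;
  pev_inj : forall i f, (i < n)%N -> pev i f = 0 -> forall r, f r = 0;
  pev2D : forall i j f g, (i < n)%N -> (j < n)%N -> i != j ->
    pev2 i j (fun r s => f r s + g r s) = pev2 i j f + pev2 i j g;
  pev2Z : forall i j c f, (i < n)%N -> (j < n)%N -> i != j ->
    pev2 i j (fun r s => c * f r s) = pio c * pev2 i j f;
  pev2x : forall i j f, (i < n)%N -> (j < n)%N -> i != j ->
    pev2 i j (fun r s => if r is m.+1 then f m s else 0) = pw i * pev2 i j f;
  pev2y : forall i j f, (i < n)%N -> (j < n)%N -> i != j ->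
    pev2 i j (fun r s => if s is m.+1 then f r m else 0) = pw j * pev2 i j f;
  pev2_inj : forall i j f, (i < n)%N -> (j < n)%N -> i != j ->
    pev2 i j f = 0 -> forall r s, f r s = 0;
  pev2M : forall i j f g, (i < n)%N -> (j < n)%N -> i != j ->
    pev2 i j (fun r s => f r * g s) = pev i f * pev j g;
  pdet : forall phi : nat -> nat -> C, \det (\matrix_(i < n, j < n) pev i (phi j)) = 0 ->
    exists2 c : 'rV[C]_n, c != 0 & forall r, \sum_j c 0 j * phi j r = 0 }.

Lemma points_exist n : inhabited (points n).
Proof.
elim: n => [|n [P]].
  constructor; apply: (@Points 0 C idfun (fun=> 0) (fun _ _ => 0) (fun _ _ _ => 0)) => //.
  by move=> phi; rewrite det_mx00 => /eqP; rewrite oner_eq0.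
case: P => F io w ev ev2 evD evZ ev1 evX ev_inj ev2D ev2Z ev2x ev2y ev2_inj ev2M dt.
pose L : idomainType := pser F.
pose T : {rmorphism L -> {fraction L}} := @tofrac L.
pose cst : {rmorphism F -> L} := @pser_const F.
have T0 x : T x = 0 -> x = 0 by move=> /eqP; rewrite tofrac_eq0 => /eqP.
have c0 x : cst x = 0 -> x = 0 by move=> /(congr1 (fun f => pcoef f 0%N)).
have cstE x (f : L) k : pcoef (cst x * f) k = x * pcoef f k by apply: pcoef_constM.
have X (f : L) k : pcoef ((pvar F : L) * f) k = if k is m.+1 then pcoef f m else 0 by apply: pcoef_varM.
have ev0 i : (i < n)%N -> ev i (fun=> 0) = 0.
  by move=> Hi; have := evZ i 0 (fun=> 0) Hi; rewrite rmorph0 !mul0r.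
pose io' : {rmorphism C -> {fraction L}} := T \o cst \o io.
pose w' i := if (i < n)%N then T (cst (w i)) else T (pvar F).
pose ev' i f := if (i < n)%N then T (cst (ev i f)) else T (Pser (fun r => io (f r))).
pose ev2' i j (f : nat -> nat -> C) := if (i < n)%N then
    if (j < n)%N then T (cst (ev2 i j f)) else T (Pser (fun s => ev i (fun r => f r s)))
  else T (Pser (fun r => ev j (fun s => f r s))).
constructor; apply: (@Points n.+1 {fraction L} io' w' ev' ev2').
- move=> i f g; rewrite /ev' => _; case: (ltnP i n) => /= ni.
    by rewrite evD // !rmorphD.
  by rewrite -rmorphD; apply: (congr1 T); apply: pserP => r; rewrite pcoefD /= rmorphD.
- move=> i c f; rewrite /ev' /io' => _; case: (ltnP i n) => /= ni.
    by rewrite evZ // !rmorphM.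
  by rewrite -rmorphM; apply: (congr1 T); apply: pserP => r; rewrite cstE /= rmorphM.
- move=> i; rewrite /ev' => _; case: (ltnP i n) => /= ni; first by rewrite ev1 // !rmorph1.
  by rewrite -(rmorph1 T); apply: (congr1 T); apply: pserP => -[|r] /=; rewrite ?rmorph1 ?rmorph0.
- move=> i f; rewrite /ev' /w' => _; case: (ltnP i n) => /= ni.
    by rewrite evX // !rmorphM.
  by rewrite -rmorphM; apply: (congr1 T); apply: pserP => -[|r]; rewrite X /= ?rmorph0.
- move=> i f; rewrite /ev' => _; case: (ltnP i n) => /= ni.
    by move=> /T0/c0; apply: ev_inj.
  move=> /T0 H r; have := congr1 (fun u => pcoef u r) H.
  by rewrite pcoef0 /= => /eqP; rewrite fmorph_eq0 => /eqP.
- move=> i j f g; rewrite !ltnS /ev2' => Hi Hj ij; case: (ltnP i n) => /= ni; last first.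
    have nj : (j < n)%N by move: ij; rewrite (anti_leq (introT andP (conj Hi ni))) ltn_neqAle eq_sym Hj => ->.
    by rewrite -rmorphD; apply: (congr1 T); apply: pserP => r; rewrite pcoefD /= evD.
  case: (ltnP j n) => /= nj; first by rewrite ev2D // !rmorphD.
  by rewrite -rmorphD; apply: (congr1 T); apply: pserP => r; rewrite pcoefD /= evD.
- move=> i j c f; rewrite !ltnS /ev2' /io' => Hi Hj ij; case: (ltnP i n) => /= ni; last first.
    have nj : (j < n)%N by move: ij; rewrite (anti_leq (introT andP (conj Hi ni))) ltn_neqAle eq_sym Hj => ->.
    by rewrite -rmorphM; apply: (congr1 T); apply: pserP => r; rewrite cstE /= evZ.
  case: (ltnP j n) => /= nj; first by rewrite ev2Z // !rmorphM.
  by rewrite -rmorphM; apply: (congr1 T); apply: pserP => r; rewrite cstE /= evZ.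
- move=> i j f; rewrite !ltnS /ev2' /w' => Hi Hj ij; case: (ltnP i n) => /= ni; last first.
    have nj : (j < n)%N by move: ij; rewrite (anti_leq (introT andP (conj Hi ni))) ltn_neqAle eq_sym Hj => ->.
    by rewrite -rmorphM; apply: (congr1 T); apply: pserP => -[|r]; rewrite X /= ?ev0.
  case: (ltnP j n) => /= nj; first by rewrite ev2x // !rmorphM.
  by rewrite -rmorphM; apply: (congr1 T); apply: pserP => r; rewrite cstE /= evX.
- move=> i j f; rewrite !ltnS /ev2' /w' => Hi Hj ij; case: (ltnP i n) => /= ni; last first.
    have nj : (j < n)%N by move: ij; rewrite (anti_leq (introT andP (conj Hi ni))) ltn_neqAle eq_sym Hj => ->.
    by rewrite nj -rmorphM; apply: (congr1 T); apply: pserP => r; rewrite cstE /= evX.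
  case: (ltnP j n) => /= nj; first by rewrite ev2y // !rmorphM.
  by rewrite -rmorphM; apply: (congr1 T); apply: pserP => -[|r]; rewrite X /= ?ev0.
- move=> i j f; rewrite !ltnS /ev2' => Hi Hj ij; case: (ltnP i n) => /= ni; last first.
    have nj : (j < n)%N by move: ij; rewrite (anti_leq (introT andP (conj Hi ni))) ltn_neqAle eq_sym Hj => ->.
    move=> /T0 H r s; apply: (ev_inj j (fun s => f r s)) => //.
    by have := congr1 (fun u => pcoef u r) H; rewrite pcoef0.
  case: (ltnP j n) => /= nj; first by move=> /T0/c0; apply: ev2_inj.
  move=> /T0 H r s; apply: (ev_inj i (fun r => f r s)) => //.
  by have := congr1 (fun u => pcoef u s) H; rewrite pcoef0.
- move=> i j f g; rewrite !ltnS /ev2' /ev' => Hi Hj ij; case: (ltnP i n) => /= ni; last first.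
    have nj : (j < n)%N by move: ij; rewrite (anti_leq (introT andP (conj Hi ni))) ltn_neqAle eq_sym Hj => ->.
    rewrite nj -rmorphM mulrC; apply: (congr1 T); apply: pserP => r; rewrite cstE /= evZ //.
    exact: mulrC.
  case: (ltnP j n) => /= nj; first by rewrite ev2M // !rmorphM.
  rewrite -rmorphM; apply: (congr1 T); apply: pserP => r; rewrite cstE /= mulrC -evZ //.
  by congr ev; apply/funext => s; rewrite mulrC.
move=> phi; set M := \matrix_(i, j) _.
pose N : 'M[F]_n.+1 := \matrix_(i, j) (if (i < n)%N then ev i (phi j) else 0).
rewrite (expand_det_row _ ord_max) => dM.
have cof j : cofactor M ord_max j = T (cst (cofactor N ord_max j)).
  rewrite /cofactor !rmorphM !rmorphXn !rmorphN !rmorph1; congr (_ * _).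
  rewrite -!det_map_mx; congr (\det _); apply/matrixP => i k; rewrite !mxE /ev'.
  by rewrite lift_max ltn_ord.
have Hs r : \sum_j cofactor N ord_max j * io (phi j r) = 0.
  have : \sum_j (cst (cofactor N ord_max j) * Pser (fun r => io (phi j r)) : L) = 0.
    apply: T0; rewrite rmorph_sum -[RHS]dM; apply: eq_bigr => j _.
    by rewrite rmorphM cof mulrC; congr (_ * _); rewrite mxE /ev' ltnn.
  move=> /(congr1 (fun u => pcoef u r)); rewrite pcoef0 => E; rewrite -[RHS]E.
  rewrite (big_morph (fun u : L => pcoef u r) (id1 := 0) (op1 := +%R)) //; last by move=> x y; apply: pcoefD.
  by apply: eq_bigr => j _; rewrite cstE.
have [m0|m0] := eqVneq (\row_j cofactor N ord_max j) 0; last first.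
  apply: (dependent_descent (io := io) (phi := fun j r => phi j r) m0) => r.
  by rewrite -[RHS](Hs r); apply: eq_bigr => j _; rewrite mxE.
have [c cn0 Hc] : exists2 c : 'rV[C]_n, c != 0 & forall r, \sum_j c 0 j * phi j r = 0.
  apply: dt; have /matrixP/(_ 0 ord_max) := m0; rewrite !mxE /cofactor => /eqP.
  rewrite mulf_eq0 signr_eq0 /= => /eqP E; rewrite -[RHS]E; congr (\det _).
  by apply/matrixP => i j; rewrite !mxE !lift_max ltn_ord.
exists (\row_j if unlift ord_max j is Some k then c 0 k else 0).
  apply: contraNneq cn0 => /matrixP H; apply/eqP/matrixP => i j.
  by have := H 0 (lift ord_max j); rewrite !mxE liftK (ord1 i).
move=> r; rewrite big_ord_recr /= mxE unlift_none mul0r addr0 -[RHS](Hc r).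
apply: eq_bigr => j _; rewrite mxE.
have -> : widen_ord (leqnSn n) j = lift ord_max j by apply: val_inj; rewrite /= /bump leqNgt ltn_ord.
by rewrite liftK.
Qed.

Ltac fieldh := field; repeat (apply/andP; split); try assumption.

Section Structure.
Variables (F : fieldType) (q : F).
Local Notation h := (q^-1 - q).
Definition gam (z : F) := (q - q^-1 * z ^+ 2) / (1 - z ^+ 2).
(* f(n; x) is the factor picked up by an operator with spectral parameter n moving past B(x). *)
Definition fwd (n x : F) := q ^+ 2 - h * n * (gam x / (x - n) + gam x^-1 / (x^-1 - n)).

Section Solve.
Variables (V : lmodType F) (x y : F).
Hypotheses (q0 : q != 0) (x0 : x != 0) (y0 : y != 0) (x2 : 1 - x ^+ 2 != 0) (y2 : 1 - y ^+ 2 != 0).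
Hypotheses (qx : q - q^-1 * x ^+ 2 != 0) (qy : q - q^-1 * y ^+ 2 != 0).
Hypotheses (yx : y - x != 0) (xy : x * y - 1 != 0) (qxy : q^-1 * (x * y) - q != 0).

Let x2' : x ^+ 2 - 1 != 0. Proof. by rewrite -oppr_eq0 opprB. Qed.
Let y2' : y ^+ 2 - 1 != 0. Proof. by rewrite -oppr_eq0 opprB. Qed.
Let yx' : x - y != 0. Proof. by rewrite -oppr_eq0 opprB. Qed.
Let yx1 : y * x - 1 != 0. Proof. by rewrite mulrC. Qed.
Let yx2 : 1 + - y * x != 0. Proof. by rewrite -oppr_eq0 opprD mulNr opprK addrC. Qed.
Let xy2 : 1 + - x * y != 0. Proof. by rewrite -oppr_eq0 opprD mulNr opprK addrC. Qed.

(* g1 = B(x)A(y), g2 = B(x)D(y), g3 = B(y)A(x), g4 = B(y)D(x), v = B(y)E(x), v' = B(x)E(y). *)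
Lemma solve_A (u v g1 g3 g4 : V) :
  (1 - x ^+ 2) *: v = - (q - q^-1 * x ^+ 2) *: g4 - (h * x ^+ 2) *: g3 ->
  ((q^-1 * y - q * x) * (q^-1 * (x * y) - q)) *: g1 =
    ((y - x) * (x * y - 1)) *: u + ((y - x) * h) *: v + (h * x * (q^-1 * (x * y) - q)) *: g3 ->
  u = fwd y x *: g1 - (h * gam x) *: ((x / (y - x)) *: g3 - (x^-1 / (y - x^-1)) *: g4).
Proof.
move=> Hv E.
have k0 : (y - x) * (x * y - 1) != 0 by rewrite mulf_neq0.
have vE : v = (- (q - q^-1 * x ^+ 2) / (1 - x ^+ 2)) *: g4 - (h * x ^+ 2 / (1 - x ^+ 2)) *: g3.
  apply: (scalerI x2); rewrite Hv scalerBr !scalerA; congr (_ *: _ - _ *: _); fieldh.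
have uE : u = (((y - x) * (x * y - 1))^-1 * ((q^-1 * y - q * x) * (q^-1 * (x * y) - q))) *: g1
  + (- ((y - x) * (x * y - 1))^-1 * (- (y - x) * h * (h * x ^+ 2 / (1 - x ^+ 2)) + h * x * (q^-1 * (x * y) - q))) *: g3
  + (- ((y - x) * (x * y - 1))^-1 * ((y - x) * h * (- (q - q^-1 * x ^+ 2) / (1 - x ^+ 2)))) *: g4.
  apply: (scalerI k0).
  have {E} -> : ((y - x) * (x * y - 1)) *: u = ((q^-1 * y - q * x) * (q^-1 * (x * y) - q)) *: g1 -
     ((y - x) * h) *: v - (h * x * (q^-1 * (x * y) - q)) *: g3 by rewrite E; linring.
  rewrite vE !scalerDr !scalerA !mulrA !mulrN !mulNr mulfV // !mul1r.
  linring.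
rewrite uE; transitivity (fwd y x *: g1 + (- (h * gam x) * (x / (y - x))) *: g3
  + (h * gam x * (x^-1 / (y - x^-1))) *: g4); last by linring.
congr (_ *: _ + _ *: _ + _ *: _); rewrite /fwd /gam; fieldh.
Qed.
End Solve.

Section SolveD.
Variables (V : lmodType F) (x y : F).
Hypotheses (q0 : q != 0) (x0 : x != 0) (y0 : y != 0) (x2 : 1 - x ^+ 2 != 0) (y2 : 1 - y ^+ 2 != 0).
Hypotheses (qx : q - q^-1 * x ^+ 2 != 0) (qy : q - q^-1 * y ^+ 2 != 0).
Hypotheses (yx : y - x != 0) (xy : x * y - 1 != 0) (qxy : q^-1 * (x * y) - q != 0).
Let x2' : x ^+ 2 - 1 != 0. Proof. by rewrite -oppr_eq0 opprB. Qed.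
Let y2' : y ^+ 2 - 1 != 0. Proof. by rewrite -oppr_eq0 opprB. Qed.
Let yx' : x - y != 0. Proof. by rewrite -oppr_eq0 opprB. Qed.
Let yx1 : y * x - 1 != 0. Proof. by rewrite mulrC. Qed.
Let yx2 : 1 + - y * x != 0. Proof. by rewrite -oppr_eq0 opprD mulNr opprK addrC. Qed.
Let xy2 : 1 + - x * y != 0. Proof. by rewrite -oppr_eq0 opprD mulNr opprK addrC. Qed.

Let yx3 : y + -1 * x != 0. Proof. by rewrite mulN1r. Qed.
Let yx4 : x + -1 * y != 0. Proof. by rewrite mulN1r. Qed.
Let qxy' : x * y + - q * q != 0.
Proof. by have := mulf_neq0 q0 qxy; rewrite mulNr mulrBr mulrA mulfV // mul1r. Qed.
Let qy' : q * q - y ^+ 2 != 0.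
Proof. by have := mulf_neq0 q0 qy; rewrite mulrBr mulrA mulfV // mul1r. Qed.

(* u = A(y)B(x), u' = A(x)B(y), e = E(y)B(x), g = D(y)B(x). *)
Lemma solve_D (u u' e g v v' g1 g2 g3 g4 : V) :
  (1 - x ^+ 2) *: v = - (q - q^-1 * x ^+ 2) *: g4 - (h * x ^+ 2) *: g3 ->
  (1 - y ^+ 2) *: v' = - (q - q^-1 * y ^+ 2) *: g2 - (h * y ^+ 2) *: g1 ->
  (1 - y ^+ 2) *: e = - (q - q^-1 * y ^+ 2) *: g - (h * y ^+ 2) *: u ->
  u = fwd y x *: g1 - (h * gam x) *: ((x / (y - x)) *: g3 - (x^-1 / (y - x^-1)) *: g4) ->
  u' = fwd x y *: g3 - (h * gam y) *: ((y / (x - y)) *: g1 - (y^-1 / (x - y^-1)) *: g2) ->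
  ((x - y) * (q^-1 * (x * y) - q)) *: e + (h * y * (x * y - 1)) *: v + (h * y * (h * (x * y))) *: u =
    ((q^-1 * x - q * y) * (x * y - 1)) *: v' + ((q^-1 * x - q * y) * (h * (x * y))) *: u' ->
  g = fwd y^-1 x *: g2 + (h * gam x * (gam y^-1 / gam y)) *: ((x / (y^-1 - x)) *: g3 - (x^-1 / (y^-1 - x^-1)) *: g4).
Proof.
move=> Hv Hv' He Hu Hu' E.
have vE : v = (- (q - q^-1 * x ^+ 2) / (1 - x ^+ 2)) *: g4 - (h * x ^+ 2 / (1 - x ^+ 2)) *: g3.
  by apply: (scalerI x2); rewrite Hv scalerBr !scalerA; congr (_ *: _ - _ *: _); fieldh.
have vE' : v' = (- (q - q^-1 * y ^+ 2) / (1 - y ^+ 2)) *: g2 - (h * y ^+ 2 / (1 - y ^+ 2)) *: g1.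
  by apply: (scalerI y2); rewrite Hv' scalerBr !scalerA; congr (_ *: _ - _ *: _); fieldh.
have k0 : (x - y) * (q^-1 * (x * y) - q) != 0 by rewrite mulf_neq0.
pose K := (x - y) * (q^-1 * (x * y) - q).
have eE : e = K^-1 *: (((q^-1 * x - q * y) * (x * y - 1)) *: v' + ((q^-1 * x - q * y) * (h * (x * y))) *: u'
   - (h * y * (x * y - 1)) *: v - (h * y * (h * (x * y))) *: u).
  by apply: (scalerI k0); rewrite scalerA mulfV // scale1r -E; linring.
have gE : g = (q - q^-1 * y ^+ 2)^-1 *: (- (1 - y ^+ 2) *: e - (h * y ^+ 2) *: u).
  by apply: (scalerI qy); rewrite scalerA mulfV // scale1r scaleNr He; linring.
rewrite gE eE vE vE' Hu Hu'.
transitivity (fwd y^-1 x *: g2 + 0 *: g1 + (h * gam x * (gam y^-1 / gam y) * (x / (y^-1 - x))) *: g3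
   + (- (h * gam x * (gam y^-1 / gam y) * (x^-1 / (y^-1 - x^-1)))) *: g4); last by linring.
transitivity (
 ((q - q^-1 * y ^+ 2)^-1 * (- (1 - y ^+ 2) * K^-1 * ((q^-1 * x - q * y) * (x * y - 1) * (- (q - q^-1 * y ^+ 2) / (1 - y ^+ 2))
    + (q^-1 * x - q * y) * (h * (x * y)) * (h * gam y * (y^-1 / (x - y^-1)))))) *: g2
 + ((q - q^-1 * y ^+ 2)^-1 * (- (1 - y ^+ 2) * K^-1 * ((q^-1 * x - q * y) * (x * y - 1) * (- (h * y ^+ 2 / (1 - y ^+ 2)))
    - (q^-1 * x - q * y) * (h * (x * y)) * (h * gam y * (y / (x - y))) - h * y * (h * (x * y)) * fwd y x)
      - (h * y ^+ 2) * fwd y x)) *: g1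
 + ((q - q^-1 * y ^+ 2)^-1 * (- (1 - y ^+ 2) * K^-1 * ((q^-1 * x - q * y) * (h * (x * y)) * fwd x y
      + h * y * (x * y - 1) * (h * x ^+ 2 / (1 - x ^+ 2)) + h * y * (h * (x * y)) * (h * gam x * (x / (y - x))))
      + (h * y ^+ 2) * (h * gam x * (x / (y - x))))) *: g3
 + ((q - q^-1 * y ^+ 2)^-1 * (- (1 - y ^+ 2) * K^-1 * (h * y * (x * y - 1) * ((q - q^-1 * x ^+ 2) / (1 - x ^+ 2))
      - h * y * (h * (x * y)) * (h * gam x * (x^-1 / (y - x^-1))))
      - (h * y ^+ 2) * (h * gam x * (x^-1 / (y - x^-1))))) *: g4).
  linring.
congr (_ *: _ + _ *: _ + _ *: _ + _ *: _); rewrite /K /fwd /gam; fieldh.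
Qed.
End SolveD.

Definition fac1 (y y' : F) := (q^-1 * y - q * y') / (y - y').
Definition fac2 (y y' : F) := (q - q^-1 * (y * y')) / (1 - y * y').

Lemma fwd_fac n x : q != 0 -> x != 0 -> n - x != 0 -> 1 - n * x != 0 -> 1 - x ^+ 2 != 0 ->
  fwd n x = fac1 n x * fac2 n x.
Proof.
move=> q0 x0 nx n1 x2.
have H1 : x - n != 0 by rewrite -oppr_eq0 opprB.
have H2 : n * x - 1 != 0 by rewrite -oppr_eq0 opprB.
have H3 : x ^+ 2 - 1 != 0 by rewrite -oppr_eq0 opprB.
have H4 : 1 + - n * x != 0 by rewrite mulNr.
have H5 : x * n - 1 != 0 by rewrite mulrC.
rewrite /fwd /gam /fac1 /fac2; fieldh.
Qed.

Lemma fwdV n x : fwd n x^-1 = fwd n x.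
Proof. by rewrite /fwd invrK [X in _ - _ * X]addrC. Qed.

Lemma fac2C y y' : fac2 y y' = fac2 y' y.
Proof. by rewrite /fac2 (mulrC y y'). Qed.

Lemma fac2_diff y y' : q != 0 -> y != 0 -> y' != 0 -> 1 - y * y' != 0 ->
  (q^-1 * y' + q / y') - (q^-1 * y + q / y) = fac2 y y' * ((y' + y'^-1) - (y + y^-1)).
Proof. move=> q0 y0 y1 yy; rewrite /fac2; fieldh. Qed.

Lemma fac1_sum (l : seq F) : q != 0 -> q - q^-1 != 0 -> uniq l -> all (fun y => y != 0) l ->
  \sum_(y <- l) \prod_(z <- rem y l) fac1 y z = (q ^+ size l - q ^- size l) / (q - q^-1).
Proof.
move=> q0 qq ul al0; set m := size l.
pose G y := \prod_(z <- rem y l) fac1 y z.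
pose Pl (s : seq F) : {poly F} := \prod_(z <- s) ('X - z%:P).
pose p : {poly F} := \prod_(z <- l) (q^-1 *: 'X - (q * z)%:P) - (q ^- m) *: Pl l
   - \sum_(y <- l) (((q^-1 - q) * y * G y) *: Pl (rem y l)).
have Pls s : size (Pl s) = (size s).+1 by rewrite size_prod_XsubC.
have Plm s : (Pl s)`_(size s) = 1.
  by have /monicP := monic_prod_XsubC s predT id; rewrite lead_coefE size_prod_XsubC.
have prodZ (c : F) (s : seq F) (f : F -> F) : \prod_(z <- s) (c * f z) = c ^+ size s * \prod_(z <- s) f z.
  by elim: s => [|z s IH]; rewrite ?big_nil ?mulr1 ?expr0 // !big_cons IH exprS mulrACA.
have pE1 : \prod_(z <- l) (q^-1 *: 'X - (q * z)%:P) = q ^- m *: Pl [seq q ^+ 2 * z | z <- l].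
  rewrite /m /Pl; elim: (l) => [|z s IH]; first by rewrite !big_nil invr1 scale1r.
  rewrite /= !big_cons.
  have -> : q^-1 *: 'X - (q * z)%:P = q^-1 *: ('X - (q ^+ 2 * z)%:P).
    by rewrite scalerBr -!mul_polyC -polyCM expr2 !mulrA mulVf // mul1r.
  by rewrite IH (exprS q (size s)) invfM -scalerAl -scalerAr scalerA.
have sz : (size p <= m)%N.
  apply/leq_sizeP => j; rewrite leq_eqVlt => mj.
  have big s k : (size s < k)%N -> (Pl s)`_k = 0 by move=> sk; rewrite nth_default // Pls.
  rewrite !coefB pE1 !coefZ coef_sum big1_seq => [|y /andP[_ yl]]; last first.
    rewrite coefZ big ?mulr0 // size_rem //.
    by case/orP: mj => [/eqP <-|/(leq_trans _)]; [|apply]; rewrite ?prednK ?leq_pred //; case: (l) yl.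
  case/orP: mj => [/eqP <-|mj]; last by rewrite !big ?mulr0 ?subrr // size_map.
  have E1 : (Pl [seq q ^+ 2 * z | z <- l])`_m = 1 by rewrite -[RHS](Plm [seq q ^+ 2 * z | z <- l]) size_map.
  by rewrite E1 (Plm l) !mulr1 subrr subr0.
have rt : all (root p) l.
  apply/allP => y yl; have y0 := allP al0 y yl.
  rewrite rootE !hornerE horner_prod horner_sum (_ : (Pl l).[y] = 0); last first.
    by rewrite /Pl (big_rem y) //= !hornerE subrr mul0r.
  rewrite mulr0 subr0 (big_rem y) //= [X in _ - X](bigD1_seq y) //= [X in _ - (_ + X)]big1_seq => [|z /andP[zy zl]]; last first.
    have yz : y \in rem z l by rewrite mem_rem_uniq // inE yl andbT eq_sym.
    by rewrite hornerZ /Pl (big_rem y yz) /= hornerM hornerXsubC subrr mul0r mulr0.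
  rewrite hornerZ /Pl horner_prod addr0 /G -(mulrA (h * y)).
  rewrite [X in _ - _ * X](_ : _ = \prod_(z <- rem y l) (fac1 y z * ('X - z%:P).[y])); last by rewrite [RHS]big_split.
  rewrite !hornerE.
  rewrite (eq_big_seq (fun z => q^-1 * y - q * z)) => [|z]; last first.
    by rewrite !hornerE.
  rewrite [X in _ - _ * X](eq_big_seq (fun z => q^-1 * y - q * z)) => [|z]; last first.
    rewrite mem_rem_uniq // inE => /andP[zy _]; rewrite hornerXsubC /fac1 divfK //.
    by rewrite subr_eq0 eq_sym.
  by apply/eqP; ring.
have p0 : p = 0 by apply: roots_geq_poly_eq0 rt ul sz.
pose Pi := \prod_(z <- l) (- z).
have Pi0 : Pi != 0.
  by rewrite prodf_seq_neq0; apply/allP => z zl /=; rewrite oppr_eq0 (allP al0).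
have Pl0 s : (Pl s).[0] = \prod_(z <- s) (- z).
  by rewrite horner_prod; apply: eq_bigr => z _; rewrite hornerXsubC sub0r.
have := congr1 (fun p => p.[0]) p0.
rewrite horner0 !hornerD !hornerN hornerZ horner_sum horner_prod Pl0.
rewrite (eq_bigr (fun z => q * - z)) => [|z _]; last first.
  by rewrite hornerD hornerN hornerZ hornerX hornerC mulr0 sub0r mulrN.
rewrite prodZ -/m -/Pi (eq_big_seq (fun y => (- h * Pi) * G y)) => [|y yl]; last first.
  have PiE : Pi = - y * \prod_(z <- rem y l) - z by rewrite /Pi (big_rem y).
  by rewrite hornerZ Pl0 PiE; ring.
rewrite -mulr_sumr => E; apply: (mulIf qq); rewrite divfK //; apply: (mulIf Pi0).
apply/eqP; rewrite -subr_eq0 -oppr_eq0 -[X in _ == X]E /G; apply/eqP.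
by move: (\sum_(y <- l) _) => s1; ring.
Qed.
End Structure.

Section Words.
Variables (F : fieldType) (q : F) (n : nat) (w : 'I_n -> F).
Local Notation h := (q^-1 - q).
Local Notation gam := (gam q).
Local Notation fwd := (fwd q).
Variables (N : nat) (opA opB opD opE : 'I_n -> 'M[F]_N) (opC E0 : 'M[F]_N) (xi : 'cV[F]_N).
Variables (a d : 'I_n -> F) (lam0 : F).
Hypotheses (q0 : q != 0) (w0 : forall i, w i != 0) (w2 : forall i, 1 - w i ^+ 2 != 0)
  (qw : forall i, q - q^-1 * w i ^+ 2 != 0).
Hypotheses (wd : forall i j, i != j -> w i - w j != 0) (ww : forall i j, i != j -> 1 - w i * w j != 0).

Definition nd (b : bool) (i : 'I_n) : F := if b then w i else (w i)^-1.
Definition sg (b : bool) : F := if b then 1 else -1.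
Definition op (b : bool) (i : 'I_n) := if b then opA i else opD i.
Definition al (b : bool) i := if b then a i else d i.
Definition kp (b : bool) i := if b then 1 else - (gam (w i)^-1 / gam (w i)).

Hypothesis opB_comm : forall i j, i != j -> opB i *m opB j = opB j *m opB i.
Hypothesis op_opB : forall b i j, i != j -> op b j *m opB i =
  fwd (nd b j) (w i) *: (opB i *m op b j)
  - (h * gam (w i) * kp b j) *: \sum_(b' : bool) (sg b' * nd b' i / (nd b j - nd b' i)) *: (opB j *m op b' i).
Hypothesis opC_opB : forall i, opC *m opB i = opB i *m opC + h *: (E0 *m opE i) + (h * q) *: (opA i *m E0).
Hypothesis E0_opB : forall i, E0 *m opB i = (q^-1 * q^-1) *: (opB i *m E0).
Hypothesis opE_AD : forall i, (1 - w i ^+ 2) *: opE i =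
  - (q - q^-1 * w i ^+ 2) *: opD i - (h * w i ^+ 2) *: opA i.
Hypotheses (xiA : forall b i, op b i *m xi = al b i *: xi) (xiC : opC *m xi = 0) (xiE0 : E0 *m xi = lam0 *: xi).

Lemma gam_neq0 i : gam (w i) != 0.
Proof. by rewrite mulf_neq0 ?invr_eq0. Qed.

Lemma sgkp b i : sg b * kp b i * gam (w i) = gam (nd b i).
Proof. by case: b; rewrite /sg /kp /nd ?mul1r // mulN1r opprK divfK ?gam_neq0. Qed.

Fixpoint wrd (l : seq 'I_n) : 'cV[F]_N := if l is i :: l then opB i *m wrd l else xi.

Lemma wrd_rem i l : uniq l -> i \in l -> wrd l = opB i *m wrd (rem i l).
Proof.
elim: l => //= j l IH /andP[jl ul]; rewrite inE.
have [<-|ij] := eqVneq j i; first by [].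
move=> /= il; rewrite IH // mulmxA (opB_comm ij) -mulmxA //.
Qed.

Lemma nd_sub b b' i j : i != j -> nd b j - nd b' i != 0.
Proof.
have inv (x y : F) : x != 0 -> y != 0 -> x^-1 - y^-1 = (y - x) / (x * y) by move=> x0 y0; field; rewrite x0 y0.
have inv1 (x y : F) : x != 0 -> x^-1 - y = (1 - x * y) / x by move=> x0; field.
have inv2 (x y : F) : y != 0 -> x - y^-1 = (x * y - 1) / y by move=> y0; field.
move=> ij; case: b; case: b'; rewrite /nd.
- by rewrite wd // eq_sym.
- by rewrite inv2 // mulf_neq0 ?invr_eq0 // -oppr_eq0 opprB ww // eq_sym.
- by rewrite inv1 // mulf_neq0 ?invr_eq0 // ww // eq_sym.
- by rewrite inv // !mulf_neq0 ?invr_eq0 ?mulf_neq0 // wd.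
Qed.

Definition fprod b i (l : seq 'I_n) := \prod_(k <- l) fwd (nd b i) (w k).

Lemma fwd_sub (m m' x : F) : m - x != 0 -> m - x^-1 != 0 -> m' - x != 0 -> m' - x^-1 != 0 -> m - m' != 0 ->
  fwd m x / (m - m') - h * (gam x * x / ((m - x) * (x - m')) + gam x^-1 * x^-1 / ((m - x^-1) * (x^-1 - m')))
  = fwd m' x / (m - m').
Proof.
move=> H1 H2 H3 H4 H5; rewrite /fwd; move: (gam x) (gam x^-1) => g1 g2.
have H1' : x - m != 0 by rewrite -oppr_eq0 opprB.
have H2' : x^-1 - m != 0 by rewrite -oppr_eq0 opprB.
have H3' : x - m' != 0 by rewrite -oppr_eq0 opprB.
have H4' : x^-1 - m' != 0 by rewrite -oppr_eq0 opprB.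
move: x^-1 H1 H2 H3 H4 H1' H2' H3' H4' => y *; fieldh.
Qed.

Definition cfo b j i b' (r : seq 'I_n) :=
  h * kp b j * gam (w i) * sg b' * nd b' i * al b' i / (nd b j - nd b' i) * fprod b' i r.

Lemma sum_bool (V : zmodType) (f : bool -> V) : \sum_(b : bool) f b = f true + f false.
Proof. by rewrite big_bool. Qed.

Lemma cfo_rec b j x i b' r : x != j -> i != j -> i != x ->
  fwd (nd b j) (w x) * cfo b j i b' r
    - \sum_(b1 : bool) (h * gam (w x) * kp b j) * (sg b1 * nd b1 x / (nd b j - nd b1 x)) * cfo b1 x i b' r
  = cfo b j i b' (x :: r).
Proof.
move=> xj ij ix.
have H1 := nd_sub b true xj; have H2 := nd_sub b false xj.
have H3 := nd_sub true b' ix; have H4 := nd_sub false b' ix; have H5 := nd_sub b b' ij.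
have E := @fwd_sub (nd b j) (nd b' i) (w x) H1 H2.
have H3' : nd b' i - w x != 0 by rewrite -oppr_eq0 opprB.
have H4' : nd b' i - (w x)^-1 != 0 by rewrite -oppr_eq0 opprB.
have {}E := E H3' H4' H5.
rewrite /cfo /fprod big_cons -/(fprod b' i r); set P := fprod b' i r.
transitivity (h * kp b j * gam (w i) * sg b' * nd b' i * al b' i * P * (fwd (nd b' i) (w x) / (nd b j - nd b' i))); last by ring.
rewrite -E sum_bool /cfo -/(fprod b' i r) -/P -[gam (w x)^-1]/(gam (nd false x)) -sgkp.
rewrite -[w x]/(nd true x) -[(w x)^-1]/(nd false x).
have -> : sg true = 1 by [].
have -> : kp true x = 1 by [].
have -> : sg false = -1 by [].
fieldh.
Qed.

Lemma op_wrd b j l : uniq l -> j \notin l -> op b j *m wrd l = (al b j * fprod b j l) *: wrd l -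
  \sum_(i <- l) \sum_(b' : bool) cfo b j i b' (rem i l) *: (opB j *m wrd (rem i l)).
Proof.
elim: l b j => [|x l IH] b j.
  by rewrite big_nil subr0 /fprod big_nil mulr1 /= xiA.
rewrite /= inE negb_or => /andP[xl ul] /andP[jx jl].
have xj : x != j by rewrite eq_sym.
rewrite mulmxA op_opB // mulmxBl -!scalemxAl -mulmxA IH // mulmx_suml.
under [X in _ - _ *: X]eq_bigr => b1 _ do rewrite -scalemxAl -mulmxA IH // mulmxBr -scalemxAr scalerBr scalerA.
rewrite sumrB mulmxBr !scalerBr -scalemxAr scalerA.
set S2 := (X in _ - (_ - X)); set T2 := (X in _ - (X - _)); set S1 := (X in _ - X - _).
have T2E : T2 = \sum_b' cfo b j x b' l *: (opB j *m wrd l).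
  rewrite /T2 scaler_sumr; apply: eq_bigr => b1 _; rewrite scalerA; congr (_ *: _).
  by rewrite /cfo; ring.
have cm v : opB x *m (opB j *m v) = opB j *m (opB x *m v) by rewrite !mulmxA opB_comm.
have SE : S1 - S2 = \sum_(i <- l) \sum_b' cfo b j i b' (x :: rem i l) *: (opB j *m (opB x *m wrd (rem i l))).
  rewrite /S1 /S2 mulmx_sumr !scaler_sumr.
  under [X in _ - X]eq_bigr => b1 _ do rewrite mulmx_sumr !scaler_sumr.
  rewrite [X in _ - X]exchange_big -sumrB; apply: eq_big_seq => i il /=.
  have ij : i != j by apply: contraNneq jl => <-.
  have ix : i != x by apply: contraNneq xl => <-.
  rewrite mulmx_sumr scaler_sumr.
  under [X in _ - X]eq_bigr => b1 _ do rewrite mulmx_sumr !scaler_sumr.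
  rewrite [X in _ - X]exchange_big -sumrB; apply: eq_bigr => b' _ /=.
  rewrite -(cfo_rec b b' (rem i l) xj ij ix) [RHS]scalerBl scaler_suml -scalemxAr scalerA cm.
  congr (_ - _); apply: eq_bigr => b1 _.
  by rewrite -scalemxAr !scalerA.
rewrite big_cons eqxx T2E.
have -> : \sum_(i <- l) \sum_b' cfo b j i b' (if x == i then l else x :: rem i l) *:
     (opB j *m wrd (if x == i then l else x :: rem i l)) = S1 - S2.
  rewrite SE; apply: eq_big_seq => i il; rewrite (negPf (_ : x != i)) //.
  by apply: contraNneq xl => ->.
have -> : fprod b j (x :: l) = fwd (nd b j) (w x) * fprod b j l by rewrite /fprod big_cons.
rewrite mulrCA mulrA; move: S1 S2 (\sum_b' _) {T2 T2E SE} => S1 S2 T; linring.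
Qed.

Lemma E0_wrd l : E0 *m wrd l = (lam0 * (q^-1 * q^-1) ^+ size l) *: wrd l.
Proof.
elim: l => [|i l IH] /=; first by rewrite expr0 mulr1.
by rewrite mulmxA E0_opB -scalemxAl -mulmxA IH -scalemxAr scalerA exprS mulrCA.
Qed.

Lemma E0_op_wrd b j l : uniq l -> j \notin l ->
  E0 *m (op b j *m wrd l) = (lam0 * (q^-1 * q^-1) ^+ size l) *: (op b j *m wrd l).
Proof.
move=> ul jl; have E0l := E0_wrd l; have E0r := fun i => E0_wrd (j :: rem i l).
have {E0r} E0r i : i \in l -> E0 *m (opB j *m wrd (rem i l)) = (lam0 * (q^-1 * q^-1) ^+ size l) *: (opB j *m wrd (rem i l)).
  by move=> il; have := E0r i; rewrite /= size_rem // prednK //; case: (l) il.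
move: (lam0 * _) E0l E0r => c E0l E0r.
rewrite op_wrd // mulmxBr -scalemxAr E0l [RHS]scalerBr !(scalerA _ _ (wrd l)) (mulrC c); congr (_ - _).
rewrite mulmx_sumr [RHS]scaler_sumr; apply: eq_big_seq => i il.
rewrite mulmx_sumr [RHS]scaler_sumr; apply: eq_bigr => b' _.
by rewrite -scalemxAr E0r // [LHS]scalerA [RHS]scalerA [in LHS]mulrC.
Qed.

Definition cfe (k : nat) i b (r : seq 'I_n) :=
  h * (lam0 * (q^-1 * q^-1) ^+ k) * gam (w i) * (sg b * al b i) * fprod b i r.

Lemma opEqA i (v : 'cV[F]_N) : opE i *m v + q *: (opA i *m v) = gam (w i) *: \sum_b sg b *: (op b i *m v).
Proof.
have E : (1 - w i ^+ 2) *: (opE i *m v) =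
    - (q - q^-1 * w i ^+ 2) *: (opD i *m v) - (h * w i ^+ 2) *: (opA i *m v).
  by rewrite scalemxAl opE_AD mulmxBl -!scalemxAl.
have G : (1 - w i ^+ 2) * gam (w i) = q - q^-1 * w i ^+ 2 by rewrite mulrC divfK.
apply: (scalerI (w2 i)); rewrite scalerDr E !scalerA G sum_bool /= scale1r scaleN1r.
by rewrite /op; move: (opA i *m v) (opD i *m v) => u1 u2; linring.
Qed.

Lemma opC_wrd l : uniq l -> opC *m wrd l =
  \sum_(i <- l) \sum_b cfe (size l).-1 i b (rem i l) *: wrd (rem i l).
Proof.
elim: l => [|x l IH] /=; first by rewrite big_nil xiC.
move=> /andP[xl ul]; rewrite mulmxA opC_opB !mulmxDl -!scalemxAl -!mulmxA IH // E0_wrd.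
have -> : opB x *m (\sum_(i <- l) \sum_b cfe (size l).-1 i b (rem i l) *: wrd (rem i l)) +
    h *: (E0 *m (opE x *m wrd l)) + (h * q) *: (opA x *m ((lam0 * (q^-1 * q^-1) ^+ size l) *: wrd l)) =
   opB x *m (\sum_(i <- l) \sum_b cfe (size l).-1 i b (rem i l) *: wrd (rem i l)) +
   (h * (lam0 * (q^-1 * q^-1) ^+ size l) * gam (w x)) *: \sum_b sg b *: (op b x *m wrd l).
  rewrite -addrA; congr (_ + _).
  have EA : opE x *m wrd l = gam (w x) *: (\sum_b sg b *: (op b x *m wrd l)) - q *: (op true x *m wrd l).
    by rewrite -opEqA addrK.
  have -> : E0 *m (opE x *m wrd l) = (lam0 * (q^-1 * q^-1) ^+ size l) *: (opE x *m wrd l).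
    by rewrite EA sum_bool mulmxBr -!scalemxAr mulmxDr -!scalemxAr !E0_op_wrd //; linring.
  by rewrite -scalemxAr -scalerA -[RHS]scalerA -opEqA; linring.
under [X in _ + _ *: X]eq_bigr => b _ do rewrite op_wrd // scalerBr scalerA.
rewrite sumrB scalerBr.
rewrite big_cons eqxx; set T := (X in _ + (X - _)); set S2 := (X in _ + (_ - X)); set S1 := (X in X + _).
have TE : T = \sum_b cfe (size l) x b l *: wrd l.
  by rewrite /T scaler_sumr; apply: eq_bigr => b _; rewrite scalerA; congr (_ *: _); rewrite /cfe; ring.
rewrite -TE addrCA; congr (_ + _).
rewrite /S1 mulmx_sumr /S2.
under [X in _ - _ *: X]eq_bigr => b _ do rewrite scaler_sumr.
rewrite exchange_big scaler_sumr -sumrB; apply: eq_big_seq => i il /=.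
have ix : i != x by apply: contraNneq xl => <-.
rewrite eq_sym (negPf ix) mulmx_sumr.
under [X in _ - _ *: X]eq_bigr => b _ do rewrite scaler_sumr.
rewrite exchange_big scaler_sumr -sumrB; apply: eq_bigr => b' _ /=.
rewrite -scalemxAr; under [X in _ - _ *: X]eq_bigr => b _ do rewrite scalerA.
rewrite -scaler_suml scalerA -scalerBl; congr (_ *: _).
have {IH T S2 TE S1} : (0 < size l)%N by case: (l) il.
case: (size l) => [//|k] _ /=; rewrite /cfe /fprod big_cons -/(fprod b' i (rem i l)).
move: (rem i l) => r; rewrite sum_bool /cfo.
have [H1 H2] : nd true x - nd b' i != 0 /\ nd false x - nd b' i != 0 by split; apply: nd_sub.
have E : fwd (nd b' i) (w x) = q ^+ 2 - h * nd b' i * (sg true * kp true x * gam (w x) / (nd true x - nd b' i)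
    + sg false * kp false x * gam (w x) / (nd false x - nd b' i)) by rewrite !sgkp.
rewrite E exprS.
move: (gam (w x)) (gam (w i)) (sg b') (nd true x) (nd false x) (nd b' i) H1 H2 (_ ^+ k) (kp true x) (kp false x) => *.
fieldh.
Qed.

Hypotheses (hq : forall m, (0 < m)%N -> q ^+ m != 1) (lam0n : lam0 != 0) (two : (2%:R : F) != 0).

Definition pt (e : {ffun 'I_n -> bool}) i := nd (e i) i.

Fixpoint pairs (e : {ffun 'I_n -> bool}) (l : seq 'I_n) : F :=
  if l is i :: l' then \prod_(j <- l') fac2 q (pt e i) (pt e j) * pairs e l' else 1.

Lemma pairs_rem e i l : i \in l -> pairs e l = \prod_(j <- rem i l) fac2 q (pt e i) (pt e j) * pairs e (rem i l).
Proof.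
elim: l => [//|k l IH]; rewrite inE eq_sym /=.
have [->|ki] := eqVneq k i; first by [].
rewrite /= => il; rewrite IH // (big_rem i) //= big_cons.
rewrite mulrACA [fac2 q (pt e k) _]fac2C -!mulrA; congr (_ * _).
Qed.

Definition uterm (e : {ffun 'I_n -> bool}) l := \prod_(i <- l) (sg (e i) * al (e i) i) * pairs e l.
Definition usum l := \sum_(e : {ffun 'I_n -> bool}) uterm e l.

Lemma sum_flip (G : bool -> {ffun 'I_n -> bool} -> F) i :
  (forall b (e e1 : {ffun _ -> bool}), (forall j, j != i -> e j = e1 j) -> G b e = G b e1) ->
  \sum_b \sum_e G b e = 2%:R * \sum_(e : {ffun 'I_n -> bool}) G (e i) e.
Proof.
move=> GE; pose fl (e : {ffun 'I_n -> bool}) := [ffun j => if j == i then ~~ e j else e j].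
have flK : involutive fl by move=> e; apply/ffunP => j; rewrite !ffunE; case: eqP => // _; rewrite negbK.
rewrite exchange_big /= mulr_natl mulr2n [X in _ = _ + X](reindex_inj (inv_inj flK)) -big_split.
apply: eq_bigr => e _; rewrite sum_bool /= ffunE eqxx.
have -> b : G b (fl e) = G b e by apply: GE => j ij; rewrite ffunE (negPf ij).
by case: (e i) => //=; rewrite addrC.
Qed.

Lemma pt_inj e : injective (pt e).
Proof.
move=> i j; apply: contra_eq => ij; rewrite -subr_eq0; apply: nd_sub.
by rewrite eq_sym.
Qed.

Lemma map_rem (T1 T2 : eqType) (f : T1 -> T2) : injective f ->
  forall x l, rem (f x) (map f l) = map f (rem x l).
Proof.
move=> finj x; elim=> [//|y l IH] /=; rewrite (inj_eq finj).
by case: eqP => //= _; rewrite IH.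
Qed.

Lemma fwd_pt b i j e : i != j -> fwd (nd b i) (w j) = fac1 q (nd b i) (pt e j) * fac2 q (nd b i) (pt e j).
Proof.
move=> ij.
have H : fwd (nd b i) (w j) = fwd (nd b i) (pt e j) by rewrite /pt /nd; case: (e j); rewrite // fwdV.
have p0 : pt e j != 0 by rewrite /pt /nd; case: (e j); rewrite ?invr_eq0.
rewrite H; apply: fwd_fac => //.
- by apply: nd_sub; rewrite eq_sym.
- have : nd b i - nd (~~ e j) j != 0 by apply: nd_sub; rewrite eq_sym.
  have -> : nd (~~ e j) j = (pt e j)^-1 by rewrite /pt /nd; case: (e j); rewrite /= ?invrK.
  apply: contraNneq => /eqP; rewrite subr_eq0 => /eqP E.
  by rewrite subr_eq0; apply/eqP/(mulIf p0); rewrite mulVf.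
- rewrite /pt /nd; case: (e j) => //; have := w2 j.
  by apply: contraNneq => /eqP; rewrite subr_eq0 exprVn eq_sym invr_eq1 eq_sym => /eqP <-; rewrite subrr.
Qed.

Lemma expq_sub m : (0 < m)%N -> q ^+ m - q ^- m != 0.
Proof.
move=> m0; rewrite subr_eq0; apply/eqP => E.
have /eqP[] : q ^+ (m + m) != 1 by apply: hq; rewrite addn_gt0 m0.
by rewrite exprD {1}E mulVf // expf_neq0.
Qed.

Fixpoint cst k : F := if k is k'.+1 then 2%:R * cst k' * (h * (lam0 * (q^-1 * q^-1) ^+ k')) *
    ((q ^+ k - q ^- k) / (q - q^-1)) else (2%:R ^+ n)^-1.

Lemma qq0 : q - q^-1 != 0. Proof. exact: (@expq_sub 1). Qed.

Lemma cst_neq0 k : cst k != 0.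
Proof.
elim: k => [|k IH]; first by rewrite /= invr_eq0 expf_neq0.
by rewrite /= !mulf_neq0 ?invr_eq0 ?expf_neq0 ?mulf_neq0 ?invr_eq0 ?expq_sub ?qq0 // -oppr_eq0 opprB qq0.
Qed.

Lemma usum_rec l : uniq l -> (0 < size l)%N ->
  \sum_(i <- l) (\sum_b sg b * al b i * fprod b i (rem i l)) * usum (rem i l) =
  2%:R * ((q ^+ size l - q ^- size l) / (q - q^-1)) * usum l.
Proof.
move=> ul l0.
have step i : i \in l -> (\sum_b sg b * al b i * fprod b i (rem i l)) * usum (rem i l) =
    2%:R * \sum_e \prod_(j <- rem i l) fac1 q (pt e i) (pt e j) * uterm e l.
  move=> il; set r := rem i l.
  have ri j : j \in r -> i != j by rewrite /r mem_rem_uniq // inE eq_sym => /andP[].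
  pose G b e := sg b * al b i * \prod_(j <- r) (fac1 q (nd b i) (pt e j) * fac2 q (nd b i) (pt e j)) * uterm e r.
  transitivity (\sum_b \sum_e G b e).
    rewrite mulr_suml; apply: eq_bigr => b _; rewrite mulr_sumr; apply: eq_bigr => e _.
    by congr (_ * _ * _); apply: eq_big_seq => j /ri; apply: fwd_pt.
  rewrite (@sum_flip _ i) => [|b e e' ee].
    congr (_ * _); apply: eq_bigr => e _; rewrite /G big_split /= -/(pt e i) /uterm (pairs_rem e il) -/r.
    by rewrite [in RHS](big_rem i il) /= -/r; ring.
  have pe j : j \in r -> e j = e' j by move=> /ri ij; apply: ee; rewrite eq_sym.
  have prE : forall s, {subset s <= r} -> pairs e s = pairs e' s.
    elim=> [//|k s IH] sr /=; rewrite IH => [|x xs]; last by apply: sr; rewrite inE xs orbT.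
    congr (_ * _); apply: eq_big_seq => j js; rewrite /pt !pe //; apply: sr; rewrite inE ?js ?orbT ?eqxx //.
  rewrite /G /uterm prE //; congr (_ * _ * (_ * _)); apply: eq_big_seq => j jr; rewrite /pt pe //.
rewrite (eq_big_seq _ step) -mulr_sumr exchange_big -mulrA; congr (_ * _); rewrite mulr_sumr.
apply: eq_bigr => e _ /=; rewrite -mulr_suml; congr (_ * _).
have := @fac1_sum F q [seq pt e i | i <- l] q0 qq0; rewrite map_inj_uniq; last exact: pt_inj.
rewrite size_map => <- //; last first.
  by apply/allP => _ /mapP[i _ ->]; rewrite /pt /nd; case: (e i); rewrite ?invr_eq0.
rewrite big_map; apply: eq_bigr => i _; rewrite map_rem; last exact: pt_inj.
by rewrite big_map.
Qed.

Lemma iterC_wrd k l : uniq l -> size l = k ->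
  iter k (mulmx opC) (wrd l) = (cst k * \prod_(i <- l) gam (w i) * usum l) *: xi.
Proof.
elim: k l => [|k IH] l ul sl.
  have -> : l = [::] by apply/nilP; rewrite /nilp sl.
  rewrite /= big_nil mulr1 /usum (eq_bigr (fun=> 1)) => [|e _]; last by rewrite /uterm big_nil mulr1.
  by rewrite sumr_const card_ffun card_bool card_ord natrX mulVf ?scale1r // expf_neq0.
have itC (I : eqType) (r : seq I) (v : I -> 'cV[F]_N) : iter k (mulmx opC) (\sum_(i <- r) v i) = \sum_(i <- r) iter k (mulmx opC) (v i).
  by elim: (k) => [//|m IHm] /=; rewrite IHm mulmx_sumr.
have itZ c v : iter k (mulmx opC) (c *: v) = c *: iter k (mulmx opC) v.
  by elim: (k) => [//|m IHm] /=; rewrite IHm scalemxAr.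
rewrite iterSr opC_wrd // itC sl /=.
rewrite (eq_big_seq (fun i => (cst k * (h * (lam0 * (q^-1 * q^-1) ^+ k)) * \prod_(i <- l) gam (w i) *
   ((\sum_b sg b * al b i * fprod b i (rem i l)) * usum (rem i l))) *: xi)); last first.
  move=> i il; rewrite -scaler_suml itZ IH ?rem_uniq ?size_rem ?sl // scalerA; congr (_ *: _).
  rewrite [in RHS](big_rem i il) /=; set P := \prod_(_ <- rem i l) gam _.
  have -> : \sum_b cfe k i b (rem i l) = (h * (lam0 * (q^-1 * q^-1) ^+ k)) * gam (w i) * \sum_b sg b * al b i * fprod b i (rem i l).
    by rewrite mulr_sumr; apply: eq_bigr => b _; rewrite /cfe -!mulrA.
  by move: (\sum_b _) (gam _) => s1 s2; ring.
rewrite -scaler_suml -mulr_sumr usum_rec ?sl //; congr (_ *: _).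
by move: (gam) => g; rewrite -mulrA; ring.
Qed.

Lemma pairs_sorted e (l : seq 'I_n) : sorted (fun i j : 'I_n => (i < j)%N) l ->
  pairs e l = \prod_(i <- l) \prod_(j <- l | (i < j)%N) fac2 q (pt e i) (pt e j).
Proof.
elim: l => [|i l IH] /=; first by rewrite big_nil.
move=> il; rewrite IH; last exact: path_sorted il.
have {}il : all (fun j : 'I_n => (i < j)%N) l by apply: order_path_min il => x y z; apply: ltn_trans.
rewrite big_cons big_cons ltnn; congr (_ * _).
  rewrite big_seq_cond [RHS]big_seq_cond; apply: eq_bigl => j.
  by have [/(allP il) ->|] := boolP (j \in l).
apply: eq_big_seq => k kl; rewrite big_cons.
by have /= ik := allP il k kl; rewrite (ltnNge k) (ltnW ik).
Qed.

Lemma pairs_enum e : pairs e (enum 'I_n) = \prod_(i < n) \prod_(j < n | (i < j)%N) fac2 q (pt e i) (pt e j).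
Proof.
rewrite pairs_sorted; last first.
  by have := iota_ltn_sorted 0 n; rewrite -val_enum_ord sorted_map.
by rewrite big_enum; apply: eq_bigr => i _; rewrite big_enum_cond.
Qed.

Definition vdm : 'M[F]_n :=
  \matrix_(i, j) \sum_b sg b * al b i * (q^-1 * nd b i + q / nd b i) ^+ j.

Lemma det_vdm : \det vdm =
  usum (enum 'I_n) * \prod_(i < n) \prod_(j < n | (i < j)%N) ((w j + (w j)^-1) - (w i + (w i)^-1)).
Proof.
pose X e i := q^-1 * pt e i + q / pt e i.
have dE (e : {ffun 'I_n -> bool}) : \prod_i (sg (e i) * al (e i) i) * \det (Vandermonde n (\row_(i < n) X e i)) =
    uterm e (enum 'I_n) * \prod_(i < n) \prod_(j < n | (i < j)%N) ((w j + (w j)^-1) - (w i + (w i)^-1)).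
  rewrite det_Vandermonde /uterm pairs_enum big_enum -mulrA; congr (_ * _).
  rewrite -big_split; apply: eq_bigr => i _ /=; rewrite -big_split; apply: eq_bigr => j ij /=.
  rewrite !mxE /X.
  have pE k : w k + (w k)^-1 = pt e k + (pt e k)^-1.
    by rewrite /pt /nd; case: (e k); rewrite ?invrK // addrC.
  have p0 k : pt e k != 0 by rewrite /pt /nd; case: (e k); rewrite ?invr_eq0.
  rewrite !pE; apply: fac2_diff => //.
  have nij : i != j by rewrite neq_ltn ij.
  have : pt e i - nd (~~ e j) j != 0 by apply: nd_sub; rewrite eq_sym.
  have -> : nd (~~ e j) j = (pt e j)^-1 by rewrite /pt /nd; case: (e j); rewrite /= ?invrK.
  apply: contraNneq => /eqP; rewrite subr_eq0 => /eqP E.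
  by rewrite subr_eq0; apply/eqP/(mulIf (p0 j)); rewrite mulVf.
rewrite /usum mulr_suml -(eq_bigr _ (fun e _ => dE e)) /determinant.
have M0 (s : 'S_n) : \prod_i vdm i (s i) =
    \sum_(e : {ffun 'I_n -> bool}) \prod_i (sg (e i) * al (e i) i * X e i ^+ s i).
  rewrite /X /pt -(bigA_distr_bigA (fun i b => sg b * al b i * (q^-1 * nd b i + q / nd b i) ^+ s i)).
  by apply: eq_bigr => i _; rewrite mxE.
transitivity (\sum_(s : 'S_n) \sum_(e : {ffun 'I_n -> bool}) (-1) ^+ s * \prod_i (sg (e i) * al (e i) i * X e i ^+ s i)).
  by apply: eq_bigr => s _; rewrite -mulr_sumr; congr (_ * _); apply: M0.
rewrite exchange_big /=; apply: eq_bigr => e _; rewrite -/(\det _) -det_tr /determinant mulr_sumr.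
apply: eq_bigr => s _; rewrite big_split /= mulrCA; congr (_ * (_ * _)).
by apply: eq_bigr => i _; rewrite !mxE.
Qed.

Lemma det_vdm0 : xi != 0 -> wrd (enum 'I_n) = 0 -> \det vdm = 0.
Proof.
move=> xi0 W0; have := iterC_wrd (enum_uniq 'I_n) (size_enum_ord n).
rewrite W0 (_ : iter _ _ _ = 0); last by elim: (n) => [//|k IH] /=; rewrite IH mulmx0.
move=> /eqP; rewrite eq_sym scaler_eq0 (negPf xi0) orbF mulf_eq0 mulf_eq0 (negPf (cst_neq0 _)) /=.
rewrite prodf_seq_eq0 (negPf (_ : ~~ has _ _)) /=; last by rewrite -all_predC; apply/allP => i _; rewrite /= gam_neq0.
by move=> /eqP U0; rewrite det_vdm U0 mul0r.
Qed.
Lemma wrd0 l : (N <= size l)%N -> wrd l = 0.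
Proof.
apply: contraTeq => W0; rewrite -ltnNge.
have nz k : wrd (drop k l) != 0.
  apply: contraNneq W0 => D0; rewrite -(cat_take_drop k l).
  by elim: (take k l) => [|i s IH] /=; rewrite ?D0 // (eqP IH) mulmx0.
pose ev k := lam0 * (q^-1 * q^-1) ^+ k.
have evI j k : (j <= k)%N -> ev j = ev k -> j = k.
  move=> jk /(mulfI lam0n); rewrite -(subnK jk) exprD => E; apply/eqP; rewrite eqn_leq leq_addl /=.
  have := @hq ((k - j) * 2)%N; rewrite muln_gt0 andbT; case: (k - j)%N E => // m E /(_ isT) /eqP[].
  have H : (q^-1 * q^-1) ^+ m.+1 = 1.
    apply: (mulIf (x := (q^-1 * q^-1) ^+ j)); first by rewrite expf_neq0 // mulf_neq0 ?invr_eq0.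
    by rewrite mul1r -E.
  by rewrite mulnC exprM -[LHS]invrK -exprVn expr2 invfM H invr1.
have rt : all (root (char_poly E0^T)) [seq ev k | k <- iota 0 (size l).+1].
  apply/allP => _ /mapP[k kl ->]; rewrite -eigenvalue_root_char; apply/eigenvalueP.
  exists (wrd (drop (size l - k) l))^T; last by rewrite trmx_eq0.
  rewrite -trmx_mul E0_wrd size_drop subKn; first by rewrite linearZ.
  by move: kl; rewrite mem_iota add0n ltnS.
have := max_poly_roots (monic_neq0 (char_poly_monic _)) rt; rewrite size_char_poly size_map size_iota ltnS; apply.
rewrite map_inj_in_uniq ?iota_uniq // => j k _ _; case: (leqP j k) => [/evI//|/ltnW/evI E /esym/E//].
Qed.
End Words.

Section Evaluation.
Variables (n : nat) (P : points n).
Local Notation F := (pF P).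
Local Notation io := (pio P).
Local Notation w i := (pw P (nat_of_ord i)).
Local Notation ev i := (pev P (nat_of_ord i)).
Local Notation ev2 i j := (pev2 P (nat_of_ord i) (nat_of_ord j)).
Implicit Types i j : 'I_n.

Lemma evD i f g : ev i (fun r => f r + g r) = ev i f + ev i g. Proof. exact: pevD. Qed.
Lemma evZ i c f : ev i (fun r => c * f r) = io c * ev i f. Proof. exact: pevZ. Qed.
Lemma ord_neq i j : i != j -> (i : nat) != j. Proof. by []. Qed.
Hint Resolve ord_neq : core.
Lemma ev2D i j f g : i != j -> ev2 i j (fun r s => f r s + g r s) = ev2 i j f + ev2 i j g.
Proof. by move=> ij; apply: pev2D => //; apply: ord_neq. Qed.
Lemma ev2Z i j c f : i != j -> ev2 i j (fun r s => c * f r s) = io c * ev2 i j f.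
Proof. by move=> ij; apply: pev2Z => //; apply: ord_neq. Qed.

Lemma ev_sum i N (f : 'I_N -> nat -> C) : ev i (fun r => \sum_k f k r) = \sum_k ev i (f k).
Proof.
elim: N f => [|N IH] f.
  rewrite big_ord0 -(mul0r (ev i (fun=> 0))) -(rmorph0 io) -evZ; congr pev.
  by apply/funext => r; rewrite big_ord0 mulr0.
rewrite big_ord_recl -IH -evD; congr pev.
by apply/funext => r; rewrite big_ord_recl.
Qed.

Lemma ev2_sum i j N (f : 'I_N -> nat -> nat -> C) : i != j ->
  ev2 i j (fun r s => \sum_k f k r s) = \sum_k ev2 i j (f k).
Proof.
move=> ij; elim: N f => [|N IH] f.
  rewrite big_ord0 -(mul0r (ev2 i j (fun _ _ => 0))) -(rmorph0 io) -ev2Z //; congr pev2.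
  by apply/funext => r; apply/funext => s; rewrite big_ord0 mulr0.
rewrite big_ord_recl -IH -ev2D //; congr pev2.
by apply/funext => r; apply/funext => s; rewrite big_ord_recl.
Qed.

Lemma ev2_shift i j k l f : i != j -> ev2 i j (shift k l f) = w i ^+ k * w j ^+ l * ev2 i j f.
Proof.
move=> ij; elim: k l f => [|k IH] l f; last first.
  transitivity (w i * ev2 i j (shift k l f)); last by rewrite IH exprS !mulrA.
  rewrite -(@pev2x n P i j (shift k l f) (ltn_ord i) (ltn_ord j) (ord_neq ij)); congr pev2.
  by apply/funext => -[|r]; apply/funext => s; rewrite /shift ?subSS.
elim: l => [|l IH].
  by rewrite !expr0 !mul1r; congr pev2; apply/funext => r; apply/funext => s; rewrite /shift !subn0.
transitivity (w j * ev2 i j (shift 0 l f)); last by rewrite IH exprS !expr0 !mul1r mulrA.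
rewrite -(@pev2y n P i j (shift 0 l f) (ltn_ord i) (ltn_ord j) (ord_neq ij)); congr pev2.
by apply/funext => r; apply/funext => -[|s]; rewrite /shift ?subSS.
Qed.

Lemma ev_shift2 i f : ev i (shift2 f) = w i ^+ 2 * ev i f.
Proof.
by rewrite expr2 -mulrA -!pevX ?ltn_ord.
Qed.

Definition evM N M i (X : nat -> 'M[C]_(N, M)) : 'M[F]_(N, M) := \matrix_(a, b) ev i (fun r => X r a b).
Definition evM2 N M i j (X : nat -> nat -> 'M[C]_(N, M)) : 'M[F]_(N, M) :=
  \matrix_(a, b) ev2 i j (fun r s => X r s a b).

Lemma evMD N M i (X Y : nat -> 'M[C]_(N, M)) : evM i (fun r => X r + Y r) = evM i X + evM i Y.
Proof. by apply/matrixP => a b; rewrite !mxE -evD; congr pev; apply/funext => r; rewrite mxE. Qed.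
Lemma evMZ N M i c (X : nat -> 'M[C]_(N, M)) : evM i (fun r => c *: X r) = io c *: evM i X.
Proof. by apply/matrixP => a b; rewrite !mxE -evZ; congr pev; apply/funext => r; rewrite mxE. Qed.
Lemma evM_shift2 N M i (X : nat -> 'M[C]_(N, M)) : evM i (shift2 X) = w i ^+ 2 *: evM i X.
Proof.
apply/matrixP => a b; rewrite !mxE -ev_shift2; congr pev.
by apply/funext => -[|[|r]]; rewrite /= ?mxE.
Qed.
Lemma evM2D N M i j (X Y : nat -> nat -> 'M[C]_(N, M)) : i != j ->
  evM2 i j (fun r s => X r s + Y r s) = evM2 i j X + evM2 i j Y.
Proof.
move=> ij; apply/matrixP => a b; rewrite !mxE -ev2D //; congr pev2.
by apply/funext => r; apply/funext => s; rewrite mxE.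
Qed.
Lemma evM2Z N M i j c (X : nat -> nat -> 'M[C]_(N, M)) : i != j ->
  evM2 i j (fun r s => c *: X r s) = io c *: evM2 i j X.
Proof.
move=> ij; apply/matrixP => a b; rewrite !mxE -ev2Z //; congr pev2.
by apply/funext => r; apply/funext => s; rewrite mxE.
Qed.
Lemma evM2_shift N M i j k l (X : nat -> nat -> 'M[C]_(N, M)) : i != j ->
  evM2 i j (shift k l X) = (w i ^+ k * w j ^+ l) *: evM2 i j X.
Proof.
move=> ij; apply/matrixP => a b; rewrite !mxE -ev2_shift //; congr pev2.
by apply/funext => r; apply/funext => s; rewrite /shift; case: ifP; rewrite ?mxE.
Qed.
Lemma evM2_quad N M i j a b c d (X : nat -> nat -> 'M[C]_(N, M)) : i != j ->
  evM2 i j (quad a b c d X) =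
  ((io a * w j + io b * w i) * (io c * (w i * w j) + io d)) *: evM2 i j X.
Proof.
move=> ij; rewrite (_ : quad a b c d X = fun r s => quad a b c d X r s) // quad.unlock.
by rewrite !(evM2D, evM2Z, evM2_shift) // !rmorphM; linring.
Qed.
Lemma evM2M N i j (X Y : nat -> 'M[C]_N) : i != j ->
  evM2 i j (fun r s => X r *m Y s) = evM i X *m evM j Y.
Proof.
move=> ij; apply/matrixP => a b; rewrite !mxE.
under [RHS]eq_bigr => k _ do rewrite !mxE -(@pev2M n P i j _ _ (ltn_ord i) (ltn_ord j) (ord_neq ij)).
rewrite -ev2_sum //; congr pev2.
by apply/funext => r; apply/funext => s; rewrite mxE.
Qed.
Lemma evM2Mr N i j (X Y : nat -> 'M[C]_N) : i != j ->
  evM2 i j (fun r s => Y s *m X r) = evM j Y *m evM i X.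
Proof.
move=> ij; apply/matrixP => a b; rewrite !mxE.
under [RHS]eq_bigr => k _ do rewrite !mxE mulrC -(@pev2M n P i j _ _ (ltn_ord i) (ltn_ord j) (ord_neq ij)).
rewrite -ev2_sum //; congr pev2.
by apply/funext => r; apply/funext => s; rewrite mxE; apply: eq_bigr => k _; rewrite mulrC.
Qed.
Lemma evM_mulr N M K i (X : nat -> 'M[C]_(N, M)) (Y : 'M_(M, K)) :
  evM i (fun r => X r *m Y) = evM i X *m map_mx io Y.
Proof.
apply/matrixP => a b; rewrite !mxE.
under [RHS]eq_bigr => k _ do rewrite !mxE mulrC -evZ.
rewrite -ev_sum; congr pev; apply/funext => r; rewrite mxE.
by apply: eq_bigr => k _; rewrite mulrC.
Qed.
Lemma evM_mull N M K i (X : nat -> 'M[C]_(N, M)) (Y : 'M_(K, N)) :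
  evM i (fun r => Y *m X r) = map_mx io Y *m evM i X.
Proof.
apply/matrixP => a b; rewrite !mxE.
under [RHS]eq_bigr => k _ do rewrite !mxE -evZ.
by rewrite -ev_sum; congr pev; apply/funext => r; rewrite mxE.
Qed.
Lemma evM_eigen N i (X : nat -> 'M[C]_N) (v : 'cV_N) (f : nat -> C) :
  (forall r, X r *m v = f r *: v) -> evM i X *m map_mx io v = ev i f *: map_mx io v.
Proof.
move=> Xv; rewrite -evM_mulr; apply/matrixP => a b; rewrite !mxE mulrC -evZ; congr pev.
by apply/funext => r; rewrite Xv mxE mulrC.
Qed.

Lemma ev_lin_neq0 i a b : a != 0 -> io a - io b * w i ^+ 2 != 0.
Proof.
apply: contra_neq => H; pose one r : C := (r == 0%N)%:R.
suff /(pev_inj (ltn_ord i))/(_ 0%N) : ev i (fun r => a * one r + - b * shift2 one r) = 0.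
  by rewrite /one mulr1 /= mulr0 addr0.
by rewrite evD !evZ ev_shift2 pev1 ?ltn_ord // !mulr1 rmorphN mulNr.
Qed.

Lemma pw_neq0 i : w i != 0.
Proof.
apply: contra_neq (oner_neq0 C) => wi0; pose one r : C := (r == 0%N)%:R.
suff /(pev_inj (ltn_ord i))/(_ 1%N) : pev P i (fun r => if r is m.+1 then one m else 0) = 0 by [].
by rewrite pevX ?ltn_ord // wi0 mul0r.
Qed.

Lemma ev2_quad_neq0 i j a b c d : i != j -> (a != 0) || (b != 0) -> d != 0 ->
  (io a * w j + io b * w i) * (io c * (w i * w j) + io d) != 0.
Proof.
move=> ij ab d0; apply: contraL ab => /eqP H; pose one r : C := (r == 0%N)%:R.
have /(pev2_inj (ltn_ord i) (ltn_ord j) ij) E : ev2 i j (quad a b c d (fun r s => one r * one s : C^o)) = 0.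
  rewrite (_ : quad a b c d _ = fun r s => quad a b c d (fun r s => one r * one s : C^o) r s) // quad.unlock.
  rewrite !(ev2D, ev2Z, ev2_shift) // (@pev2M n P i j _ _ (ltn_ord i) (ltn_ord j) (ord_neq ij)) !pev1 ?ltn_ord // !rmorphM.
  by rewrite -[RHS]H; ring.
rewrite negb_or !negbK; apply/andP; split.
  have := E 0%N 1%N; rewrite quad.unlock /shift /= !(mulr0, addr0, add0r, scaler0) /one /= mulr1.
  by move=> /eqP; rewrite scaler_eq0 oner_eq0 orbF mulf_eq0 (negPf d0) orbF.
have := E 1%N 0%N; rewrite quad.unlock /shift /= !(mulr0, addr0, add0r, scaler0) /one /= mulr1.
by move=> /eqP; rewrite scaler_eq0 oner_eq0 orbF mulf_eq0 (negPf d0) orbF.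
Qed.
End Evaluation.

Section Determinant.
Variables (q : C) (q0 : q != 0) (hq : forall n : nat, (0 < n)%N -> q ^+ n != 1).
Variables (mu mub : nat -> C) (N : nat) (M : hw_module q mu mub N) (mub0 : mub 0%N != 0).
Variables (P : points N).
Local Notation F := (pF P).
Local Notation io := (pio P).
Local Notation Q := (io q).
Local Notation h := (Q^-1 - Q).
Let w (i : 'I_N) := pw P i.
Let A (i : 'I_N) := evM P i (opA M).
Let B (i : 'I_N) := evM P i (opB M).
Let D (i : 'I_N) := evM P i (opD M).
Let E (i : 'I_N) := evM P i (opE M).
Let xi := map_mx io (hwv M).
Let C0 := map_mx io (opC M).
Let E0 := map_mx io (opE M 0%N).

Let ioq : io q^-1 = Q^-1. Proof. exact: fmorphV. Qed.
Let ioh : io (q^-1 - q) = h. Proof. by rewrite rmorphB ioq. Qed.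
Let Q0 : Q != 0. Proof. by rewrite fmorph_eq0. Qed.
Let q1 : q^-1 != 0. Proof. by rewrite invr_eq0. Qed.
Let iosimp := (ioh, ioq, rmorphN, rmorph1, rmorph0).

Let neq2 i j : i != j -> w j - w i != 0.
Proof.
move=> ij; have := @ev2_quad_neq0 N P i j (1) (-1) (0) (1) ij.
by rewrite !oner_eq0 !iosimp mul0r add0r mulr1 mul1r mulN1r; apply.
Qed.
Let w0 i : w i != 0. Proof. exact: pw_neq0. Qed.
Let neqxy i j : i != j -> w i * w j - 1 != 0.
Proof.
move=> ij; have := @ev2_quad_neq0 N P i j (0) (1) (1) (-1) ij.
rewrite oner_eq0 orbT oppr_eq0 oner_eq0 !iosimp mul0r add0r !mul1r => /(_ isT isT).
by rewrite mulf_eq0 (negPf (w0 i)).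
Qed.
Let neqq i j : i != j -> Q^-1 * (w i * w j) - Q != 0.
Proof.
move=> ij; have := @ev2_quad_neq0 N P i j (0) (1) (q^-1) (- q) ij.
rewrite oner_eq0 orbT oppr_eq0 q0 !iosimp mul0r add0r !mul1r => /(_ isT isT).
by rewrite mulf_eq0 (negPf (w0 i)).
Qed.
Let w2 i : 1 - w i ^+ 2 != 0.
Proof. by have := ev_lin_neq0 P i 1 (oner_neq0 C); rewrite !iosimp mul1r. Qed.
Let qw i : Q - Q^-1 * w i ^+ 2 != 0.
Proof. by have := ev_lin_neq0 P i q^-1 q0; rewrite !iosimp. Qed.

Let BB i j : i != j -> B i *m B j = B j *m B i.
Proof.
move=> ij; have EE : quad q^-1 (- q) q^-1 (- q) (fun r s => opB M r *m opB M s) =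
    quad q^-1 (- q) q^-1 (- q) (fun r s => opB M s *m opB M r).
  by apply/funext => r; apply/funext => s; apply: opBB.
have := congr1 (evM2 P i j) EE; rewrite !evM2_quad // evM2M // evM2Mr // => /scalerI; apply.
by apply: ev2_quad_neq0; rewrite ?q1 ?oppr_eq0.
Qed.

Let EAD i : (1 - w i ^+ 2) *: E i = - (Q - Q^-1 * w i ^+ 2) *: D i - (h * w i ^+ 2) *: A i.
Proof.
have EE : (fun r => opE M r + (-1) *: shift2 (opE M) r) = (fun r => (- q) *: opD M r + (q^-1 *: shift2 (opD M) r
   + (- (q^-1 - q)) *: shift2 (opA M) r)).
  apply/funext => r; rewrite scaleN1r opEAD; linring.
have := congr1 (evM P i) EE; rewrite !(evMD, evMZ) !evM_shift2 -/(A i) -/(D i) -/(E i) -/(w i) !iosimp => H.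
by apply: (lin_comb (c := 1) H); linring.
Qed.

Let relA i j : i != j -> A j *m B i = fwd Q (w j) (w i) *: (B i *m A j)
   - (h * gam Q (w i)) *: ((w i / (w j - w i)) *: (B j *m A i) - ((w i)^-1 / (w j - (w i)^-1)) *: (B j *m D i)).
Proof.
move=> ij; apply: (@solve_A F Q _ (w i) (w j) Q0 (w0 i) (w2 i) (neq2 ij) (neqxy ij) _ (B j *m E i)).
  by rewrite scalemxAr EAD mulmxBr -!scalemxAr.
have EE : quad q^-1 (- q) q^-1 (- q) (fun r s => opB M r *m opA M s) =
  fun r s => quad 1 (- 1) 1 (- 1) (fun r s => opA M s *m opB M r) r s +
    (quad 1 (- 1) 0 (q^-1 - q) (fun r s => opB M s *m opE M r) r s +
    quad 0 (q^-1 - q) q^-1 (- q) (fun r s => opB M s *m opA M r) r s).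
  by apply/funext => r; apply/funext => s; rewrite opAB addrA.
have := congr1 (evM2 P i j) EE; rewrite !evM2D // !evM2_quad // evM2M // !evM2Mr // -/(w i) -/(w j) -/(A i) -/(A j) -/(B i) -/(B j) -/(E i) !iosimp => H.
by apply: (lin_comb (c := 1) H); linring.
Qed.

Let relD i j : i != j -> D j *m B i = fwd Q (w j)^-1 (w i) *: (B i *m D j)
   + (h * gam Q (w i) * (gam Q (w j)^-1 / gam Q (w j))) *: ((w i / ((w j)^-1 - w i)) *: (B j *m A i)
     - ((w i)^-1 / ((w j)^-1 - (w i)^-1)) *: (B j *m D i)).
Proof.
move=> ij; have ji : j != i by rewrite eq_sym.
apply: (@solve_D F Q _ (w i) (w j) Q0 (w0 i) (w0 j) (w2 i) (w2 j) (qw j) (neq2 ij) (neqxy ij) (neqq ij)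
  (A j *m B i) (A i *m B j) (E j *m B i) _ (B j *m E i) (B i *m E j) (B i *m A j)).
- by rewrite scalemxAr EAD mulmxBr -!scalemxAr.
- by rewrite scalemxAr EAD mulmxBr -!scalemxAr.
- by rewrite scalemxAl EAD mulmxBl -!scalemxAl.
- exact: relA.
- exact: relA.
have EE : (fun r s => quad 1 (- 1) q^-1 (- q) (fun r s => opE M r *m opB M s) r s +
    (quad 0 (q^-1 - q) 1 (- 1) (fun r s => opB M r *m opE M s) r s +
    quad 0 (q^-1 - q) (q^-1 - q) 0 (fun r s => opA M r *m opB M s) r s)) =
   (fun r s => quad q^-1 (- q) 1 (- 1) (fun r s => opB M s *m opE M r) r s +
    quad q^-1 (- q) (q^-1 - q) 0 (fun r s => opA M s *m opB M r) r s).
  by apply/funext => r; apply/funext => s; rewrite addrA opEB.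
have := congr1 (evM2 P j i) EE; rewrite !evM2D // !evM2_quad // !evM2M // !evM2Mr // -/(w i) -/(w j) -/(A i) -/(A j) -/(B i) -/(B j) -/(E i) -/(E j) !iosimp => H.
by apply: (lin_comb (c := 1) H); linring.
Qed.

Lemma hw_det : \det (\matrix_(i < N, j < N) (pev P i mu * (Q^-1 * w i + Q / w i) ^+ j
   - pev P i mub * (Q^-1 / w i + Q * w i) ^+ j)) = 0.
Proof.
have lam0 : io (- q * mub 0%N) != 0 by rewrite fmorph_eq0 mulf_neq0 ?oppr_eq0.
have E0xi : opE M 0%N *m hwv M = (- q * mub 0%N) *: hwv M.
  have := opEAD M 0%N; rewrite /= subr0 !scaler0 !subr0 => ->.
  by rewrite mulNmx -scalemxAl hwD scalerA mulNr scaleNr.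
have D0 : @vdm F Q N w (fun i => pev P i mu) (fun i => pev P i mub) = \matrix_(i < N, j < N)
    (pev P i mu * (Q^-1 * w i + Q / w i) ^+ j - pev P i mub * (Q^-1 / w i + Q * w i) ^+ j).
  by apply/matrixP => i j; rewrite !mxE sum_bool /= !mul1r mulN1r invrK mulNr.
rewrite -D0.
have hyp1 b i j : i != j -> op A D b j *m B i =
    fwd Q (nd w b j) (w i) *: (B i *m op A D b j)
    - (h * gam Q (w i) * kp Q w b j) *: \sum_(b' : bool) (sg F b' * nd w b' i / (nd w b j - nd w b' i)) *: (B j *m op A D b' i).
  move=> ij; rewrite sum_bool; case: b; rewrite /op /kp /nd /sg /= !mul1r !mulN1r ?mulr1 mulNr scaleNr.
    exact: relA.
  by rewrite relD // mulrN scaleNr opprK.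
have hypE i : E0 *m B i = (Q^-1 * Q^-1) *: (B i *m E0).
  have EE : (fun r => opE M 0%N *m opB M r) = (fun r => (q^-1 * q^-1) *: (opB M r *m opE M 0%N)).
    by apply/funext => r; rewrite opE0B.
  by have := congr1 (evM P i) EE; rewrite evMZ evM_mull evM_mulr rmorphM ioq.
have hypX : E0 *m xi = io (- q * mub 0%N) *: xi by rewrite -map_mxM E0xi map_mxZ.
have hypq m : (0 < m)%N -> Q ^+ m != 1 by move=> m0; rewrite -rmorphXn fmorph_eq1 hq.
apply: (@det_vdm0 F Q N w N A B D E C0 E0 xi _ _ (io (- q * mub 0%N))) => //.
- by move=> i j ij; rewrite neq2 // eq_sym.
- by move=> i j ij; rewrite -oppr_eq0 opprB neqxy.
- move=> i; have EE : (fun r => opC M *m opB M r) = (fun r => opB M r *m opC M + ((q^-1 - q) *: (opE M 0%N *m opE M r) +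
       ((q^-1 - q) * q) *: (opA M r *m opE M 0%N))).
    by apply/funext => r; rewrite -opCB addrCA subrr addr0.
  have := congr1 (evM P i) EE; rewrite !evMD !evMZ !evM_mull !evM_mulr -/(A i) -/(B i) -/(E i) -/C0 -/E0 ioh rmorphM ioh => ->.
  by rewrite addrA.
- by move=> [] i; apply: evM_eigen => r; rewrite ?hwA ?hwD.
- by rewrite -map_mxM hwC map_mx0.
- by rewrite -(rmorph_nat io) fmorph_eq0 pnatr_eq0.
- by rewrite map_mx_eq0 hwv_neq0.
apply: (wrd0 Q0 hypE hypX hypq lam0); by rewrite size_enum_ord.
Qed.
End Determinant.

Lemma poly_eq_nz (p r : {poly C}) : (forall x, x != 0 -> p.[x] = r.[x]) -> p = r.
Proof.
move=> pr; apply/eqP; rewrite -subr_eq0; apply/eqP; set d := p - r.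
apply: (@roots_geq_poly_eq0 _ d [seq k.+1%:R | k <- iota 0 (size d)]).
- apply/allP => _ /mapP[k _ ->]; rewrite rootE hornerD hornerN pr ?subrr //.
  by rewrite pnatr_eq0.
- rewrite map_inj_uniq ?iota_uniq // => j k /eqP; rewrite eqr_nat => /eqP; exact: succn_inj.
- by rewrite size_map size_iota.
Qed.

Definition rev_poly (F : fieldType) (d : nat) (p : {poly F}) := \poly_(i < d.+1) p`_(d - i).

Lemma horner_rev_poly (F : fieldType) d (p : {poly F}) x : (size p <= d.+1)%N -> x != 0 ->
  (rev_poly d p).[x] = x ^+ d * p.[x^-1].
Proof.
move=> pd x0; rewrite horner_poly (horner_coef_wide _ pd) (reindex_inj rev_ord_inj) mulr_sumr.
apply: eq_bigr => i _; rewrite [val (rev_ord i)]/= subSS.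
have id : (i <= d)%N by rewrite -ltnS.
by rewrite subKn // mulrCA exprVn -exprB ?unitfE.
Qed.

Lemma rev_poly_eq d (p r : {poly C}) : (size p <= d.+1)%N ->
  (forall x, x != 0 -> r.[x] = x ^+ d * p.[x^-1]) -> rev_poly d p = r.
Proof. by move=> pd E; apply: poly_eq_nz => x x0; rewrite E // horner_rev_poly. Qed.

Lemma revpE d (p : {poly C}) : size p = d.+1 -> revp p = rev_poly d p.
Proof. by rewrite /revp => ->. Qed.

Definition smul (f : nat -> C) (p : {poly C}) := ser_mul f (fun k => p`_k).

Lemma smulD f p r k : smul f (p + r) k = smul f p k + smul f r k.
Proof. by rewrite -big_split; apply: eq_bigr => a _; rewrite coefD mulrDr. Qed.
Lemma smulZ f c p k : smul f (c *: p) k = c * smul f p k.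
Proof. by rewrite /smul /ser_mul mulr_sumr; apply: eq_bigr => a _; rewrite coefZ mulrCA. Qed.
Lemma smul0 f k : smul f 0 k = 0.
Proof. by rewrite -(scale0r 0) smulZ mul0r. Qed.
Lemma smul1 f k : smul f 1 k = f k.
Proof.
rewrite /smul /ser_mul big_ord_recr /= subnn coef1 mulr1 big1 ?add0r // => a _.
by rewrite coef1 subn_eq0 leqNgt ltn_ord mulr0.
Qed.
Lemma smulX f p k : smul f (p * 'X) k = if k is m.+1 then smul f p m else 0.
Proof.
rewrite /smul /ser_mul big_ord_recr /= subnn coefMX mulr0 addr0; case: k => [|m]; first by rewrite big_ord0.
apply: eq_bigr => a _; have am : (a <= m)%N by rewrite -ltnS.
by rewrite coefMX subSn.
Qed.
Lemma smulXn f g p r m : (forall k, smul f (p * 'X^m) k = smul g (r * 'X^m) k) -> forall k, smul f p k = smul g r k.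
Proof.
elim: m => [|m IH] H k; first by have := H k; rewrite expr0 !mulr1.
by apply: IH => {}k; have := H k.+1; rewrite exprSr !mulrA !smulX.
Qed.
Lemma smul_sum f (I : finType) (S : pred I) (c : I -> C) (p : I -> {poly C}) k :
  smul f (\sum_(j | S j) c j *: p j) k = \sum_(j | S j) c j * smul f (p j) k.
Proof.
elim/big_rec2: _ => [|j x y _ <-]; first exact: smul0.
by rewrite smulD smulZ.
Qed.

Lemma ev_smul n (P : points n) i f p : (i < n)%N ->
  pev P i (smul f p) = (map_poly (pio P) p).[pw P i] * pev P i f.
Proof.
move=> ni; elim/poly_ind: p => [|p c IH].
  rewrite rmorph0 horner0 (_ : smul f 0 = fun r => 0 * f r) ?pevZ ?rmorph0 //.
  by apply/funext => k; rewrite smul0 mul0r.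
rewrite (_ : smul f _ = fun k => (if k is m.+1 then smul f p m else 0) + c * f k).
  by rewrite pevD // pevX // pevZ // IH rmorphD rmorphM /= map_polyX map_polyC !hornerE /=; ring.
by apply/funext => k; rewrite -smulX -[in RHS](smul1 f k) -smulZ -smulD alg_polyC.
Qed.

Section Extract.
Variables (q : C) (q0 : q != 0) (mu mub : nat -> C) (N : nat) (c : 'rV[C]_N).

Definition hpoly (u v : C) m := \sum_(j < N | (j <= m)%N) c 0 j *: ((u *: 'X^2 + v%:P) ^+ j * 'X^(m - j)).

Lemma size_hpoly u v m : (size (hpoly u v m) <= (m + m).+1)%N.
Proof.
apply: (leq_trans (size_sum _ _ _)); apply/bigmax_leqP => j jm.
apply: (leq_trans (size_scale_leq _ _)); apply: (leq_trans (size_polyMleq _ _)).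
rewrite size_polyXn addnS /=.
have s3 : (size (u *: 'X^2 + v%:P)%R <= 3)%N.
  apply: (leq_trans (size_polyD _ _)); rewrite geq_max (leq_trans (size_scale_leq _ _)) ?size_polyXn //=.
  exact: (leq_trans (size_polyC_leq1 _)).
have e : (size ((u *: 'X^2 + v%:P) ^+ j)%R <= (j + j).+1)%N.
  apply: (leq_trans (size_poly_exp_leq _ _)); rewrite ltnS addnn -mul2n leq_mul2r.
  by case: (size _) s3 => [|[|[|[|]]]] //=; rewrite orbT.
apply: (leq_trans (leq_add e (leqnn _))).
by rewrite addSn ltnS -addnA subnKC // leq_add2r.
Qed.

Lemma horner_hpoly u v m x : (hpoly u v m).[x] = \sum_(j < N | (j <= m)%N) c 0 j * ((u * x ^+ 2 + v) ^+ j * x ^+ (m - j)).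
Proof.
rewrite horner_sum; apply: eq_bigr => j _.
by rewrite hornerZ hornerM horner_exp hornerD hornerZ !hornerXn hornerC.
Qed.

Lemma hpoly_rev u v m x : x != 0 -> (hpoly u v m).[x] = x ^+ (m + m) * (hpoly v u m).[x^-1].
Proof.
move=> x0; rewrite !horner_hpoly mulr_sumr; apply: eq_bigr => j jm.
rewrite [RHS]mulrCA; congr (_ * _).
have -> : (m + m = (m - j) + (m - j) + 2 * j)%N by rewrite mul2n -addnn addnACA subnK.
rewrite 2!exprD.
have -> : u * x ^+ 2 + v = x ^+ 2 * (v * x^-1 ^+ 2 + u) by field.
rewrite exprMn exprM (exprVn x (m - j)).
move: ((x ^+ 2) ^+ j) ((v * x^-1 ^+ 2 + u) ^+ j) (x ^+ (m - j)) (expf_neq0 (m - j) x0) => y z t t0.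
by field.
Qed.

Hypothesis c0 : c != 0.
Hypothesis Hc : forall r, \sum_j c 0 j * (smul mu ((q^-1 *: 'X^2 + q%:P) ^+ j * 'X^(N.-1 - j)) r
  - smul mub ((q *: 'X^2 + q^-1%:P) ^+ j * 'X^(N.-1 - j)) r) = 0.
Hypothesis mub0 : mub 0%N != 0.

Lemma extract_good_P : exists P : {poly C}, good_P q mu mub P.
Proof.
have [i0 ci0] : exists i, c 0 i != 0.
  apply/existsP; apply: contraNT c0; rewrite negb_exists => /forallP H.
  by apply/eqP/matrixP => a b; rewrite (ord1 a) mxE; have := H b; rewrite negbK => /eqP.
case: (@arg_maxnP _ i0 (fun i => c 0 i != 0) (fun i => val i) ci0) => k ck kmax.
pose G := hpoly q^-1 q k; pose H := hpoly q q^-1 k.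
have kN : (k <= N.-1)%N by rewrite -ltnS prednK // (leq_ltn_trans _ (ltn_ord k)).
have top u v : \sum_j c 0 j *: ((u *: 'X^2 + v%:P) ^+ j * 'X^(N.-1 - j)) = hpoly u v k * 'X^(N.-1 - k).
  rewrite /hpoly mulr_suml (bigID (fun j : 'I_N => (j <= k)%N)) /= [X in _ + X]big1 ?addr0.
    by apply: eq_bigr => j jk; rewrite -scalerAl -mulrA -exprD (addnC (k - j)%N) addnBA // subnK.
  move=> j; rewrite -ltnNge => kj; have [/kmax /=|] := boolP (c 0 j != 0); first by rewrite leqNgt kj.
  by rewrite negbK => /eqP ->; rewrite scale0r.
have GH r : smul mu G r = smul mub H r.
  apply: (@smulXn mu mub G H (N.-1 - k)) => {}r; rewrite -!top !smul_sum.
  by apply/eqP; rewrite -subr_eq0 -sumrB -[X in _ == X](Hc r); apply/eqP/eq_bigr => j _; rewrite mulrBr.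
have at0 u v : (hpoly u v k)`_0 = c 0 k * v ^+ k.
  rewrite -horner_coef0 horner_hpoly (bigD1 k) //= subnn expr0 mulr1 expr0n mulr0 add0r big1 ?addr0 // => j /andP[jk nk].
  by rewrite expr0n subn_eq0 leqNgt ltn_neqAle nk jk /= mulr0 mulr0.
have szH u v : u != 0 -> size (hpoly u v k) = (k + k).+1.
  move=> u0; apply: anti_leq; rewrite size_hpoly ltnNge; apply/negP => sz.
  have E : rev_poly (k + k) (hpoly v u k) = hpoly u v k.
    by apply: rev_poly_eq; [exact: size_hpoly|move=> x x0; rewrite hpoly_rev].
  have := at0 v u; rewrite -[k in LHS]/k => E0.
  have : (hpoly u v k)`_(k + k) = 0 by rewrite nth_default.
  by rewrite -E coef_poly ltnSn subnn E0 => /eqP; rewrite mulf_eq0 (negPf ck) expf_eq0 (negPf u0) andbF.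
have revH u v : u != 0 -> revp (hpoly u v k) = hpoly v u k.
  move=> u0; rewrite (revpE (szH u v u0)).
  by apply: rev_poly_eq; [exact: size_hpoly|move=> x x0; rewrite hpoly_rev].
have q1 : q^-1 != 0 by rewrite invr_eq0.
pose l := (c 0 k * q ^+ k)^-1.
have l0 : l != 0 by rewrite invr_eq0 mulf_neq0 ?expf_neq0.
have revZ (b : C) (p : {poly C}) : b != 0 -> revp (b *: p) = b *: revp p.
  move=> b0; rewrite /revp size_scale //; apply/polyP => i; rewrite coefZ !coef_poly.
  by case: ifP; rewrite ?mulr0 // coefZ.
have Gq : G \Po (q ^+ 2 *: 'X) = q ^+ (k + k) *: H.
  apply: poly_eq_nz => x x0; rewrite horner_comp !hornerE /G /H !horner_hpoly mulr_sumr.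
  apply: eq_bigr => j jk; rewrite [RHS]mulrCA; congr (_ * _).
  have -> : (k + k = 2 * (k - j) + 2 * j)%N by rewrite !mul2n -!addnn addnACA subnK.
  have -> : q^-1 * (q ^+ 2 * x) ^+ 2 + q = q ^+ 2 * (q * x ^+ 2 + q^-1) by field.
  by rewrite (exprMn j (q ^+ 2)) (exprMn (k - j) (q ^+ 2)) exprD !exprM; ring.
exists (l *: G); rewrite /good_P.
have -> : (size (l *: G)).-1 = (k + k)%N by rewrite size_scale // szH.
rewrite comp_polyZ Gq; split.
- by rewrite addnn odd_double.
- by rewrite coefZ at0 mulVf // mulf_neq0 ?expf_neq0.
- by rewrite revZ // revH // !scalerA mulrAC mulVf ?expf_neq0 // mul1r.
- apply: contraNneq mub0 => mu0; have := GH 0%N.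
  rewrite /smul /ser_mul !big_ord_recl !big_ord0 /= !addr0 mu0 mul0r at0 => /esym/eqP.
  by rewrite !mulf_eq0 (negPf ck) expf_eq0 (negPf q1) andbF !orbF.
move=> r; rewrite !revZ ?expf_neq0 // revH // revH // -!/(smul _ _ r) !smulZ GH.
by rewrite [RHS]mulrCA mulKf ?expf_neq0.
Qed.
End Extract.

Lemma hw_good_P (q : C) (q0 : q != 0) (hq : forall n : nat, (0 < n)%N -> q ^+ n != 1) mu mub N
  (M : hw_module q mu mub N) : mub 0%N != 0 -> exists P : {poly C}, good_P q mu mub P.
Proof.
move=> mub0; have [P] := points_exist N.
have dt := hw_det q0 hq M mub0 P.
pose phi (j r : nat) := smul mu ((q^-1 *: 'X^2 + q%:P) ^+ j * 'X^(N.-1 - j)) r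
  - smul mub ((q *: 'X^2 + q^-1%:P) ^+ j * 'X^(N.-1 - j)) r.
suff /pdet[c c0 Hc] : \det (\matrix_(i < N, j < N) pev P i (phi j)) = 0 by apply: (extract_good_P q0 c0 Hc mub0).
have w0 (i : 'I_N) : pw P i != 0.
  exact: pw_neq0.
have -> : \matrix_(i < N, j < N) pev P i (phi j) = diag_mx (\row_i pw P i ^+ N.-1) *m
   \matrix_(i < N, j < N) (pev P i mu * ((pio P q)^-1 * pw P i + pio P q / pw P i) ^+ j
   - pev P i mub * ((pio P q)^-1 / pw P i + pio P q * pw P i) ^+ j).
  apply/matrixP => i j; rewrite mul_diag_mx !mxE.
  rewrite (_ : phi j = fun r => smul mu ((q^-1 *: 'X^2 + q%:P) ^+ j * 'X^(N.-1 - j)) r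
     + (-1) * smul mub ((q *: 'X^2 + q^-1%:P) ^+ j * 'X^(N.-1 - j)) r); last first.
    by apply/funext => r; rewrite mulN1r.
  rewrite pevD ?ltn_ord // pevZ ?ltn_ord // !ev_smul ?ltn_ord // rmorphN rmorph1 mulN1r.
  have jN : (j <= N.-1)%N by rewrite -ltnS prednK // (leq_ltn_trans _ (ltn_ord j)).
  rewrite !rmorphM /= !rmorphXn /= !rmorphD /= !linearZ /= !map_polyC !map_polyXn map_polyX.
  rewrite !hornerM !horner_exp !hornerD !hornerZ !hornerXn !hornerX !hornerC /= !fmorphV.
  rewrite -[in RHS](subnK jN) exprD; have Q0 : pio P q != 0 by rewrite fmorph_eq0.
  move: (pio P q) Q0 (pw P i) (w0 i) => Q Q0 w w0'.
  have -> : Q^-1 * w ^+ 2 + Q = w * (Q^-1 * w + Q / w) by field; rewrite ?Q0 ?w0'.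
  have -> : Q * w ^+ 2 + Q^-1 = w * (Q^-1 / w + Q * w) by field; rewrite ?Q0 ?w0'.
  rewrite !(exprMn j w); move: (w ^+ j) (_ ^+ j) (_ ^+ j) (w ^+ (N.-1 - j)) => x1 x2 x3 x4; ring.
by rewrite det_mulmx dt mulr0.
Qed.

Definition tconv (A : nzRingType) (t t' : 'I_2 -> 'I_2 -> nat -> A) i j r : A :=
  \sum_a \sum_(k < r.+1) t i a k * t' a j (r - k)%N.

Section Convolution.
Variable A : algType C.
Implicit Types t : 'I_2 -> 'I_2 -> nat -> A.

Lemma mxx_conv t t' : mxx (tconv t t') = mxx t * mxx t'.
Proof.
apply/matrixP => i j; rewrite !mxE; under eq_bigr => a _ do rewrite !mxE /inx -rmorphM.
rewrite -rmorph_sum; congr (pser_const _); apply: pserP => r.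
rewrite (big_morph (fun u : pser A => pcoef u r) (id1 := 0) (op1 := +%R)) //; last by move=> x y; apply: pcoefD.
by apply: eq_bigr => a _; rewrite pcoefM.
Qed.
Lemma mxy_conv t t' : mxy (tconv t t') = mxy t * mxy t'.
Proof.
apply/matrixP => i j; rewrite !mxE; under eq_bigr => a _ do rewrite !mxE.
apply: pserP => s; rewrite (big_morph (fun u : pser (pser A) => pcoef u s) (id1 := 0) (op1 := +%R)) //; last by move=> x y; apply: pcoefD.
rewrite [LHS]rmorph_sum; apply: eq_bigr => a _; rewrite pcoefM [LHS]rmorph_sum.
by apply: eq_bigr => k _; rewrite rmorphM.
Qed.

Lemma ten_conv (M : nzRingType) (R X1 Y1 X2 Y2 : M) :
  R * X1 * Y1 = Y1 * X1 * R -> R * X2 * Y2 = Y2 * X2 * R -> X2 * Y1 = Y1 * X2 -> X1 * Y2 = Y2 * X1 ->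
  R * (X1 * X2) * (Y1 * Y2) = (Y1 * Y2) * (X1 * X2) * R.
Proof.
move=> H1 H2 c1 c2.
transitivity (R * X1 * Y1 * X2 * Y2); first by rewrite -!mulrA (mulrA X2) c1 -mulrA.
rewrite H1; transitivity (Y1 * X1 * (R * X2 * Y2)); first by rewrite !mulrA.
by rewrite H2 !mulrA -(mulrA Y1 X1) c2 mulrA.
Qed.

Lemma iny_inx_comm t t' : (forall i j k l r s, t i j r * t' k l s = t' k l s * t i j r) ->
  ten1 (mxx t) * ten2 (mxy t') = ten2 (mxy t') * ten1 (mxx t).
Proof.
move=> tt; apply: ten12C => i j k l; rewrite !mxE; apply: cf2_inj => r s.
by rewrite cf2_xy cf2_yx.
Qed.

Variables (q : C) (t1 tb1 t2 tb2 : 'I_2 -> 'I_2 -> nat -> A) (ti1 tbi1 ti2 tbi2 : 'I_2 -> A).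
Hypotheses (H1 : Uext_rels q t1 tb1 ti1 tbi1) (H2 : Uext_rels q t2 tb2 ti2 tbi2).
Hypothesis c12 : forall i j k l r s, [/\ t1 i j r * t2 k l s = t2 k l s * t1 i j r,
  t1 i j r * tb2 k l s = tb2 k l s * t1 i j r, tb1 i j r * t2 k l s = t2 k l s * tb1 i j r &
  tb1 i j r * tb2 k l s = tb2 k l s * tb1 i j r].

Lemma tconv0 t t' i j : tconv t t' i j 0%N = t i o1 0%N * t' o1 j 0%N + t i o2 0%N * t' o2 j 0%N.
Proof. by rewrite /tconv sum_o12 !big_ord1 subn0. Qed.

Lemma conv_rels : Uext_rels q (tconv t1 t2) (tconv tb1 tb2)
  (fun i => ti2 i * ti1 i) (fun i => tbi2 i * tbi1 i).
Proof.
case: H1 => u1 b1 d1 v1 r1; case: H2 => u2 b2 d2 v2 r2.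
have T0 i : tconv t1 t2 i i 0%N = t1 i i 0%N * t2 i i 0%N.
  by rewrite tconv0; case: (ord2E i) => ->; rewrite ?u1 ?u2 ?mul0r ?mulr0 ?addr0 ?add0r.
have Tb0 i : tconv tb1 tb2 i i 0%N = tb1 i i 0%N * tb2 i i 0%N.
  by rewrite tconv0; case: (ord2E i) => ->; rewrite ?b1 ?b2 ?mul0r ?mulr0 ?addr0 ?add0r.
have TT : rttTT q (tconv t1 t2) (tconv t1 t2).
  apply/rttTT_P; rewrite mxx_conv mxy_conv ten1M ten2M; apply: ten_conv.
  - by apply/rttTT_P => r s i j k l; case: (r1 r s i j k l).
  - by apply/rttTT_P => r s i j k l; case: (r2 r s i j k l).
  - by apply: iny_inx_comm => i j k l r s; case: (c12 k l i j s r).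
  - by apply: iny_inx_comm => i j k l r s; case: (c12 i j k l r s).
have BB : rttBB q (tconv tb1 tb2) (tconv tb1 tb2).
  apply/rttBB_P; rewrite mxx_conv mxy_conv ten1M ten2M; apply: ten_conv.
  - by apply/rttBB_P => r s i j k l; case: (r1 r s i j k l).
  - by apply/rttBB_P => r s i j k l; case: (r2 r s i j k l).
  - by apply: iny_inx_comm => i j k l r s; case: (c12 k l i j s r).
  - by apply: iny_inx_comm => i j k l r s; case: (c12 i j k l r s).
have BT : rttBT q (tconv tb1 tb2) (tconv t1 t2).
  apply/rttBT_P; rewrite mxx_conv mxy_conv ten1M ten2M; apply: ten_conv.
  - by apply/rttBT_P => r s i j k l; case: (r1 r s i j k l).
  - by apply/rttBT_P => r s i j k l; case: (r2 r s i j k l).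
  - by apply: iny_inx_comm => i j k l r s; case: (c12 k l i j s r).
  - by apply: iny_inx_comm => i j k l r s; case: (c12 i j k l r s).
split.
- by rewrite tconv0 u1 u2 mul0r mulr0 addr0.
- by rewrite tconv0 b1 b2 mul0r mulr0 addr0.
- move=> i; rewrite T0 Tb0; have [_ e1 e2 _] := c12 i i i i 0%N 0%N.
  by rewrite !mulrA -(mulrA (t1 i i 0%N)) -e2 mulrA d1 -mulrA d2 -!mulrA; congr (_ * _); rewrite !mulrA -e1.
- move=> i; have [a1 a2 a3 a4] := v1 i; have [a1' a2' a3' a4'] := v2 i; rewrite T0 Tb0; split.
  + by rewrite -mulrA (mulrA (t2 i i 0%N)) a1' mul1r.
  + by rewrite -mulrA (mulrA (ti1 i)) a2 mul1r.
  + by rewrite -mulrA (mulrA (tb2 i i 0%N)) a3' mul1r.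
  + by rewrite -mulrA (mulrA (tbi1 i)) a4 mul1r.
by move=> r s i j k l; split; [apply: TT|apply: BB|apply: BT].
Qed.
End Convolution.

Lemma hom_rels (A B : algType C) (f : A -> B) q t tb ti tbi : alg_hom f ->
  Uext_rels q t tb ti tbi ->
  Uext_rels q (fun i j r => f (t i j r)) (fun i j r => f (tb i j r)) (fun i => f (ti i)) (fun i => f (tbi i)).
Proof.
move=> [fD fZ fM f1] [u b d v r0].
have f0 : f 0 = 0 by rewrite -(scale0r 0) fZ scale0r.
have fpc g n : pc (fun r => f (g r)) n = f (pc g n) by case: n.
have fS (F : 'I_2 -> A) : \sum_a f (F a) = f (\sum_a F a) by rewrite !sum_o12 fD.
have ent Xa Ya Xb Yb i j k l : rtt_entry q Xa Ya Xb Yb i j k l ->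
   rtt_entry q (fun a b => f (Xa a b)) (fun a b => f (Ya a b)) (fun a b => f (Xb a b)) (fun a b => f (Yb a b)) i j k l.
  move=> /(congr1 f) E; rewrite /rtt_entry.
  transitivity (f (\sum_(a < 2) \sum_(b < 2)
     (Ral q i k a b *: (Xa a j * Ya b l) + Rbe q i k a b *: (Xb a j * Yb b l)))).
    by rewrite -fS; apply: eq_bigr => a _; rewrite -fS; apply: eq_bigr => c _; rewrite fD !fZ !fM.
  rewrite E -fS; apply: eq_bigr => a _; rewrite -fS; apply: eq_bigr => c _; by rewrite fD !fZ !fM.
split; rewrite ?u ?b //.
- by move=> i; rewrite -!fM d.
- by move=> i; rewrite -!fM; case: (v i) => -> -> -> ->.
move=> r s i j k l; have [e1 e2 e3] := r0 r s i j k l.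
have P (g : 'I_2 -> 'I_2 -> nat -> A) n : (fun a b => pc (fun r => f (g a b r)) n) = (fun a b => f (pc (g a b) n)).
  by apply/funext => a; apply/funext => c; apply: fpc.
by split; rewrite !P; apply: ent.
Qed.

Definition weight_vector m (t tb : 'I_2 -> 'I_2 -> nat -> 'M[C]_m.+1) (l lb : 'I_2 -> nat -> C) (xi : 'cV[C]_m.+1) :=
  [/\ xi != 0, forall r, t o1 o2 r *m xi = 0, forall r, tb o1 o2 r *m xi = 0,
      forall i r, t i i r *m xi = l i r *: xi & forall i r, tb i i r *m xi = lb i r *: xi].

Definition has_rep (q : C) (l lb : 'I_2 -> nat -> C) :=
  exists m (t tb : 'I_2 -> 'I_2 -> nat -> 'M[C]_m.+1) (ti tbi : 'I_2 -> 'M[C]_m.+1) (xi : 'cV[C]_m.+1),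
    Uext_rels q t tb ti tbi /\ weight_vector t tb l lb xi.

Section Tensor.
Variable m : nat.
Local Notation B := 'M[C]_(m.+1 + m.+1).
Definition emb1 (x : 'M[C]_m.+1) : B := block_mx x 0 0 x.
Definition emb2 (y : 'M[C]_2) : B := block_mx (y o1 o1)%:M (y o1 o2)%:M (y o2 o1)%:M (y o2 o2)%:M.

Lemma emb1_hom : alg_hom emb1.
Proof.
split=> [x y|c x|x y|].
- by rewrite [RHS](add_block_mx x 0 0 x y 0 0 y) !addr0.
- by rewrite [RHS](scale_block_mx c x 0 0 x) !scaler0.
- by rewrite [RHS](@mulmx_block _ m.+1 m.+1 m.+1 m.+1 m.+1 m.+1 x 0 0 x y 0 0 y) !mulmx0 !mul0mx !addr0 !add0r.
- by rewrite /emb1 -scalar_mx_block.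
Qed.

Lemma emb2_hom : alg_hom emb2.
Proof.
split=> [x y|c x|x y|].
- rewrite [RHS](@add_block_mx _ m.+1 m.+1 m.+1 m.+1 (x o1 o1)%:M (x o1 o2)%:M (x o2 o1)%:M (x o2 o2)%:M
    (y o1 o1)%:M (y o1 o2)%:M (y o2 o1)%:M (y o2 o2)%:M).
  by rewrite /emb2 !mxE !raddfD.
- rewrite [RHS](@scale_block_mx _ m.+1 m.+1 m.+1 m.+1 c (x o1 o1)%:M (x o1 o2)%:M (x o2 o1)%:M (x o2 o2)%:M).
  by rewrite /emb2 !mxE !scale_scalar_mx.
- rewrite [RHS](@mulmx_block _ m.+1 m.+1 m.+1 m.+1 m.+1 m.+1 (x o1 o1)%:M (x o1 o2)%:M (x o2 o1)%:M (x o2 o2)%:M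
    (y o1 o1)%:M (y o1 o2)%:M (y o2 o1)%:M (y o2 o2)%:M).
  by rewrite /emb2 !mxE !sum_o12 !raddfD /= !scalar_mxM.
- by rewrite /emb2 !mxE /= !mulr0n !mulr1n !raddf0 -scalar_mx_block.
Qed.

Lemma emb_comm x y : emb1 x * emb2 y = emb2 y * emb1 x.
Proof.
rewrite [LHS](@mulmx_block _ m.+1 m.+1 m.+1 m.+1 m.+1 m.+1 x 0 0 x (y o1 o1)%:M (y o1 o2)%:M (y o2 o1)%:M (y o2 o2)%:M)
  [RHS](@mulmx_block _ m.+1 m.+1 m.+1 m.+1 m.+1 m.+1 (y o1 o1)%:M (y o1 o2)%:M (y o2 o1)%:M (y o2 o2)%:M x 0 0 x).
by rewrite !mulmx0 !mul0mx !addr0 !add0r !(scalar_mxC _ x).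
Qed.

Lemma emb1_col x (v : 'cV[C]_m.+1) : emb1 x *m col_mx v 0 = col_mx (x *m v) 0.
Proof. by rewrite /emb1 mul_block_col !mulmx0 mul0mx !addr0. Qed.
Lemma emb2_col y (v : 'cV[C]_m.+1) : emb2 y *m col_mx v 0 = col_mx (y o1 o1 *: v) (y o2 o1 *: v).
Proof. by rewrite /emb2 mul_block_col !mulmx0 !addr0 !mul_scalar_mx. Qed.
End Tensor.

Lemma has_rep_tensor q l lb (t2 tb2 : 'I_2 -> 'I_2 -> nat -> 'M[C]_2) ti2 tbi2 (p pb : 'I_2 -> {poly C}) :
  has_rep q l lb -> Uext_rels q t2 tb2 ti2 tbi2 ->
  weight_vector t2 tb2 (fun i r => (p i)`_r) (fun i r => (pb i)`_r) (delta_mx 0 0) ->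
  has_rep q (fun i => smul (l i) (p i)) (fun i => smul (lb i) (pb i)).
Proof.
move=> [m [t1 [tb1 [ti1 [tbi1 [xi [H1 [xi0 A1 A2 A3 A4]]]]]]]] H2 [_ B1 B2 B3 B4].
have G1 := hom_rels (emb1_hom m) H1; have G2 := hom_rels (emb2_hom m) H2.
exists (m + m.+1)%N; do 4 eexists; exists (col_mx xi 0); split.
  apply: (conv_rels G1 G2) => i j k l0 r s; split; exact: emb_comm.
have ent (y : 'M[C]_2) (c : C) : y *m delta_mx 0 0 = c *: (delta_mx 0 0 : 'cV_2) -> y o1 o1 = c /\ y o2 o1 = 0.
  move=> /matrixP E; have := E o1 0; have := E o2 0; rewrite !mxE !sum_o12 !mxE /=.
  by rewrite !mulr1 !mulr0 !addr0 => -> ->.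
have col0 : col_mx 0 0 = 0 :> 'cV[C]_(m.+1 + m.+1) by apply: col_mx0.
have diag (u1 : 'I_2 -> 'I_2 -> nat -> 'M[C]_m.+1) (u2 : 'I_2 -> 'I_2 -> nat -> 'M[C]_2) (w : 'I_2 -> nat -> C) (s : 'I_2 -> {poly C}) :
   (forall r, u1 o1 o2 r *m xi = 0) -> (forall r, u2 o1 o2 r *m delta_mx 0 0 = 0 :> 'cV_2) ->
   (forall i r, u1 i i r *m xi = w i r *: xi) -> (forall i r, u2 i i r *m delta_mx 0 0 = (s i)`_r *: (delta_mx 0 0 : 'cV_2)) ->
   (forall r, tconv (fun i j r => emb1 (u1 i j r)) (fun i j r => emb2 m (u2 i j r)) o1 o2 r *m col_mx xi 0 = 0) /\
   (forall i r, tconv (fun i j r => emb1 (u1 i j r)) (fun i j r => emb2 m (u2 i j r)) i i r *m col_mx xi 0 = smul (w i) (s i) r *: col_mx xi 0).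
  move=> E1 E2 E3 E4.
  have z2 r : u2 o1 o2 r o1 o1 = 0 /\ u2 o1 o2 r o2 o1 = 0 by apply: ent; rewrite E2 scale0r.
  have z i r := ent _ _ (E4 i r).
  have term (x : 'M[C]_m.+1) (y : 'M[C]_2) : (emb1 x * emb2 m y) *m col_mx xi 0 =
      col_mx (y o1 o1 *: (x *m xi)) (y o2 o1 *: (x *m xi)).
    rewrite -[LHS](@mulmxA _ _ _ _ _ (emb1 x) (emb2 m y) (col_mx xi 0)).
    by rewrite emb2_col /emb1 mul_block_col !mul0mx addr0 add0r -!scalemxAr.
  split=> [r|i r]; rewrite /tconv sum_o12 mulmxDl !mulmx_suml.
    rewrite !big1 ?addr0 // => k _; rewrite term.
      by have [-> ->] := z o2 (r - k)%N; rewrite E1 !scaler0 col0.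
    by have [-> ->] := z2 (r - k)%N; rewrite !scale0r col0.
  rewrite /smul /ser_mul scaler_suml.
  case: (ord2E i) => ->; [rewrite [X in _ + X]big1 ?addr0 => [|k _]|rewrite [X in X + _]big1 ?add0r => [|k _]].
  - by apply: eq_bigr => k _; rewrite term; have [-> ->] := z o1 (r - k)%N; rewrite E3 scale0r scale_col_mx scaler0 scalerA mulrC.
  - by rewrite term E1 !scaler0 col0.
  - by apply: eq_bigr => k _; rewrite term; have [-> ->] := z o2 (r - k)%N; rewrite E3 scale0r scale_col_mx scaler0 scalerA mulrC.
  - by rewrite term; have [-> ->] := z2 (r - k)%N; rewrite !scale0r col0.
have [D1 D2] := diag t1 t2 l p A1 B1 A3 B3; have [D3 D4] := diag tb1 tb2 lb pb A2 B2 A4 B4.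
split=> //.
apply: contraNneq xi0 => e; have := congr1 (@usubmx C m.+1 m.+1 1) e.
by rewrite col_mxKu [RHS]linear0 => ->.
Qed.

HB.lock Definition mk2 (x y z w : C) : 'M[C]_2 :=
  \matrix_(i, j) if i == o1 then if j == o1 then x else y else if j == o1 then z else w.

Section EvaluationRep.
Variables (q a : C) (q0 : q != 0) (a0 : a != 0).
Local Notation h := (q^-1 - q).

Lemma sum_R (M : lmodType C) (F G : 'I_2 -> 'I_2 -> M) i k :
  \sum_(a < 2) \sum_(b < 2) (Ral q i k a b *: F a b + Rbe q i k a b *: G a b) =
  if i == k then q^-1 *: F i k - q *: G i k
  else F i k - G i k + (if i == o1 then h *: G k i else h *: F k i).
Proof.
rewrite !sum_o12 /Ral /Rbe.
by case: (ord2E i) (ord2E k) => -> [] ->; rewrite /= ?(scale0r, scaleNr, scale1r, scaleN1r, addr0, add0r) //; rewrite [LHS]addrC.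
Qed.
Lemma sum_Rr (M : lmodType C) (F G : 'I_2 -> 'I_2 -> M) j l :
  \sum_(a < 2) \sum_(b < 2) (Ral q a b j l *: F a b + Rbe q a b j l *: G a b) =
  if j == l then q^-1 *: F j l - q *: G j l
  else F j l - G j l + (if j == o1 then h *: F l j else h *: G l j).
Proof.
rewrite !sum_o12 /Ral /Rbe.
by case: (ord2E j) (ord2E l) => -> [] ->; rewrite /= ?(scale0r, scaleNr, scale1r, scaleN1r, addr0, add0r) //; rewrite [LHS]addrC.
Qed.

Lemma rtt_entryE (B : algType C) (Xa Ya Xb Yb : 'I_2 -> 'I_2 -> B) i j k l : rtt_entry q Xa Ya Xb Yb i j k l <->
  (if i == k then q^-1 *: (Xa i j * Ya k l) - q *: (Xb i j * Yb k l)
   else Xa i j * Ya k l - Xb i j * Yb k l + (if i == o1 then h *: (Xb k j * Yb i l) else h *: (Xa k j * Ya i l))) =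
  (if j == l then q^-1 *: (Ya k l * Xa i j) - q *: (Yb k l * Xb i j)
   else Ya k l * Xa i j - Yb k l * Xb i j + (if j == o1 then h *: (Ya k j * Xa i l) else h *: (Yb k j * Xb i l))).
Proof. by rewrite /rtt_entry sum_R sum_Rr. Qed.

Lemma rtt_entry_all (B : algType C) (Xa Ya Xb Yb : 'I_2 -> 'I_2 -> B) :
  q^-1 *: (Xa o1 o1 * Ya o1 o1) - q *: (Xb o1 o1 * Yb o1 o1) = q^-1 *: (Ya o1 o1 * Xa o1 o1) - q *: (Yb o1 o1 * Xb o1 o1) ->
  q^-1 *: (Xa o1 o1 * Ya o1 o2) - q *: (Xb o1 o1 * Yb o1 o2) = Ya o1 o2 * Xa o1 o1 - Yb o1 o2 * Xb o1 o1 + h *: (Ya o1 o1 * Xa o1 o2) ->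
  Xa o1 o1 * Ya o2 o1 - Xb o1 o1 * Yb o2 o1 + h *: (Xb o2 o1 * Yb o1 o1) = q^-1 *: (Ya o2 o1 * Xa o1 o1) - q *: (Yb o2 o1 * Xb o1 o1) ->
  Xa o1 o1 * Ya o2 o2 - Xb o1 o1 * Yb o2 o2 + h *: (Xb o2 o1 * Yb o1 o2) = Ya o2 o2 * Xa o1 o1 - Yb o2 o2 * Xb o1 o1 + h *: (Ya o2 o1 * Xa o1 o2) ->
  q^-1 *: (Xa o1 o2 * Ya o1 o1) - q *: (Xb o1 o2 * Yb o1 o1) = Ya o1 o1 * Xa o1 o2 - Yb o1 o1 * Xb o1 o2 + h *: (Yb o1 o2 * Xb o1 o1) ->
  q^-1 *: (Xa o1 o2 * Ya o1 o2) - q *: (Xb o1 o2 * Yb o1 o2) = q^-1 *: (Ya o1 o2 * Xa o1 o2) - q *: (Yb o1 o2 * Xb o1 o2) ->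
  Xa o1 o2 * Ya o2 o1 - Xb o1 o2 * Yb o2 o1 + h *: (Xb o2 o2 * Yb o1 o1) = Ya o2 o1 * Xa o1 o2 - Yb o2 o1 * Xb o1 o2 + h *: (Yb o2 o2 * Xb o1 o1) ->
  Xa o1 o2 * Ya o2 o2 - Xb o1 o2 * Yb o2 o2 + h *: (Xb o2 o2 * Yb o1 o2) = q^-1 *: (Ya o2 o2 * Xa o1 o2) - q *: (Yb o2 o2 * Xb o1 o2) ->
  Xa o2 o1 * Ya o1 o1 - Xb o2 o1 * Yb o1 o1 + h *: (Xa o1 o1 * Ya o2 o1) = q^-1 *: (Ya o1 o1 * Xa o2 o1) - q *: (Yb o1 o1 * Xb o2 o1) ->
  Xa o2 o1 * Ya o1 o2 - Xb o2 o1 * Yb o1 o2 + h *: (Xa o1 o1 * Ya o2 o2) = Ya o1 o2 * Xa o2 o1 - Yb o1 o2 * Xb o2 o1 + h *: (Ya o1 o1 * Xa o2 o2) ->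
  q^-1 *: (Xa o2 o1 * Ya o2 o1) - q *: (Xb o2 o1 * Yb o2 o1) = q^-1 *: (Ya o2 o1 * Xa o2 o1) - q *: (Yb o2 o1 * Xb o2 o1) ->
  q^-1 *: (Xa o2 o1 * Ya o2 o2) - q *: (Xb o2 o1 * Yb o2 o2) = Ya o2 o2 * Xa o2 o1 - Yb o2 o2 * Xb o2 o1 + h *: (Ya o2 o1 * Xa o2 o2) ->
  Xa o2 o2 * Ya o1 o1 - Xb o2 o2 * Yb o1 o1 + h *: (Xa o1 o2 * Ya o2 o1) = Ya o1 o1 * Xa o2 o2 - Yb o1 o1 * Xb o2 o2 + h *: (Yb o1 o2 * Xb o2 o1) ->
  Xa o2 o2 * Ya o1 o2 - Xb o2 o2 * Yb o1 o2 + h *: (Xa o1 o2 * Ya o2 o2) = q^-1 *: (Ya o1 o2 * Xa o2 o2) - q *: (Yb o1 o2 * Xb o2 o2) ->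
  q^-1 *: (Xa o2 o2 * Ya o2 o1) - q *: (Xb o2 o2 * Yb o2 o1) = Ya o2 o1 * Xa o2 o2 - Yb o2 o1 * Xb o2 o2 + h *: (Yb o2 o2 * Xb o2 o1) ->
  q^-1 *: (Xa o2 o2 * Ya o2 o2) - q *: (Xb o2 o2 * Yb o2 o2) = q^-1 *: (Ya o2 o2 * Xa o2 o2) - q *: (Yb o2 o2 * Xb o2 o2) ->
  forall i j k l, rtt_entry q Xa Ya Xb Yb i j k l.
Proof.
move=> e1 e2 e3 e4 e5 e6 e7 e8 e9 e10 e11 e12 e13 e14 e15 e16 i j k l; apply/rtt_entryE.
by  case: (ord2E i) (ord2E j) (ord2E k) (ord2E l) => -> [] -> [] -> [] ->.
Qed.

Lemma mk2M x y z w x' y' z' w' : mk2 x y z w * mk2 x' y' z' w' =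
  mk2 (x * x' + y * z') (x * y' + y * w') (z * x' + w * z') (z * y' + w * w').
Proof.
rewrite mk2.unlock; apply/matrixP => i j; rewrite !mxE sum_o12 !mxE.
by case: (ord2E i) (ord2E j) => -> [] ->.
Qed.
Lemma mk2D x y z w x' y' z' w' : mk2 x y z w + mk2 x' y' z' w' = mk2 (x + x') (y + y') (z + z') (w + w').
Proof.
rewrite mk2.unlock; apply/matrixP => i j; rewrite !mxE.
by case: (ord2E i) (ord2E j) => -> [] ->.
Qed.
Lemma mk2N x y z w : - mk2 x y z w = mk2 (- x) (- y) (- z) (- w).
Proof.
rewrite mk2.unlock; apply/matrixP => i j; rewrite !mxE.
by case: (ord2E i) (ord2E j) => -> [] ->.
Qed.
Lemma mk2Z c x y z w : c *: mk2 x y z w = mk2 (c * x) (c * y) (c * z) (c * w).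
Proof.
rewrite mk2.unlock; apply/matrixP => i j; rewrite !mxE.
by case: (ord2E i) (ord2E j) => -> [] ->.
Qed.
Lemma mk2_0 : 0 = mk2 0 0 0 0.
Proof.
rewrite mk2.unlock; apply/matrixP => i j; rewrite !mxE.
by case: (ord2E i) (ord2E j) => -> [] ->.
Qed.

Definition ev0 (i j : 'I_2) := if i == o1 then if j == o1 then mk2 q 0 0 1 else mk2 0 0 0 0
  else if j == o1 then mk2 0 0 h 0 else mk2 1 0 0 q.
Definition evb0 (i j : 'I_2) := if i == o1 then if j == o1 then mk2 q^-1 0 0 1 else mk2 0 (- h) 0 0
  else if j == o1 then mk2 0 0 0 0 else mk2 1 0 0 q^-1.
Definition evt (i j : 'I_2) (r : nat) : 'M[C]_2 :=
  match r with 0%N => ev0 i j | 1%N => (- a) *: evb0 i j | _ => 0 end.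
Definition evtb (i j : 'I_2) (r : nat) : 'M[C]_2 :=
  match r with 0%N => evb0 i j | 1%N => (- a^-1) *: ev0 i j | _ => 0 end.

Let T11 : ev0 o1 o1 = mk2 q 0 0 1. Proof. by []. Qed.
Let T12 : ev0 o1 o2 = mk2 0 0 0 0. Proof. by []. Qed.
Let T21 : ev0 o2 o1 = mk2 0 0 h 0. Proof. by []. Qed.
Let T22 : ev0 o2 o2 = mk2 1 0 0 q. Proof. by []. Qed.
Let S11 : evb0 o1 o1 = mk2 q^-1 0 0 1. Proof. by []. Qed.
Let S12 : evb0 o1 o2 = mk2 0 (- h) 0 0. Proof. by []. Qed.
Let S21 : evb0 o2 o1 = mk2 0 0 0 0. Proof. by []. Qed.
Let S22 : evb0 o2 o2 = mk2 1 0 0 q^-1. Proof. by []. Qed.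
Ltac entry := rewrite ?(T11, T12, T21, T22, S11, S12, S21, S22) ?mk2_0 ?mk2M ?mk2Z ?mk2N ?mk2D.

Local Notation Z := (fun _ _ : 'I_2 => 0 : 'M[C]_2).
Lemma ev_TT1 i j k l : rtt_entry q ev0 ev0 Z Z i j k l.
Proof. by apply: rtt_entry_all; cbv beta; entry; congr (mk2 _ _ _ _); field; rewrite ?q0. Qed.
Lemma ev_TT2 i j k l : rtt_entry q Z Z ev0 ev0 i j k l.
Proof. by apply: rtt_entry_all; cbv beta; entry; congr (mk2 _ _ _ _); field; rewrite ?q0. Qed.
Lemma ev_SS1 i j k l : rtt_entry q evb0 evb0 Z Z i j k l.
Proof. by apply: rtt_entry_all; cbv beta; entry; congr (mk2 _ _ _ _); field; rewrite ?q0. Qed.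
Lemma ev_SS2 i j k l : rtt_entry q Z Z evb0 evb0 i j k l.
Proof. by apply: rtt_entry_all; cbv beta; entry; congr (mk2 _ _ _ _); field; rewrite ?q0. Qed.
Lemma ev_TS1 i j k l : rtt_entry q ev0 evb0 Z Z i j k l.
Proof. by apply: rtt_entry_all; cbv beta; entry; congr (mk2 _ _ _ _); field; rewrite ?q0. Qed.
Lemma ev_ST2 i j k l : rtt_entry q Z Z evb0 ev0 i j k l.
Proof. by apply: rtt_entry_all; cbv beta; entry; congr (mk2 _ _ _ _); field; rewrite ?q0. Qed.
Lemma ev_ST i j k l : rtt_entry q evb0 ev0 ev0 evb0 i j k l.
Proof. by apply: rtt_entry_all; cbv beta; entry; congr (mk2 _ _ _ _); field; rewrite ?q0. Qed.

Lemma rtt_entry_scale (B : algType C) (c : C) (Xa Ya Xb Yb Xa' Ya' Xb' Yb' : 'I_2 -> 'I_2 -> B) i j k l :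
  (forall a b a' b', Xa' a b * Ya' a' b' = c *: (Xa a b * Ya a' b')) ->
  (forall a b a' b', Ya' a b * Xa' a' b' = c *: (Ya a b * Xa a' b')) ->
  (forall a b a' b', Xb' a b * Yb' a' b' = c *: (Xb a b * Yb a' b')) ->
  (forall a b a' b', Yb' a b * Xb' a' b' = c *: (Yb a b * Xb a' b')) ->
  rtt_entry q Xa Ya Xb Yb i j k l -> rtt_entry q Xa' Ya' Xb' Yb' i j k l.
Proof.
move=> Ea Ea' Eb Eb' /(congr1 (fun x => c *: x)); rewrite /rtt_entry !scaler_sumr => E.
transitivity (\sum_a c *: \sum_b (Ral q i k a b *: (Xa a j * Ya b l) + Rbe q i k a b *: (Xb a j * Yb b l))).
  apply: eq_bigr => x _; rewrite scaler_sumr; apply: eq_bigr => y _.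
  by rewrite Ea Eb scalerDr !scalerA !(mulrC c).
rewrite E; apply: eq_bigr => x _; rewrite scaler_sumr; apply: eq_bigr => y _.
by rewrite Ea' Eb' scalerDr !scalerA !(mulrC c).
Qed.

Let ba : - a^-1 * - a = 1. Proof. by rewrite mulrNN mulVf. Qed.
Let ab : - a * - a^-1 = 1. Proof. by rewrite mulrNN mulfV. Qed.
Ltac prods := move=> ? ? ? ?; rewrite /evt /evtb /pc ?(mul0r, mulr0, scaler0) -?scalerAl -?scalerAr ?scalerA ?ba ?ab ?scale1r ?scale0r.
Lemma ev_tt : rttTT q evt evt.
Proof.
move=> [|[|[|r]]] [|[|[|s]]] i j k l.
- by apply: (rtt_entry_scale (c := 0)) (ev_TT1 i j k l); prods.
- by apply: (rtt_entry_scale (c := 1)) (ev_TT1 i j k l); prods.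
- by apply: (rtt_entry_scale (c := (- a))) (ev_TS1 i j k l); prods.
- by apply: (rtt_entry_scale (c := 0)) (ev_TT1 i j k l); prods.
- by apply: (rtt_entry_scale (c := 1)) (ev_TT2 i j k l); prods.
- by apply: (rtt_entry_scale (c := (- a))) (ev_ST i j k l); prods.
- by apply: (rtt_entry_scale (c := (- a * - a))) (ev_SS1 i j k l); prods.
- by apply: (rtt_entry_scale (c := 0)) (ev_TT1 i j k l); prods.
- by apply: (rtt_entry_scale (c := (- a))) (ev_ST2 i j k l); prods.
- by apply: (rtt_entry_scale (c := (- a * - a))) (ev_SS2 i j k l); prods.
- by apply: (rtt_entry_scale (c := 0)) (ev_TT1 i j k l); prods.
- by apply: (rtt_entry_scale (c := 0)) (ev_TT1 i j k l); prods.
- by apply: (rtt_entry_scale (c := 0)) (ev_TT1 i j k l); prods.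
- by apply: (rtt_entry_scale (c := 0)) (ev_TT1 i j k l); prods.
- by apply: (rtt_entry_scale (c := 0)) (ev_TT1 i j k l); prods.
- by apply: (rtt_entry_scale (c := 0)) (ev_TT1 i j k l); prods.
Qed.
Lemma ev_bb : rttBB q evtb evtb.
Proof.
move=> [|[|[|r]]] [|[|[|s]]] i j k l.
- by apply: (rtt_entry_scale (c := 0)) (ev_TT1 i j k l); prods.
- by apply: (rtt_entry_scale (c := 1)) (ev_SS2 i j k l); prods.
- by apply: (rtt_entry_scale (c := (- a^-1))) (ev_ST2 i j k l); prods.
- by apply: (rtt_entry_scale (c := 0)) (ev_TT1 i j k l); prods.
- by apply: (rtt_entry_scale (c := 1)) (ev_SS1 i j k l); prods.
- by apply: (rtt_entry_scale (c := (- a^-1))) (ev_ST i j k l); prods.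
- by apply: (rtt_entry_scale (c := (- a^-1 * - a^-1))) (ev_TT2 i j k l); prods.
- by apply: (rtt_entry_scale (c := 0)) (ev_TT1 i j k l); prods.
- by apply: (rtt_entry_scale (c := (- a^-1))) (ev_TS1 i j k l); prods.
- by apply: (rtt_entry_scale (c := (- a^-1 * - a^-1))) (ev_TT1 i j k l); prods.
- by apply: (rtt_entry_scale (c := 0)) (ev_TT1 i j k l); prods.
- by apply: (rtt_entry_scale (c := 0)) (ev_TT1 i j k l); prods.
- by apply: (rtt_entry_scale (c := 0)) (ev_TT1 i j k l); prods.
- by apply: (rtt_entry_scale (c := 0)) (ev_TT1 i j k l); prods.
- by apply: (rtt_entry_scale (c := 0)) (ev_TT1 i j k l); prods.
- by apply: (rtt_entry_scale (c := 0)) (ev_TT1 i j k l); prods.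
Qed.
Lemma ev_bt : rttBT q evtb evt.
Proof.
move=> [|[|[|r]]] [|[|[|s]]] i j k l.
- by apply: (rtt_entry_scale (c := 1)) (ev_ST2 i j k l); prods.
- by apply: (rtt_entry_scale (c := (- a))) (ev_SS2 i j k l); prods.
- by apply: (rtt_entry_scale (c := 0)) (ev_TT1 i j k l); prods.
- by apply: (rtt_entry_scale (c := 0)) (ev_TT1 i j k l); prods.
- by apply: (rtt_entry_scale (c := (- a^-1))) (ev_TT2 i j k l); prods.
- by apply: (rtt_entry_scale (c := 1)) (ev_ST i j k l); prods.
- by apply: (rtt_entry_scale (c := (- a))) (ev_SS1 i j k l); prods.
- by apply: (rtt_entry_scale (c := 0)) (ev_TT1 i j k l); prods.
- by apply: (rtt_entry_scale (c := 0)) (ev_TT1 i j k l); prods.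
- by apply: (rtt_entry_scale (c := (- a^-1))) (ev_TT1 i j k l); prods.
- by apply: (rtt_entry_scale (c := 1)) (ev_TS1 i j k l); prods.
- by apply: (rtt_entry_scale (c := 0)) (ev_TT1 i j k l); prods.
- by apply: (rtt_entry_scale (c := 0)) (ev_TT1 i j k l); prods.
- by apply: (rtt_entry_scale (c := 0)) (ev_TT1 i j k l); prods.
- by apply: (rtt_entry_scale (c := 0)) (ev_TT1 i j k l); prods.
- by apply: (rtt_entry_scale (c := 0)) (ev_TT1 i j k l); prods.
Qed.

Lemma ev_rels : Uext_rels q evt evtb (fun i => if i == o1 then mk2 q^-1 0 0 1 else mk2 1 0 0 q^-1)
  (fun i => if i == o1 then mk2 q 0 0 1 else mk2 1 0 0 q).
Proof.
have mk1 : 1 = mk2 1 0 0 1.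
  rewrite mk2.unlock; apply/matrixP => i j; rewrite !mxE.
  by case: (ord2E i) (ord2E j) => -> [] ->.
split.
- by rewrite /evt T12 -mk2_0.
- by rewrite /evtb S21 -mk2_0.
- by move=> i; rewrite /evt /evtb; case: (ord2E i) => ->; rewrite ?(T11, T22, S11, S22) !mk2M; congr (mk2 _ _ _ _); ring.
- move=> i; rewrite /evt /evtb mk1; case: (ord2E i) => ->; rewrite ?(T11, T22, S11, S22) ?(o11, o21) !mk2M.
    by split; congr (mk2 _ _ _ _); field.
  by split; congr (mk2 _ _ _ _); field.
by move=> r s i j k l; split; [apply: ev_tt|apply: ev_bb|apply: ev_bt].
Qed.
Definition evw (i : 'I_2) : {poly C} := if i == o1 then q%:P - (a / q) *: 'X else 1 - a *: 'X.
Definition evwb (i : 'I_2) : {poly C} := if i == o1 then q^-1%:P - (a^-1 * q) *: 'X else 1 - a^-1 *: 'X.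

Let mk2_e x y z w : mk2 x y z w *m delta_mx 0 0 = x *: delta_mx 0 0 + z *: delta_mx o2 0 :> 'cV_2.
Proof.
rewrite mk2.unlock; apply/matrixP => i j; rewrite !mxE sum_o12 !mxE (ord1 j).
by case: (ord2E i) => ->; rewrite ?(o11, o12, o21, o22) /= !(mulr0, mulr1, addr0, add0r).
Qed.

Lemma ev_weight : weight_vector evt evtb (fun i r => (evw i)`_r) (fun i r => (evwb i)`_r) (delta_mx 0 0).
Proof.
have d0 : (delta_mx 0 0 : 'cV[C]_2) != 0.
  by apply/eqP => /matrixP/(_ 0 0)/eqP; rewrite !mxE /= oner_eq0.
have lin (x y : C) r : (x%:P - y *: 'X)`_r = match r with 0%N => x | 1%N => - y | _ => 0 end.
  by rewrite coefB coefC coefZ coefX; case: r => [|[|r]] /=; rewrite ?(mulr0n, mulr1n) ?(mulr0, mulr1, subr0, sub0r, oppr0, addr0).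
split=> //.
- by case=> [|[|r]]; rewrite /evt ?T12 ?mk2Z ?mk2_e ?mul0mx ?(mulr0, mul0r) ?scale0r ?addr0.
- by case=> [|[|r]]; rewrite /evtb ?T12 ?S12 ?mk2Z ?mk2_e ?mul0mx ?(mulr0, mul0r) ?scale0r ?addr0.
- move=> i r; rewrite /evw; case: (ord2E i) => ->; rewrite ?(o11, o21) -?polyC1 lin /evt; case: r => [|[|r]];
  rewrite ?(T11, T22, S11, S22) ?mk2Z ?mk2_e ?mul0mx ?scale0r // ?mulr0 ?scale0r ?addr0 ?mulr1 ?mulNr //.
- move=> i r; rewrite /evwb; case: (ord2E i) => ->; rewrite ?(o11, o21) -?polyC1 lin /evtb; case: r => [|[|r]];
  rewrite ?(T11, T22, S11, S22) ?mk2Z ?mk2_e ?mul0mx ?scale0r // ?mulr0 ?scale0r ?addr0 ?mulr1 ?mulNr //.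
Qed.
End EvaluationRep.

Lemma smulM f (p r : {poly C}) k : smul (smul f p) r k = smul f (p * r) k.
Proof.
elim/poly_ind: r k => [|r c IH] k; first by rewrite mulr0 !smul0.
rewrite smulD mulrDr mulrA smulD !smulX; congr (_ + _); first by case: k.
by rewrite -alg_polyC -scalerAr mulr1 !smulZ smul1.
Qed.

Lemma smul_delta (p : {poly C}) k : smul (fun r => (r == 0%N)%:R) p k = p`_k.
Proof.
rewrite /smul /ser_mul big_ord_recl eqxx mul1r subn0 big1 ?addr0 // => i _.
by rewrite mul0r.
Qed.

Lemma rtt_entry_scalar q (B : algType C) (xa ya xb yb : B) i j k l :
  xa * ya = ya * xa -> xb * yb = yb * xb ->
  rtt_entry q (fun a b => if a == b then xa else 0) (fun a b => if a == b then ya else 0)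
    (fun a b => if a == b then xb else 0) (fun a b => if a == b then yb else 0) i j k l.
Proof.
move=> Ea Eb; have dl (x y : B) (i' j' k' l' : 'I_2) : (if i' == j' then x else 0) * (if k' == l' then y else 0) =
    if (i' == j') && (k' == l') then x * y else 0.
  by case: eqP => _; case: eqP => _; rewrite ?mul0r ?mulr0.
rewrite /rtt_entry (bigD1 j) //= (bigD1 l) //= !eqxx big1 => [|b bl]; last first.
  by rewrite (negPf bl) !mulr0 !scaler0 addr0.
rewrite big1 => [|a aj]; last by rewrite big1 // => b _; rewrite (negPf aj) !mul0r !scaler0 addr0.
rewrite [RHS](bigD1 i) //= (bigD1 k) //= !eqxx big1 => [|b bl]; last first.
  by rewrite eq_sym (negPf bl) !mul0r !scaler0 addr0.
rewrite big1 => [|a aj]; last by rewrite big1 // => b _; rewrite (eq_sym i) (negPf aj) !mulr0 !scaler0 addr0.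
by rewrite !addr0 Ea Eb.
Qed.

Lemma has_rep_scalar q (f : nat -> C) : f 0%N != 0 ->
  has_rep q (fun=> f) (fun _ r => (r == 0%N)%:R).
Proof.
move=> f0; pose sc (g : nat -> C) (i j : 'I_2) r : 'M[C]_1 := if i == j then (g r)%:M else 0.
pose dl r : C := (r == 0%N)%:R.
exists 0%N, (sc f), (sc dl), (fun=> (f 0%N)^-1%:M), (fun=> 1%:M), 1%:M.
have E g r : (fun a b => sc g a b r) = (fun a b : 'I_2 => if a == b then (g r)%:M else 0) by [].
have Ep g r : (fun a b => pc (sc g a b) r) =
    (fun a b : 'I_2 => if a == b then (if r is s.+1 then (g s)%:M else 0) else 0).
  by apply/funext => a; apply/funext => b; case: r => [|r]; rewrite /sc //=; case: eqP.
have cm (x y : 'M[C]_1) : x * y = y * x by rewrite [x]mx11_scalar [y]mx11_scalar -[LHS]scalar_mxM mulrC scalar_mxM.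
split.
  split=> //.
  - by move=> i; rewrite /sc eqxx; split; rewrite -[LHS]scalar_mxM ?mulfV ?mulVf ?mul1r.
  - by move=> r s i j k l; split; rewrite ?E !Ep; apply: rtt_entry_scalar.
split.
- by apply/eqP => /matrixP/(_ 0 0)/eqP; rewrite !mxE eqxx oner_eq0.
- by move=> r; rewrite /sc mul0mx.
- by move=> r; rewrite /sc mul0mx.
- by move=> i r; rewrite /sc eqxx mul_scalar_mx.
- by move=> i r; rewrite /sc eqxx mul_scalar_mx.
Qed.

Lemma has_rep_prod q (f : nat -> C) (s : seq C) : q != 0 -> f 0%N != 0 -> all (fun a => a != 0) s ->
  has_rep q (fun i => smul f (\prod_(a <- s) evw q a i)) (fun i r => (\prod_(a <- s) evwb q a i)`_r).
Proof.
move=> q0 f0; elim: s => [_|a s IH /= /andP[a0 s0]].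
  have := has_rep_scalar q f0; congr has_rep.
    by apply/funext => i; apply/funext => r; rewrite big_nil smul1.
  by apply/funext => i; apply/funext => r; rewrite big_nil coef1.
have := has_rep_tensor (IH s0) (@ev_rels q a q0 a0) (@ev_weight q a); congr has_rep.
  by apply/funext => i; apply/funext => r; rewrite smulM big_cons mulrC.
apply/funext => i; apply/funext => r; rewrite big_cons mulrC -!smul_delta -smulM; congr smul.
by apply/funext => k; rewrite smul_delta.
Qed.

Section FromRep.
Variables (q : C) (q0 : q != 0) (A : algType C) (t tb : 'I_2 -> 'I_2 -> nat -> A) (ti tbi : 'I_2 -> A).
Hypothesis HU : is_Uext q t tb ti tbi.
Local Notation S := (s_coef q t tb).
Local Notation D := (sb_coef q t tb o2 o1).
Local Notation Y := (Yq q t tb ti tbi).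

Lemma rep_hom (l lb : 'I_2 -> nat -> C) : has_rep q l lb ->
  exists m (rho : A -> 'M[C]_m.+1) (xi : 'cV[C]_m.+1),
  [/\ alg_hom rho, xi != 0, forall r, rho (S o1 o1 r) *m xi = 0,
      forall r, rho (S o2 o1 r) *m xi = - ser_mul (l o2) (lb o1) r *: xi &
      forall r, rho (D r) *m xi = - ser_mul (lb o2) (l o1) r *: xi].
Proof.
move=> [m [t1 [tb1 [ti1 [tbi1 [xi [H1 [xi0 A1 A2 A3 A4]]]]]]]].
have [f [fh ft _ _]] := HU.2 _ _ _ _ _ H1.
exists m, f, xi; have [fD fZ fM f1] := fh.
have f0 : f 0 = 0 by rewrite -(scale0r 0) fZ scale0r.
have fS n (F : 'I_n -> A) : f (\sum_a F a) *m xi = \sum_a (f (F a) *m xi).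
  elim: n F => [|n IH] F; first by rewrite !big_ord0 f0 mul0mx.
  by rewrite !big_ord_recl fD mulmxDl IH.
have fB x y : f (x - y) *m xi = f x *m xi - f y *m xi.
  by rewrite fD -scaleN1r fZ mulmxDl scaleN1r mulNmx.
have ftt i j r : f (t i j r) = t1 i j r by case: (ft i j r).
have ftb i j r : f (tb i j r) = tb1 i j r by case: (ft i j r).
have mm (x y : 'M[C]_m.+1) : (x * y) *m xi = x *m (y *m xi) by apply/esym/mulmxA.
split=> //.
- move=> r; rewrite /s_coef fS big1 // => a _.
  by rewrite fB fZ !fM !ftt !ftb -scalemxAl !mm A2 A4 mulmx0 scaler0 -scalemxAr A1 scaler0 subr0.
- move=> r; rewrite /s_coef fS /ser_mul -sumrN scaler_suml; apply: eq_bigr => a _.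
  rewrite fB fZ !fM !ftt !ftb -scalemxAl !mm A2 A4 mulmx0 scaler0 sub0r -scalemxAr A3 scalerA.
  by rewrite mulrC scaleNr.
move=> r; rewrite /sb_coef fS /ser_mul -sumrN scaler_suml; apply: eq_bigr => a _.
rewrite fB fZ !fM !ftt !ftb -scalemxAl !mm A1 A3 mulmx0 scaler0 sub0r -scalemxAr A4 scalerA.
by rewrite mulrC scaleNr.
Qed.

Lemma finite_spanning_mod m (ev : A -> 'rV[C]_m) (Y0 : A -> Prop) : subspace Y0 ->
  (forall x y, ev (x + y) = ev x + ev y) -> (forall (c : C) x, ev (c *: x) = c *: ev x) ->
  exists n (v : 'I_n -> A), (forall k, Y0 (v k)) /\
    forall y, Y0 y -> exists c : 'I_n -> C, ev (y - \sum_k c k *: v k) = 0.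
Proof.
move=> sY evD evZ; pose Mx n (v : 'I_n -> A) : 'M[C]_(n, m) := \matrix_(i, j) ev (v i) 0 j.
pose P r := `[< exists n (v : 'I_n -> A), (forall k, Y0 (v k)) /\ \rank (Mx n v) = r >].
have exP : exists r, P r.
  exists (\rank (Mx 0%N (fun=> 0))); apply/asboolP; exists 0%N, (fun=> 0); split=> // k.
  exact: (sub0 sY).
have Pb r : P r -> (r <= m)%N by move=> /asboolP[n [v [_ <-]]]; apply: rank_leq_col.
case: (ex_maxnP exP Pb) => r /asboolP[n [v [Yv rk]]] rmax; exists n, v; split=> // y Yy.
pose v' (i : 'I_(n + 1)) := match split i with inl j => v j | inr _ => y end.
have Mv' : Mx _ v' = col_mx (Mx n v) (ev y).
  apply/matrixP => i j; rewrite !mxE /v'; case: split => k; rewrite ?mxE //.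
  by rewrite (ord1 k).
have rk' : (\rank (Mx _ v') <= r)%N.
  apply: rmax; apply/asboolP; exists (n + 1)%N, v'; split=> // i; rewrite /v'.
  by case: split.
have sub : (ev y <= Mx n v)%MS.
  have le : (Mx n v <= Mx _ v')%MS by rewrite Mv' -addsmxE addsmxSl.
  have e : \rank (Mx n v) = \rank (Mx _ v').
    by apply/eqP; rewrite eqn_leq (mxrankS le) rk rk'.
  have [_] := mxrank_leqif_sup le; rewrite e eqxx => /esym BA; apply: submx_trans BA.
  by rewrite Mv' -addsmxE addsmxSr.
have [c cE] := submxP sub; exists (fun k => c 0 k).
have ev0 : ev 0 = 0 by rewrite -(scale0r 0) evZ scale0r.
have evS k (F : 'I_k -> A) : ev (\sum_a F a) = \sum_a ev (F a).
  by elim: k F => [|k IH] F; rewrite ?big_ord0 // !big_ord_recl evD IH.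
rewrite evD -scaleN1r evZ scaleN1r evS cE; apply/eqP; rewrite subr_eq0; apply/eqP/matrixP => i j.
rewrite (ord1 i) !mxE summxE; apply: eq_bigr => k _; by rewrite evZ !mxE.
Qed.

Variables (mu mub : nat -> C).
Local Notation I := (verma_ideal q t tb ti tbi mu mub).

Lemma rep_findim (l lb : 'I_2 -> nat -> C) : has_rep q l lb ->
  (forall r, mu r = - ser_mul (l o2) (lb o1) r) -> (forall r, mub r = - ser_mul (lb o2) (l o1) r) ->
  V_findim q t tb ti tbi mu mub.
Proof.
move=> hr muE mubE; have [m [rho [xi [[fD fZ fM f1] xi0 hC hA hD]]]] := rep_hom hr.
have HR := HU.1; pose N y := Y y /\ rho y *m xi = 0.
have f0 : rho 0 = 0 by rewrite -(scale0r 0) fZ scale0r.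
have mm (x y : 'M[C]_m.+1) : (x * y) *m xi = x *m (y *m xi) by apply/esym/mulmxA.
have sY := Yq_subspace q t tb ti tbi.
have Nleft : left_ideal Y N.
  split.
  - by move=> x [].
  - by split; [exact: (sub0 sY)|rewrite f0 mul0mx].
  - by move=> x y [Yx ex] [Yy ey]; split; [exact: (subD sY)|rewrite fD mulmxDl ex ey addr0].
  - by move=> y x Yy [Yx ex]; split; [exact: YqM|rewrite fM mm ex mulmx0].
have hB x c : rho x *m xi = c *: xi -> rho (x - c *: 1) *m xi = 0.
  by move=> E; rewrite fD -scaleN1r !fZ f1 mulmxDl E scaleN1r mulNmx -scalemxAl mul1mx subrr.
have Nprop : Defs.proper_sub q t tb ti tbi mu mub N.
  split=> //.
    move=> x; apply=> // r.
    - by split; [exact: Yq_s|exact: hC].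
    - split; first by apply: (subB sY); [exact: Yq_s|apply: (subZ sY); exact: Yq1].
      by apply: hB; rewrite hA muE.
    - split; first by apply: (subB sY); [exact: (Yq_sb q0 HR)|apply: (subZ sY); exact: Yq1].
      by apply: hB; rewrite hD mubE.
  by move=> [_]; rewrite f1 mul1mx => /eqP; rewrite (negPf xi0).
have [||n [v [Yv Hv]]] := @finite_spanning_mod _ (fun y => (rho y *m xi)^T) Y sY.
- by move=> x y; rewrite fD mulmxDl linearD.
- by move=> c x; rewrite fZ -scalemxAl linearZ.
exists n, v; split=> // y Yy; have [c Hc] := Hv y Yy; exists c.
move=> S0 _ _ HS; apply: (HS N Nprop); split.
  by apply: (subB sY) => //; apply: (sub_sum sY) => k _; apply: (subZ sY).
by apply: trmx_inj; rewrite Hc trmx0.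
Qed.
End FromRep.

(* When the Verma module vanishes, [max_sub] reduces to 0, so that [V_findim] would make
   the whole algebra finite-dimensional; its one-dimensional representations forbid this. *)
Lemma verma_trivial_infinite (q : C) (q0 : q != 0) (A : algType C) t tb ti tbi
  (HU : @is_Uext q A t tb ti tbi) mu mub :
  verma_ideal q t tb ti tbi mu mub 1 -> ~ V_findim q t tb ti tbi mu mub.
Proof.
move=> I1 [n [v [Yv Hv]]].
have max0 x : max_sub q t tb ti tbi mu mub x -> x = 0.
  move=> H; apply: (H (fun y => y = 0)) => // [y z -> ->|N [_ IN N1]]; first by rewrite addr0.
  by case: N1; apply: IN.
pose s := s_coef q t tb o2 o1 1%N.
have Ys j : Yq q t tb ti tbi (s ^+ j).
  elim: j => [|j IH]; first exact: Yq1.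
  by rewrite exprS; apply: YqM => //; apply: Yq_s.
have /choice[cc Hcc] : forall j : nat, exists c : 'I_n -> C, s ^+ j = \sum_k c k *: v k.
  by move=> j; have [c /max0/eqP] := Hv _ (Ys j); rewrite subr_eq0 => /eqP E; exists c.
pose M : 'M[C]_(n.+1, n) := \matrix_(j, k) cc j k.
pose b := nz_row (kermx M).
have b0 : b != 0.
  rewrite nz_row_eq0 kermx_eq0; apply/negP => /eqP rk.
  by have := rank_leq_col M; rewrite rk ltnn.
have bM : b *m M = 0 by apply/sub_kermxP/nz_row_sub.
have bs : \sum_(j < n.+1) b 0 j *: s ^+ j = 0.
  under eq_bigr => j _ do rewrite Hcc scaler_sumr.
  rewrite exchange_big big1 // => k _; under eq_bigr => j _ do rewrite scalerA.
  rewrite -scaler_suml; have /matrixP/(_ 0 k) := bM; rewrite !mxE => E.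
  by under eq_bigr => j _ do rewrite -(mxE matrix_key (fun j k => cc j k) j k); rewrite E scale0r.
pose p : {poly C} := \poly_(j < n.+1) b 0 (inord j).
have p0 : p = 0.
  apply: poly_eq_nz => x x0; rewrite horner0.
  pose f (r : nat) : C := match r with 0%N => 1 | 1%N => - x | _ => 0 end.
  have f0 : f 0%N != 0 by rewrite oner_neq0.
  have [m [rho [xi [[fD fZ fM f1] xi0 _ hA _]]]] := rep_hom HU (has_rep_scalar q f0).
  have sx : rho s *m xi = x *: xi.
    rewrite hA /ser_mul !big_ord_recl big_ord0 /= /bump /= ?subSS ?subn0 ?subnn /= !mulr0 !mulr1 add0r addr0.
    by rewrite opprK.
  have rho0 : rho 0 = 0 by rewrite -(scale0r 0) fZ scale0r.
  have sX j : rho (s ^+ j) *m xi = x ^+ j *: xi.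
    elim: j => [|j IH]; first by rewrite f1 mul1mx scale1r.
    rewrite exprS fM -[LHS](@mulmxA _ _ _ _ _ (rho s) (rho (s ^+ j)) xi) IH -scalemxAr sx scalerA.
    by rewrite mulrC -exprS.
  have fS k (F : 'I_k -> A) : rho (\sum_a F a) *m xi = \sum_a (rho (F a) *m xi).
    elim: k F => [|k IH] F; first by rewrite !big_ord0 rho0 mul0mx.
    by rewrite !big_ord_recl fD mulmxDl IH.
  have := congr1 (fun y => rho y *m xi) bs; rewrite fS rho0 mul0mx.
  under eq_bigr => j _ do rewrite fZ -scalemxAl sX scalerA.
  rewrite -scaler_suml => /eqP; rewrite scaler_eq0 (negPf xi0) orbF => /eqP E.
  by rewrite horner_poly -[RHS]E; apply: eq_bigr => j _; rewrite inord_val.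
case/negP: b0; apply/eqP/matrixP => i j; rewrite (ord1 i) mxE.
have : p`_j = 0 by rewrite p0 coef0.
by rewrite coef_poly ltn_ord inord_val.
Qed.

Lemma ser_mulC (f g : nat -> C) r : ser_mul f g r = ser_mul g f r.
Proof.
rewrite /ser_mul (reindex_inj rev_ord_inj); apply: eq_bigr => i _.
by rewrite [val (rev_ord i)]/= subSS mulrC subKn // -ltnS.
Qed.

Lemma smul_recr f (p : {poly C}) r : smul f p r = \sum_(a < r) f a * p`_(r - a) + f r * p`_0.
Proof. by rewrite /smul /ser_mul big_ord_recr /= subnn. Qed.

Lemma smul_inj (p : {poly C}) f g : p`_0 != 0 -> (forall r, smul f p r = smul g p r) -> forall r, f r = g r.
Proof.
move=> p0 E r; elim/ltn_ind: r => r IH.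
have := E r; rewrite !smul_recr (eq_bigr (fun a : 'I_r => g a * p`_(r - a))) => [|a _].
  by move=> /addrI /(mulIf p0).
by rewrite IH.
Qed.

Lemma smul_surj (p : {poly C}) g : p`_0 != 0 -> exists f, forall r, smul f p r = g r.
Proof.
move=> p0.
pose nxt (l : seq C) := (g (size l) - \sum_(a < size l) l`_a * p`_(size l - a)) / p`_0.
pose gs n := iter n (fun l => rcons l (nxt l)) [::].
have sz n : size (gs n) = n by elim: n => [//|n IH]; rewrite /gs /= size_rcons IH.
have st n k : (k < n)%N -> (gs n)`_k = (gs k.+1)`_k.
  elim: n => [//|n IH]; rewrite ltnS leq_eqVlt => /orP[/eqP -> //|kn].
  by rewrite -IH // [gs n.+1]/gs iterS -/(gs n) nth_rcons sz kn.
exists (fun n => (gs n.+1)`_n) => r; rewrite smul_recr.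
rewrite (eq_bigr (fun a : 'I_r => (gs r)`_a * p`_(r - a))) => [|a _]; last by rewrite (st r).
rewrite [gs r.+1]/gs iterS -/(gs r) nth_rcons sz ltnn eqxx /nxt sz divfK //.
by rewrite addrC subrK.
Qed.

Lemma coef_comp_scaleX (p : {poly C}) c i : (p \Po (c *: 'X))`_i = c ^+ i * p`_i.
Proof.
elim/poly_ind: p i => [|p d IH] i; first by rewrite comp_poly0 coef0 mulr0.
rewrite comp_polyD comp_polyM comp_polyX comp_polyC !coefD !coefMX !coefC -scalerAr coefZ coefMX.
by case: i => [|i] /=; rewrite ?mulr0 ?addr0 ?add0r ?expr0 ?mul1r // IH exprS mulrA.
Qed.

Lemma rev_polyM d e (p r : {poly C}) : (size p <= d.+1)%N -> (size r <= e.+1)%N ->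
  rev_poly (d + e) (p * r) = rev_poly d p * rev_poly e r.
Proof.
move=> pd re; apply: rev_poly_eq => [|x x0].
  apply: (leq_trans (size_polyMleq _ _)); have := leq_add pd re; rewrite addSn addnS.
  by case: (size p + size r)%N.
by rewrite !hornerM !horner_rev_poly // exprD mulrACA.
Qed.

Ltac hsimp := rewrite -?polyC1 !(hornerM, hornerD, hornerN, hornerZ, hornerX, hornerC).

Section Factor.
Variables (q : C) (q0 : q != 0).

Definition pair_poly (a : C) : {poly C} := (1 - a^-1 *: 'X) * (1 - (a / q ^+ 2) *: 'X).
Local Notation dil p := (p \Po (q ^+ 2 *: 'X)).

Lemma size_lin (x y : C) : (size (x%:P - y *: 'X)%R <= 2)%N.
Proof.
apply: (leq_trans (size_polyD _ _)); rewrite geq_max (leq_trans (size_polyC_leq1 _)) //= size_polyN.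
by apply: (leq_trans (size_scale_leq _ _)); rewrite size_polyX.
Qed.

Lemma size_pair a : (size (pair_poly a) <= 3)%N.
Proof.
have := size_polyMleq (1 - a^-1 *: 'X) (1 - (a / q ^+ 2) *: 'X).
move=> /leq_trans; apply; rewrite -polyC1.
have := leq_add (size_lin 1 a^-1) (size_lin 1 (a / q ^+ 2)).
by case: (_ + _)%N.
Qed.

Lemma size_dil (p : {poly C}) : size (dil p) = size p.
Proof. by rewrite size_comp_poly2 // size_scale ?size_polyX // expf_neq0. Qed.

Lemma rev_pair a : a != 0 -> rev_poly 2 (pair_poly a) = q^-1 *: (evw q a o2 * evwb q a o1).
Proof.
move=> a0; apply: rev_poly_eq => [|x x0]; first exact: size_pair.
by rewrite /pair_poly /evw /evwb /=; hsimp; field; rewrite ?a0 ?x0 ?q0.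
Qed.

Lemma rev_dil_pair a : a != 0 -> rev_poly 2 (dil (pair_poly a)) = q *: (evwb q a o2 * evw q a o1).
Proof.
move=> a0; apply: rev_poly_eq => [|x x0]; first by rewrite size_dil size_pair.
by rewrite /pair_poly /evw /evwb /=; rewrite horner_comp; hsimp; field; rewrite ?a0 ?x0 ?q0.
Qed.

Lemma dil_pair a : a != 0 -> rev_poly 2 (pair_poly a) = q ^- 2 *: dil (pair_poly a).
Proof.
move=> a0; apply: rev_poly_eq => [|x x0]; first exact: size_pair.
by rewrite /pair_poly hornerZ horner_comp; hsimp; field; rewrite ?a0 ?x0 ?q0.
Qed.

Lemma pair_at0 a : (pair_poly a).[0] = 1.
Proof. by rewrite /pair_poly; hsimp; rewrite !mulr0 !subr0 mulr1. Qed.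

Lemma pair_factorization k (P : {poly C}) : size P = k.*2.+1 -> P`_0 = 1 ->
  rev_poly k.*2 P = q ^- k.*2 *: dil P ->
  exists2 s : seq C, all (fun a => a != 0) s & size s = k /\ P = \prod_(a <- s) pair_poly a.
Proof.
elim: k P => [|k IH] P sP P0 fP.
  exists [::] => //; split=> //; rewrite big_nil.
  have s1 : (size P <= 1)%N by rewrite sP.
  by rewrite (size1_polyC s1) P0.
set D := (k.+1).*2 in sP fP *.
have fe x : x != 0 -> x ^+ D * P.[x^-1] = q ^- D * P.[q ^+ 2 * x].
  move=> x0; have := congr1 (fun p : {poly C} => p.[x]) fP.
  by rewrite horner_rev_poly ?sP // hornerZ horner_comp hornerZ hornerX.
have [a ra] : exists a, root P a.
  by apply/(@closed_rootP (Rdefinitions.R)[i] P); rewrite sP.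
have a0 : a != 0.
  by apply/eqP => a0; move: ra; rewrite a0 rootE horner_coef0 P0 oner_eq0.
pose b := q ^+ 2 / a.
have ab : a * b = q ^+ 2 by rewrite /b mulrC divfK.
have qD : q ^- D != 0 by rewrite invr_eq0 expf_neq0.
have rb : root P b.
  have := fe a^-1; rewrite invr_eq0 invrK => /(_ a0); rewrite (eqP ra) mulr0 => /esym/eqP.
  by rewrite mulf_eq0 (negPf qD).
have [Q PQ] := factor_theorem P a ra.
have Qb : root Q b.
  have [eab|nab] := eqVneq a b; last first.
    move: rb; rewrite PQ rootM root_XsubC => /orP[//|/eqP e]; by rewrite e eqxx in nab.
  have a2 : q ^+ 2 = a ^+ 2 by rewrite -ab -eab expr2.
  pose W := rev_poly D.-1 Q + (q ^- D * a) *: dil Q.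
  have sQ : (size Q <= D.-1.+1)%N.
    have Qn0 : Q != 0 by apply: contra_eq_neq sP => Q0; rewrite PQ Q0 mul0r size_poly0.
    by have := sP; rewrite PQ size_Mmonic ?monicXsubC // size_XsubC addn2 /= => -[->].
  have WE y : y != 0 -> W.[y] = y ^+ D.-1 * Q.[y^-1] + q ^- D * a * Q.[q ^+ 2 * y].
    by move=> y0; rewrite /W hornerD horner_rev_poly // hornerZ horner_comp; hsimp.
  have : (a%:P * 'X - 1) * W = 0.
    apply: poly_eq_nz => x x0; rewrite horner0 hornerM WE //.
    hsimp; have := fe x x0; rewrite PQ; hsimp; rewrite a2 => E.
    have E' : (1 - a * x) * (x ^+ D.-1 * Q.[x^-1]) = x ^+ D * (Q.[x^-1] * (x^-1 - a)).
      have -> : x ^+ D = x * x ^+ D.-1 by rewrite -exprS.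
      by move: (x ^+ D.-1) (Q.[x^-1]) => y z; field.
    have -> : (a * x - 1) * (x ^+ D.-1 * Q.[x^-1] + q ^- D * a * Q.[a ^+ 2 * x]) =
       q ^- D * (Q.[a ^+ 2 * x] * (a ^+ 2 * x - a)) - (1 - a * x) * (x ^+ D.-1 * Q.[x^-1]) by ring.
    by rewrite E' E subrr.
  move=> /eqP; rewrite mulf_eq0 => /orP[/eqP/(congr1 (fun p : {poly C} => p.[0]))/eqP|/eqP].
    by hsimp; rewrite ?horner0 mulr0 sub0r oppr_eq0 oner_eq0.
  move=> /(congr1 (fun p : {poly C} => p.[a^-1])); rewrite horner0 WE ?invr_eq0 //.
  rewrite invrK -/b -eab exprVn.
  have -> : a ^- D.-1 = q ^- D * a.
    have -> : q ^+ D = a ^+ D by rewrite /D -mul2n !exprM a2.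
    have -> : a ^+ D = a * a ^+ D.-1 by rewrite -exprS.
    by rewrite invfM mulrAC mulVf // mul1r.
  move=> /eqP; rewrite -mulr2n -mulr_natl mulf_eq0 pnatr_eq0 /= mulf_eq0 mulf_eq0 (negPf qD) (negPf a0) /=.
  by rewrite rootE.
have [R' QR] := factor_theorem Q b Qb.
pose R := q ^+ 2 *: R'.
have PR : P = R * pair_poly a.
  rewrite PQ QR /R /pair_poly -mulrA -scalerAl scalerAr; congr (_ * _).
  apply: poly_eq_nz => x x0; hsimp; rewrite /b; field.
  by rewrite a0 q0.
have R0 : R`_0 = 1.
  by have := P0; rewrite -!horner_coef0 PR hornerM pair_at0 mulr1.
have sR : size R = k.*2.+1.
  rewrite /R size_scale ?expf_neq0 //.
  have R'n0 : R' != 0 by apply: contra_eq_neq sP => R'0; rewrite PQ QR R'0 !mul0r size_poly0.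
  have := sP; rewrite PQ QR size_Mmonic ?monicXsubC ?mulf_neq0 ?polyXsubC_eq0 //.
  by rewrite size_Mmonic ?monicXsubC // !size_XsubC !addn2 /= /D doubleS => -[].
have fR : rev_poly k.*2 R = q ^- k.*2 *: dil R.
  have pn0 : dil (pair_poly a) != 0.
    rewrite -size_poly_eq0 size_dil size_poly_eq0; apply/eqP => p0.
    by have := pair_at0 a; rewrite p0 horner0 => /eqP; rewrite eq_sym oner_eq0.
  have q2 : q ^- 2 != 0 by rewrite invr_eq0 expf_neq0.
  apply: (mulIf pn0); apply: (scalerI q2).
  have := fP; rewrite /D doubleS -addn2 {1}PR rev_polyM ?sR ?size_pair // dil_pair // PR (comp_polyM R (pair_poly a)).
  rewrite -[X in X = _ -> _]scalerAr => ->; rewrite -[in RHS]scalerAl [RHS]scalerA; congr (_ *: _).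
  by rewrite exprD invfM mulrC.
have [s s0 [ss sE]] := IH R sR R0 fR.
exists (a :: s); rewrite /= ?a0 // ss; split=> //.
by rewrite big_cons -sE mulrC.
Qed.
End Factor.

Section Main.
Variables (q : C) (q0 : q != 0) (mu mub : nat -> C).
Local Notation dil p := (p \Po (q ^+ 2 *: 'X)).
Local Notation num a := (evwb q a o2 * evw q a o1).
Local Notation den a := (evw q a o2 * evwb q a o1).

Lemma smulZl f c (p : {poly C}) r : smul (fun r => c * f r) p r = c * smul f p r.
Proof. by rewrite /smul /ser_mul mulr_sumr; apply: eq_bigr => a _; rewrite mulrA. Qed.

Lemma smul_injr f (p r : {poly C}) : f 0%N != 0 -> (forall k, smul f p k = smul f r k) -> p = r.
Proof.
move=> f0 E; apply/polyP => k; elim/ltn_ind: k => k IH.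
have := E k; rewrite /smul /ser_mul !big_ord_recl !subn0.
rewrite (eq_bigr (fun i : 'I_k => f (lift ord0 i) * r`_(k - lift ord0 i))) => [|i _].
  by move=> /addIr /(mulfI f0).
by rewrite IH // ltn_subrL /= (leq_ltn_trans _ (ltn_ord i)).
Qed.

Lemma good_P_size (P : {poly C}) : good_P q mu mub P -> size P = (size P).-1.+1.
Proof.
case=> _ P0 _ _ _; rewrite prednK // lt0n size_poly_eq0; apply/eqP => E.
by move: P0; rewrite E coef0 => /eqP; rewrite eq_sym oner_eq0.
Qed.

Lemma rev_prod (f g : C -> {poly C}) c (s : seq C) :
  (forall a, a \in s -> (size (f a) <= 3)%N /\ rev_poly 2 (f a) = c *: g a) ->
  (size (\prod_(a <- s) f a)%R <= (size s).*2.+1)%N /\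
  rev_poly (size s).*2 (\prod_(a <- s) f a) = c ^+ size s *: \prod_(a <- s) g a.
Proof.
elim: s => [_|a s IH H].
  rewrite !big_nil size_poly1 scale1r; split=> //.
  by apply: rev_poly_eq => [|x _]; rewrite ?size_poly1 // -polyC1 !hornerC expr0 mul1r.
have [fa ga] := H a (mem_head _ _).
have [fs gs] := IH (fun b bs => H b (mem_behead (s := a :: s) bs)).
rewrite !big_cons [size (a :: s)]/= doubleS -[(_.*2).+2]add2n; split.
  apply: (leq_trans (size_polyMleq _ _)); have := leq_add fa fs.
  by rewrite addSn addnS; case: (size (f a) + _)%N.
by rewrite rev_polyM // ga gs -scalerAl -scalerAr scalerA exprS.
Qed.

Lemma good_P_factor (P : {poly C}) : good_P q mu mub P -> exists s : seq C,
  all (fun a => a != 0) s /\ forall r, smul mub (\prod_(a <- s) den a) r = smul mu (\prod_(a <- s) num a) r.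
Proof.
move=> gP; have sP := good_P_size gP; case: gP => od P0 fP mu0 E.
set d := (size P).-1 in sP od fP E; have dE : d./2.*2 = d by rewrite -[RHS]odd_double_half (negPf od).
have fP' : rev_poly d./2.*2 P = q ^- d./2.*2 *: dil P by rewrite dE -(revpE sP).
have sP' : size P = d./2.*2.+1 by rewrite dE.
have [s s0 [ss PE]] := pair_factorization q0 sP' P0 fP'.
exists s; split=> // r.
have sd : d = (size s).*2 by rewrite ss dE.
have [_ R1] := @rev_prod (pair_poly q) (fun a => den a) q^-1 s (fun a as_ => conj (size_pair q a) (rev_pair q0 (allP s0 a as_))).
have [|_ R2] := @rev_prod (fun a => dil (pair_poly q a)) (fun a => num a) q s.
  by move=> a as_; split; [rewrite size_dil // size_pair|rewrite rev_dil_pair // (allP s0 a as_)].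
have dP : dil P = \prod_(a <- s) dil (pair_poly q a).
  by rewrite PE; elim: (s) => [|a l IH]; rewrite ?big_nil ?big_cons ?comp_polyC1 ?comp_polyM ?IH // -polyC1 comp_polyC.
have sdP : size (dil P) = d.+1 by rewrite size_dil.
have := E r; rewrite -!/(smul _ _ _) (revpE sP) (revpE sdP) dP {1}PE sd R1 R2 !smulZ.
move=> E'; have qs : q ^+ size s != 0 by rewrite expf_neq0.
apply: (mulfI (x := q^-1 ^+ size s)); first by rewrite expf_neq0 // invr_eq0.
rewrite E' mulrA; congr (_ * _); rewrite exprVn -addnn exprD invfM -mulrA mulVf // mulr1 //.
Qed.

Lemma good_P_findim (A : algType C) t tb ti tbi (HU : @is_Uext q A t tb ti tbi) :
  (exists P : {poly C}, good_P q mu mub P) -> V_findim q t tb ti tbi mu mub.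
Proof.
move=> [P gP]; have [s [s0 E]] := good_P_factor gP.
have mu0 : mu 0%N != 0 by case: gP.
have at0 (f : C -> {poly C}) : (\prod_(a <- s) f a)`_0 = \prod_(a <- s) (f a)`_0.
  by rewrite -horner_coef0 horner_prod; apply: eq_bigr => a _; rewrite horner_coef0.
have lin0 (x y : C) : (x%:P - y *: 'X)`_0 = x by rewrite coefB coefC coefZ coefX mulr0 subr0.
have den0 : (\prod_(a <- s) den a)`_0 != 0.
  rewrite at0 prodf_seq_neq0; apply/allP => a _ /=.
  by rewrite -horner_coef0 hornerM !horner_coef0 /evw /evwb /= -polyC1 !lin0 mul1r invr_eq0.
have [f fE] := smul_surj (fun r => - mu r) den0.
have f0 : f 0%N != 0.
  apply: contraNneq mu0 => f0; have := fE 0%N; rewrite smul_recr big_ord0 add0r f0 mul0r => /eqP.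
  by rewrite eq_sym oppr_eq0.
have smulN g (p : {poly C}) r : smul (fun r => - g r) p r = - smul g p r.
  by rewrite /smul /ser_mul -sumrN; apply: eq_bigr => a _; rewrite mulNr.
apply: (rep_findim q0 HU (has_rep_prod q0 f0 s0)) => r.
  by rewrite -/(smul _ _ r) smulM -big_split fE opprK.
rewrite ser_mulC -/(smul _ _ r) smulM mulrC -big_split /= -smulN.
apply: (smul_inj den0) => {}r; rewrite E smulM mulrC -smulM; congr smul.
by apply/funext => k; rewrite smulN fE opprK.
Qed.

Hypothesis hq : forall n : nat, (0 < n)%N -> q ^+ n != 1.

Lemma good_P_unique (P1 P2 : {poly C}) : good_P q mu mub P1 -> good_P q mu mub P2 -> P1 = P2.
Proof.
move=> g1 g2; have s1 := good_P_size g1; have s2 := good_P_size g2.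
case: g1 => _ z1 f1 mu0 E1; case: g2 => _ z2 f2 _ E2.
set d1 := (size P1).-1 in s1 f1 E1; set d2 := (size P2).-1 in s2 f2 E2.
have sd (P : {poly C}) d : size P = d.+1 -> size (dil P) = d.+1 by move=> sP; rewrite size_dil.
(* The reversal is an involution on polynomials with constant term 1, so the symmetry of P
   also expresses the reversal of P(q^2 X) through P. *)
have rd (P : {poly C}) d : size P = d.+1 -> revp P = q ^- d *: dil P -> revp (dil P) = q ^+ d *: P.
  move=> sP fP; rewrite (revpE (sd _ _ sP)); apply: rev_poly_eq => [|x x0]; first by rewrite (sd _ _ sP).
  have := congr1 (fun p : {poly C} => p.[x^-1]) fP.
  rewrite (revpE sP) horner_rev_poly ?sP ?invr_eq0 // invrK hornerZ => E.
  have -> : (dil P).[x^-1] = q ^+ d * (x^-1 ^+ d * P.[x]) by rewrite E mulrA mulfV ?mul1r // expf_neq0.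
  by rewrite hornerZ mulrCA (mulrA (x ^+ d)) exprVn mulfV ?mul1r // expf_neq0.
have H0 (P : {poly C}) d : size P = d.+1 -> revp P = q ^- d *: dil P ->
    (forall r, smul mub (revp P) r = q ^- d * smul mu (revp (dil P)) r) ->
    forall r, smul mub (dil P) r = q ^+ d * smul mu P r.
  move=> sP fP E r; have := E r; rewrite (rd _ _ sP fP) fP !smulZ => /mulfI; apply.
  by rewrite invr_eq0 expf_neq0.
have H1 := H0 _ _ s1 f1 E1; have H2 := H0 _ _ s2 f2 E2.
have e0 (P : {poly C}) d : P`_0 = 1 -> (forall r, smul mub (dil P) r = q ^+ d * smul mu P r) -> mub 0%N = q ^+ d * mu 0%N.
  by move=> P0 /(_ 0%N); rewrite !smul_recr !big_ord0 !add0r coef_comp_scaleX expr0 mul1r P0 !mulr1.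
have qd : q ^+ d1 = q ^+ d2.
  by apply: (mulIf mu0); rewrite -(e0 _ _ z1 H1) -(e0 _ _ z2 H2).
have mub0 : mub 0%N != 0 by rewrite (e0 _ _ z1 H1) mulf_neq0 ?expf_neq0.
have X : dil P1 * P2 = dil P2 * P1.
  apply: (smul_injr mub0) => r.
  have HH (P P' : {poly C}) d : (forall r, smul mub (dil P) r = q ^+ d * smul mu P r) ->
      smul mub (dil P * P') r = q ^+ d * smul mu (P * P') r.
    move=> H; rewrite -!smulM -smulZl; congr smul.
    by apply/funext => k; apply: H.
  by rewrite (HH _ _ _ H1) (HH _ _ _ H2) qd mulrC [P2 * P1]mulrC mulrC.
apply/eqP; rewrite -subr_eq0; apply/eqP; set W := P1 - P2.
have WX : dil W * P2 = W * dil P2.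
  by rewrite comp_polyB mulrBl X mulrBl (mulrC _ P2); congr (_ - _); rewrite mulrC.
apply/polyP => i; rewrite coef0; elim/ltn_ind: i => i IH.
have low (U V : {poly C}) : (forall k, (k < i)%N -> U`_k = 0) -> (U * V)`_i = U`_i * V`_0.
  by move=> U0; rewrite coefM big_ord_recr /= subnn big1 ?add0r // => k _; rewrite U0 ?mul0r.
have := congr1 (fun p : {poly C} => p`_i) WX; rewrite (low W) // low => [|k ki]; last first.
  by rewrite coef_comp_scaleX IH ?mulr0.
rewrite !coef_comp_scaleX expr0 mul1r z2 !mulr1.
case: i IH {low} => [|i] IH; first by rewrite coefB z1 z2 subrr.
move=> /eqP; rewrite -[X in _ == X]mul1r -subr_eq0 -mulrBl mulf_eq0 subr_eq0 -exprM.
by rewrite (negPf (hq _)) ?muln_gt0 //= => /eqP.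
Qed.
End Main.

Theorem theorem4p6 (q : C) (hq0 : q != 0)
  (hq : forall n : nat, (0 < n)%N -> q ^+ n != 1)
  (A : algType C) (t tb : 'I_2 -> 'I_2 -> nat -> A) (ti tbi : 'I_2 -> A)
  (HU : is_Uext q t tb ti tbi)
  (mu mub : nat -> C) :
  (V_findim q t tb ti tbi mu mub <-> exists P : {poly C}, good_P q mu mub P) /\
  (forall P1 P2 : {poly C}, good_P q mu mub P1 -> good_P q mu mub P2 -> P1 = P2).
Proof.
split; last exact: good_P_unique.
split=> [fd|]; last exact: good_P_findim.
have [I1|I1] := pselect (verma_ideal q t tb ti tbi mu mub 1).
  by case: (verma_trivial_infinite hq0 HU I1).
have [N [M]] := findim_hw_module hq0 hq HU.1 I1 fd.
exact: (hw_good_P hq0 hq M (mub0_neq0 hq0 HU.1 I1)).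
Qed.
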